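(* The two specific elements $A,B\in\mathcal G(3311)_{4,+}$ described in the context (with dual generators $\check A,\check B$) satisfy the box jellyfish relations $$\begin{pmatrix} f\cdot j(\check A)\\ f\cdot j(\check B)\end{pmatrix}=R\begin{pmatrix} f(A\circ A)\\ f(A\circ B)\\ f(B\circ A)\\ f(B\circ B)\end{pmatrix},\qquad \begin{pmatrix} f\cdot j(A)\\ f\cdot j(B)\end{pmatrix}=\check R\begin{pmatrix} f(\check A\circ \check A)\\ f(\check A\circ \check B)\\ f(\check B\circ \check A)\\ f(\check B\circ \check B)\end{pmatrix},$$ where $$R=\begin{pmatrix} 0 & \lambda_{121,0,78,0,9}^{(0.7029 i)} & \lambda_{121,0,78,0,9}^{(-0.7029 i)} & 0\\[4pt] \frac{-137208-77672\sqrt3}{172163} & \frac{-33708-32332\sqrt3}{172163} & \frac{-33708-32332\sqrt3}{172163} & \frac{52626+80142\sqrt3}{172163}\end{pmatrix}$$ and $\check R=(\check r_{kl})$ is the $2\times4$ matrix with $\check r_{11}=\lambda_{1559184260929,0,-65569974336,0,497664}^{(-0.205052)}$, $\check r_{12}=\lambda_{3872,0,648,0,27}^{(0.27984 i)}$, $\check r_{13}=\lambda_{3872,0,648,0,27}^{(-0.27984 i)}$, $\check r_{14}=\lambda_{1559184260929,0,-1362157739172,0,2305430424}^{(0.93378)}$, $\check r_{21}=\lambda_{1559184260929,0,-23898282768,0,33872256}^{(-0.11725)}$, $\check r_{22}=\lambda_{512,0,4896,0,3267}^{(-0.850 i)}$, $\check r_{23}=\lambda_{512,0,4896,0,3267}^{(0.850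 i)}$, $\check r_{24}=\lambda_{3118368521858,0,-1989820501362,0,313826716467}^{(0.53393)}$; here $\lambda^{(z)}_{a_m,\dots,a_0}$ denotes the root of $\sum_i a_ix^i$ closest to $z$.
   Context: **Diagrams.** Let $f^{(k)}$ be the Jones–Wenzl idempotent on $k$ strands. For $S,T$ both in $P_{n,+}$ or both in $P_{n,-}$: $S\circ T$ is the diagram with $S$ on the left and $T$ on the right, distinguished regions $\star$ of both at the top, joined to each other by $n-1$ parallel strings, with the remaining $n+1$ strings of each running down to the bottom boundary; the external distinguished region is the outer region at the top and left. $j(S)$ is the diagram in which all $2n$ strings of $S$ run down to the bottom (the $\star$ of $S$ being immediately to the left of its strings) and one additional string forms an arc from the bottom boundary, over the top of $S$, back to the bottom boundary; the external distinguished region is outside this arc. $f(S\circ T)$ and $f\cdot j(S)$ denote the diagrams obtained by attaching $f^{(2n+2)}$ to the $2n+2$ strings at the bottom of $S\circ T$ and $j(S)$. **Graph planar algebra.** For a finite bipartite graph $\Gamma$ with root $*$ and Perron–Frobenius eigenvector $\dim$ (eigenvalue $\delta$), the (spherical) graph planar algebra $\mathcal G(\Gamma)$ has $\mathcal G(\Gamma)_{n,+}$ (resp. $\mathcal G(\Gamma)_{n,-}$) equal to the complex functions on closed walks (loops) $\gamma=(\gamma(0),\dots,\gamma(2n-1))$ of length $2n$ with $\gamma(0)$ at even (resp. odd) distance from $*$. An $n$-box is a rectangle with $n$ strings on top and $n$ on the bottom and distinguished region $\star$ on the left; its regions are numbered clockwise from $\star$ ($0$ = left, $1,\dots,n-1$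 = top, $n$ = right, $n+1,\dots,2n-1$ = bottom), and $\gamma(i)$ labels region $i$. Tangles act by Jones' state sum, each local maximum or minimum of a string contributing $\sqrt{\dim(v)/\dim(w)}$, with $v$ the vertex on the convex side and $w$ the vertex on the other side. The adjoint is $x^*(\gamma)=\overline{x(\gamma^{\rm rev})}$, where $\gamma^{\rm rev}$ is $\gamma$ traversed backwards from the same base point. An element is uncappable (a lowest weight vector) if joining any two adjacent boundary points by a cap gives $0$. The Fourier transform is $\mathcal F(x)(\gamma)=\sqrt{\frac{\dim\gamma(1)\dim\gamma(n+1)}{\dim\gamma(0)\dim\gamma(n)}}\;x(\gamma(1),\dots,\gamma(2n-1),\gamma(0))$, and $\rho=\mathcal F^2$. If $\rho(S)=\omega_SS$ and $\sigma_S^2=\omega_S$ is a chosen square root, then $\check S=\sigma_S^{-1}\mathcal F(S)$. **The generators.** $\Gamma=3311$ is the tree with a central vertex $c$ and four arms: arm $0$ (length $3$, its end is the root $*$), arm $1$ (length $3$), arms $2,3$ (length $1$); $\delta^2=3+\sqrt3$. Let $u_j$ be the neighbour of $c$ on arm $j$, $d_j=\dim u_j$. Here $n=4$; for a word $a=a_1a_2a_3a_4$ let $\ell(a)=(u_{a_1},c,u_{a_2},c,u_{a_3},c,u_{a_4},c)$. $A$ and $B$ are the unique uncappable elements of $\mathcal G(\Gamma)_{4,+}$ with $\rho(A)=-A$, $\rho(B)=B$ (with $\sigma_A=i$, $\sigma_B=1$), vanishing on $\ell(1111)$ and on all $\ell(a)$, $a\in\{1,2,3\}^4$, with two cyclically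 consecutive $2$'s or two cyclically consecutive $3$'s, and with $A(\ell(a))=\kappa\sqrt{d_{a_4}/d_{a_2}}\,\mathbf A(a)$, $B(\ell(a))=\kappa\sqrt{d_{a_4}/d_{a_2}}\,\mathbf B(a)$ for the words in the table, where $\kappa>0$ is the constant for which $\mathrm{Tr}(A^2)=\frac19(12+8\sqrt3)$ (and then $\mathrm{Tr}(B^2)=\frac13(9+4\sqrt3)$, $\mathrm{Tr}(AB)=0$). They are self-adjoint. Table (word: $\mathbf A$; $\mathbf B$): 1112: $\frac{9-5\sqrt3}{6}$; $\frac{9-5\sqrt3}{4}$. 1113: $\frac{3\sqrt3-5}{6}$; $\frac{\sqrt3-3}{12}$. 1123: $\frac{\sqrt3-1}{3}$; $\frac{3-\sqrt3}{6}$. 1132: $\frac{1-\sqrt3}{3}$; $\frac{3-\sqrt3}{6}$. 1212: $\frac{5\sqrt3-9}{6}$; $\frac{13\sqrt3-21}{4}$. 1213: $\frac{\sqrt3-3}{6}$; $\frac{\sqrt3-3}{4}$. 1232: $\frac{\sqrt3-1}{3}$; $\frac{7\sqrt3-15}{6}$. 1313: $\frac{7-3\sqrt3}{6}$; $\frac{1-\sqrt3}{12}$. 1323: $\frac{1-\sqrt3}{3}$; $\frac{\sqrt3-1}{6}$. 2323: $0$; $\frac{2\sqrt3-2}{3}$. *)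

(* Defs.v *)
(* MathComp and MathComp-Analysis: R is an arbitrary realType, and the complex
   numbers are R[i]. *)
From Stdlib Require Import ZArith.
From mathcomp Require Import all_boot all_order all_algebra.
From mathcomp Require Import boolp classical_sets reals.
From mathcomp.real_closed Require Import complex.
From mathcomp.zify Require ssrZ.

Set Implicit Arguments.
Unset Strict Implicit.
Unset Printing Implicit Defensive.

Import Order.TTheory GRing.Theory Num.Theory.
Local Open Scope ring_scope.
Local Open Scope complex_scope.

Section GraphPlanarAlgebra.

(* A finite bipartite graph (V, adj) with root rt. *)
Variables (R : realType) (V : finType) (adj : rel V) (rt : V).
Local Notation C := R[i].

(* The vertices at the end of a walk of length k from the root. *)
Fixpoint walk_ends (k : nat) : {set V} :=
  if k is k'.+1 then [set w | [exists v in walk_ends k', adj v w]] else [set rt].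

Definition dist (v : V) : nat := find (fun k => v \in walk_ends k) (iota 0 #|V|).

(* The parity b of a base point is the shading: b = false is "+" (even distance
   from the root) and b = true is "-".  Only n > 0 is meaningful below: for
   n = 0 a tuple of vertices does not record the base point. *)
Definition is_loop (n : nat) (b : bool) (t : (n.*2).-tuple V) : bool :=
  cycle adj t && (odd (dist (nth rt t 0)) == b).

Definition loop (n : nat) (b : bool) : Type :=
  {t : (n.*2).-tuple V | is_loop b t}.

Definition gpa (n : nat) (b : bool) : Type := {ffun loop n b -> C^o}.

Definition loop_seq (n : nat) (b : bool) (g : loop n b) : seq V := val (val g).

(* The value of x at a sequence of regions; 0 if this is not a loop of the
   right length and shading. *)
Definition value (n : nat) (b : bool) (x : gpa n b) (s : seq V) : C :=
  if obind insub (insub s : option ((n.*2).-tuple V)) is Some g then x g else 0.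

Variable dim : V -> R.

Definition perron_frobenius (delta : R) : Prop :=
  (forall v, 0 < dim v) /\
  (forall v, \sum_(w | adj v w) dim w = delta * dim v).

(* F and rho = F^2; indices of the loop are read cyclically. *)
Definition fourier (n : nat) (b : bool) (x : gpa n b) : gpa n (~~ b) :=
  [ffun g =>
     let d i := dim (nth rt (loop_seq g) (i %% n.*2)) in
     (Num.sqrt (d 1%N * d n.+1 / (d 0%N * d n)))%:C
       * value x (rot 1 (loop_seq g))].

Definition rho (n : nat) (b : bool) (x : gpa n b) : gpa n (~~ ~~ b) :=
  fourier (fourier x).

(* The dual generator sigma^-1 F(x). *)
Definition checked (n : nat) (b : bool) (sigma : C) (x : gpa n b) :
  gpa n (~~ b) := sigma^-1 *: fourier x.

(* Tangles.  A tangle in general position is cut into horizontal layers, each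
   containing one local maximum or minimum of a string or one box, next to
   vertical strings.  Strings and regions on a horizontal line are numbered from
   left to right starting with 0; string i separates the regions i and i.+1.
   - Max i : a local maximum inside region i of the line above; on the line
     below, its two ends are the strings i and i.+1.
   - Min i : a local minimum joining the strings i and i.+1 of the line above.
   - Box i x : a rectangular n-box, distinguished region on its left, attached
     to the strings i, ..., i + n - 1 above and below. *)
Inductive layer : Type :=
  | Max of nat
  | Min of nat
  | Box (i n : nat) (b : bool) of gpa n b.

(* The weight of a local extremum with v on its convex side and w on the other. *)
Definition bend_weight (v w : V) : C := (Num.sqrt (dim v / dim w))%:C.

(* The state sum.  If psi q' is the state sum of the part of a tangle above some
   layer, as a function of the labels q' of the regions met by the line just
   above this layer, then act L psi q is the state sum after adding this layer,
   as a function of the labels q on the line just below it; the sums range over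
   the labels of the regions which are cut off from the line by the layer. *)
Definition act (L : layer) (psi : seq V -> C) (q : seq V) : C :=
  let r k := nth rt q k in
  match L with
  | Max i =>
      if [&& (i.+2 < size q)%N, r i == r i.+2 & adj (r i) (r i.+1)]
      then bend_weight (r i.+1) (r i) * psi (take i q ++ drop i.+2 q)
      else 0
  | Min i =>
      \sum_(v | adj (r i) v)
        bend_weight v (r i) * psi (take i.+1 q ++ v :: drop i q)
  | Box i n _ x =>
      (* m labels the top regions 1, ..., n - 1 of the box; the bottom regions
         n + 1, ..., 2n - 1, clockwise, are read from right to left *)
      \sum_(m : n.-1.-tuple V)
        value x (r i :: m ++ r (i + n)%N :: rev (take n.-1 (drop i.+1 q)))
        * psi (take i.+1 q ++ m ++ drop (i + n) q)
  end.

(* Tangles without strings at the top; the layers are listed from top to bottom.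
   Above all layers there is a single region. *)
Definition state_sum (D : seq layer) : seq V -> C :=
  foldl (fun psi L => act L psi) (fun q => (size q == 1%N)%:R) D.

(* The element of the graph planar algebra given by a tangle all of whose strings
   end at the bottom, external distinguished region at the top and left.  The
   external regions are numbered clockwise, hence from right to left along the
   bottom. *)
Definition bottom_elt (n : nat) (b : bool) (psi : seq V -> C) : gpa n b :=
  [ffun g => psi (nth rt (loop_seq g) 0 :: rev (loop_seq g))].

(* h nested arcs, the k-th one starting inside region k. *)
Definition arcs (h : nat) : seq layer := [seq Max k | k <- iota 0 h].

(* All 2n strings of x run down to the bottom, distinguished region immediately
   to their left (the top strings turn over to the right). *)
Definition down_tangle (n : nat) (b : bool) (x : gpa n b) : seq layer :=
  rcons (arcs n) (Box 0 x).

(* j(S): the outermost of the n + 1 nested arcs is the additional string. *)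
Definition j_tangle (n : nat) (b : bool) (S : gpa n b) : seq layer :=
  rcons (arcs n.+1) (Box 1 S).

(* S o T, with both boxes turned by a quarter turn counterclockwise (a planar
   isotopy), so that their distinguished regions lie on the left: T is above S,
   the last n - 1 strings of T (bottom left) are the first n - 1 strings of S
   (top left), and the remaining strings leave on the right and bend down. *)
Definition circ_tangle (n : nat) (b : bool) (S T : gpa n b) : seq layer :=
  arcs n ++ [:: Box 0 T; Max n.-1; Box 0 S].

(* For k < 2n - 1, the strings k and k.+1 of down_tangle x are capped off.  For
   k = 2n - 1, the last and the first boundary points of x are joined around the
   distinguished region, through the additional arc of j_tangle x. *)
Definition capped_tangle (n : nat) (b : bool) (x : gpa n b) (k : nat) :
  seq layer :=
  if (k < n.*2.-1)%N then rcons (down_tangle x) (Min k)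
  else j_tangle x ++ [:: Min 0; Min n.*2.-2].

Definition uncappable (n : nat) (b : bool) (x : gpa n b) : Prop :=
  forall (k : nat) (q : seq V), (k < n.*2)%N ->
    state_sum (capped_tangle x k) q = 0.

(* Tr(xy), with values in the functions on vertices of parity b: x is stacked on
   top of y and the strings are closed up on the right. *)
Definition trace_mul (n : nat) (b : bool) (x y : gpa n b) (v : V) : C :=
  state_sum (arcs n ++ [:: Box 0 x; Box 0 y] ++ [seq Min k | k <- rev (iota 0 n)])
    [:: v].

Variable delta : R.

Fixpoint qint (k : nat) : R :=
  match k with
  | 0 => 0
  | k'.+1 => if k' is k''.+1 then delta * qint k' - qint k'' else 1
  end.

(* f^(k) attached below the first k strings, by Wenzl's recursion
   f^(k+1) = f^(k) - [k]/[k+1] f^(k) E_k f^(k), where f^(k) also stands for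
   f^(k) with a string on its right and E_k is Min (k - 1) above Max (k - 1). *)
Fixpoint jones_wenzl (k : nat) (psi : seq V -> C) (q : seq V) : C :=
  match k with
  | 0 => psi q
  | k'.+1 =>
      if k' == 0%N then psi q
      else jones_wenzl k' psi q
           - (qint k' / qint k)%:C
             * jones_wenzl k'
                 (act (Max k'.-1) (act (Min k'.-1) (jones_wenzl k' psi))) q
  end.

Definition f_circ (n : nat) (b : bool) (S T : gpa n b) : gpa n.+1 b :=
  bottom_elt n.+1 b (jones_wenzl (n.*2).+2 (state_sum (circ_tangle S T))).

Definition f_j (n : nat) (b : bool) (S : gpa n b) : gpa n.+1 (~~ b) :=
  bottom_elt n.+1 (~~ b) (jones_wenzl (n.*2).+2 (state_sum (j_tangle S))).

End GraphPlanarAlgebra.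

(* The tree 3311:
     0 - 1 - 2 - 3 - 4 - 5 - 6,   3 - 7,   3 - 8
   with root 0, central vertex 3, and u_0, u_1, u_2, u_3 = 2, 4, 7, 8. *)
Section Graph3311.
Local Open Scope nat_scope.

Definition edges3311 : seq (nat * nat) :=
  [:: (0, 1); (1, 2); (2, 3); (3, 4); (4, 5); (5, 6); (3, 7); (3, 8)].

Definition adj3311 : rel 'I_9 := fun v w =>
  ((v : nat, w : nat) \in edges3311) || ((w : nat, v : nat) \in edges3311).

Definition root3311 : 'I_9 := Ordinal (isT : 0 < 9).
Definition c3311 : 'I_9 := Ordinal (isT : 3 < 9).
Definition u3311 (j : nat) : 'I_9 :=
  nth root3311 [:: Ordinal (isT : 2 < 9); Ordinal (isT : 4 < 9);
                   Ordinal (isT : 7 < 9); Ordinal (isT : 8 < 9)] j.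

(* l(a), for a word a of length 4 in the letters 0, ..., 3. *)
Definition ell (a : seq nat) : seq 'I_9 :=
  flatten [seq [:: u3311 j; c3311] | j <- a].

Definition bad_word (a : seq nat) : bool :=
  [&& size a == 4, all (fun j => j \in [:: 1; 2; 3]) a
    & has (fun p => (p.1 == p.2) && (p.1 \in [:: 2; 3])) (zip a (rot 1 a))].

End Graph3311.

Notation gpa3311 R := (@gpa R 'I_9 adj3311 root3311).

Section Generators.
Variable R : realType.
Local Notation C := R[i].
Local Notation s3 := (Num.sqrt 3 : R).

(* The entries (a, (A(a), B(a))) of the table. *)
Definition table3311 : seq (seq nat * (R * R)) :=
  [:: ([:: 1; 1; 1; 2]%N, ((9 - 5 * s3) / 6, (9 - 5 * s3) / 4));
      ([:: 1; 1; 1; 3]%N, ((3 * s3 - 5) / 6, (s3 - 3) / 12));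
      ([:: 1; 1; 2; 3]%N, ((s3 - 1) / 3, (3 - s3) / 6));
      ([:: 1; 1; 3; 2]%N, ((1 - s3) / 3, (3 - s3) / 6));
      ([:: 1; 2; 1; 2]%N, ((5 * s3 - 9) / 6, (13 * s3 - 21) / 4));
      ([:: 1; 2; 1; 3]%N, ((s3 - 3) / 6, (s3 - 3) / 4));
      ([:: 1; 2; 3; 2]%N, ((s3 - 1) / 3, (7 * s3 - 15) / 6));
      ([:: 1; 3; 1; 3]%N, ((7 - 3 * s3) / 6, (1 - s3) / 12));
      ([:: 1; 3; 2; 3]%N, ((1 - s3) / 3, (s3 - 1) / 6));
      ([:: 2; 3; 2; 3]%N, (0, (2 * s3 - 2) / 3))].

Definition vanishing (x : gpa3311 R 4 false) : Prop :=
  value x (ell [:: 1; 1; 1; 1]%N) = 0 /\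
  (forall a : seq nat, bad_word a -> value x (ell a) = 0).

Definition prescribed (dim : 'I_9 -> R) (kappa : R) (x : gpa3311 R 4 false)
    (a : seq nat) (t : R) : Prop :=
  value x (ell a) =
    (kappa * Num.sqrt (dim (u3311 (nth 0%N a 3)) / dim (u3311 (nth 0%N a 1)))
       * t)%:C.

(* The description which determines A, B and kappa. *)
Definition generators3311 (dim : 'I_9 -> R) (kappa : R)
    (A B : gpa3311 R 4 false) : Prop :=
  [/\ [/\ uncappable dim A, rho dim A = - A & vanishing A],
      [/\ uncappable dim B, rho dim B = B & vanishing B],
      (forall a tA tB, (a, (tA, tB)) \in table3311 ->
         prescribed dim kappa A a tA /\ prescribed dim kappa B a tB),
      0 < kappa
    & (forall v, ~~ odd (dist adj3311 root3311 v) ->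
         trace_mul dim A A v = ((12 + 8 * s3) / 9)%:C)].

(* Integers are given in binary, as numerals of ring_scope are unary. *)
Definition ofZ (k : Z) : R := (ssrZ.int_of_Z k)%:~R.

(* decimal m k = m * 10^(-k). *)
Definition decimal (m : Z) (k : nat) : R := ofZ m / 10 ^+ k.

(* lambda_{a_m, ..., a_0}^(z), for a = [:: a_m; ...; a_0]. *)
Definition lambda (a : seq Z) (z : C) : C :=
  let p := Poly [seq (ofZ k)%:C | k <- rev a] in
  xget z [set r | root p r /\ forall s, root p s -> `|r - z| <= `|s - z|].

End Generators.

Arguments ofZ {R} k%_Z_scope.
Arguments decimal {R} m%_Z_scope k%_nat_scope.
Arguments lambda {R} a%_Z_scope z.

Section RelationMatrices.
Variable R : realType.
Local Notation C := R[i].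
Local Notation s3 := (Num.sqrt 3 : R).

(* 2 x 4 matrices listed row by row. *)
Definition mx24 (e : seq (seq C)) : 'M[C]_(2, 4) :=
  \matrix_(k < 2, l < 4) nth 0 (nth [::] e k) l.

Section Entries.
Local Open Scope Z_scope.

Definition relR : 'M[C]_(2, 4) := mx24
  [:: [:: 0%R;
          lambda [:: 121; 0; 78; 0; 9] (decimal 7029 4)*i;
          lambda [:: 121; 0; 78; 0; 9] (decimal (-7029) 4)*i;
          0%R];
      [:: ((ofZ (-137208) - ofZ 77672 * s3) / ofZ 172163)%R%:C;
          ((ofZ (-33708) - ofZ 32332 * s3) / ofZ 172163)%R%:C;
          ((ofZ (-33708) - ofZ 32332 * s3) / ofZ 172163)%R%:C;
          ((ofZ 52626 + ofZ 80142 * s3) / ofZ 172163)%R%:C]].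

Definition relRcheck : 'M[C]_(2, 4) := mx24
  [:: [:: lambda [:: 1559184260929; 0; -65569974336; 0; 497664]
                 (decimal (-205052) 6)%:C;
          lambda [:: 3872; 0; 648; 0; 27] (decimal 27984 5)*i;
          lambda [:: 3872; 0; 648; 0; 27] (decimal (-27984) 5)*i;
          lambda [:: 1559184260929; 0; -1362157739172; 0; 2305430424]
                 (decimal 93378 5)%:C];
      [:: lambda [:: 1559184260929; 0; -23898282768; 0; 33872256]
                 (decimal (-11725) 5)%:C;
          lambda [:: 512; 0; 4896; 0; 3267] (decimal (-850) 3)*i;
          lambda [:: 512; 0; 4896; 0; 3267] (decimal 850 3)*i;
          lambda [:: 3118368521858; 0; -1989820501362; 0; 313826716467]
                 (decimal 53393 5)%:C]].

End Entries.

End RelationMatrices.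

(* The columns of the box jellyfish relations. *)
Definition j_column (R : realType) (dim : 'I_9 -> R) (delta : R) (b : bool)
    (S T : gpa3311 R 4 b) : 2.-tuple (gpa3311 R 5 (~~ b)) :=
  [tuple f_j dim delta S; f_j dim delta T].

Definition circ_column (R : realType) (dim : 'I_9 -> R) (delta : R) (b : bool)
    (S T : gpa3311 R 4 b) : 4.-tuple (gpa3311 R 5 b) :=
  [tuple f_circ dim delta S S; f_circ dim delta S T;
         f_circ dim delta T S; f_circ dim delta T T].

(* Main.v *)
Require Import Defs.
From Stdlib Require Import ZArith.
From mathcomp Require Import all_boot all_order all_algebra.
From mathcomp Require Import boolp classical_sets functions reals.
From mathcomp.real_closed Require Import complex.
From mathcomp Require Import zify ssrZ ring lra.

Set Implicit Arguments.
Unset Strict Implicit.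
Unset Printing Implicit Defensive.

Import Order.TTheory GRing.Theory Num.Theory.
Local Open Scope ring_scope.
Local Open Scope complex_scope.

(** Attaching the Jones-Wenzl idempotent f to ten strings and evaluating at a
    loop is a linear functional of the diagram above, and since f kills cups this
    functional factors through the quotient by cups. Expanding a diagram in the
    walks that label its regions along the ten strings, the functional becomes a
    function nu of walks with

      sum over the neighbours w of v of nu (a v w v b) = 0,

    the relations of the preprojective algebra of the graph (wenzl_kills,
    jones_wenzl_pairing). A relation between diagrams therefore holds under f as
    soon as its coefficients vanish modulo the relations of that algebra, for
    walks from each of the nine vertices.

    The coefficients are brought into Z[sqrt 3]. Multiplying the value of a box
    at a loop by suitable square roots of dimensions (hat) turns the Fourier
    transform into the rotation of loops, turns uncappability into linear
    relations whose coefficients are dimensions, and gives the state sums of j(S)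
    and of S o T coefficients which are rational in the dimensions, up to a
    factor of the base vertex which they share (j_tangleE, circ_tangleE,
    hat_fourier). The dimensions of 3311 are elements of Z[sqrt 3] times t or
    t delta, and the units t and delta can be collected once and for all.

    The values of A and B at all loops follow from the table: caps move a loop
    towards loops in the letters 1, 2, 3 through the centre, and the rotation
    eigenvalue takes care of the base point (evalh_sound). The only loops needed
    as input are those of the words in the table and of 1111. The trace of A^2 at
    the root then fixes kappa = 1 (kappa1).

    It remains to reduce the combinations of walks. A spike v w v, with w the
    neighbour of v towards a chosen leaf, is replaced by the other spikes at v;
    the walks which remain carry no spike towards the leaf except at the leaf
    itself, where a spike is 0 in the algebra. The coefficients vanish after
    adding a few explicit multiples of walks with a spike at the leaf
    (certificates, check_row_sound). All of this is one evaluation of a boolean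
    (check_true).

    Finally the entries of the matrices are roots of biquadratic polynomials
    over Z whose squares lie in Q(sqrt 3). The four roots lie on the real or on
    the imaginary axis together with the given approximation, and the nearest one
    is singled out by inequalities between elements of Z[sqrt 3]
    (lambda_biquadratic). *)

(** * Jones-Wenzl projections kill cups *)

Section WenzlRecursion.
Variables (K : fieldType) (M : lmodType K) (P : M -> Prop).
Variables (m : nat) (e : nat -> M -> M) (d : K) (qi : nat -> K).

Hypothesis P_lin : forall a x y, P x -> P y -> P (a *: x + y).
Hypothesis P_e : forall i x, (i < m)%N -> P x -> P (e i x).
Hypothesis e_lin : forall i a x y, e i (a *: x + y) = a *: e i x + e i y.
Hypothesis eK : forall i x, (i < m)%N -> P x -> e i (e i x) = d *: e i x.
Hypothesis e_braid : forall i x, (i.+1 < m)%N -> P x ->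
  e i.+1 (e i (e i.+1 x)) = e i.+1 x.
Hypothesis e_far : forall i j x, (i.+1 < j < m)%N -> P x ->
  e i (e j x) = e j (e i x).
Hypothesis qi0 : qi 0 = 0.
Hypothesis qi1 : qi 1 = 1.
Hypothesis qiSS : forall k, qi k.+2 = d * qi k.+1 - qi k.
Hypothesis qi_neq0 : forall k, qi k.+1 != 0.

(** Wenzl's recursion for any linear operators e i satisfying the Temperley-
    Lieb relations on the vectors of P. The relations are asked for on P only,
    because the operators which come from functions on sequences of regions
    satisfy them only on functions supported on walks. *)
Fixpoint wenzl (k : nat) (x : M) : M :=
  match k with
  | 0 => x
  | k'.+1 => if k' == 0%N then x else
      wenzl k' x - (qi k' / qi k) *: wenzl k' (e k'.-1 (wenzl k' x))
  end.

Lemma wenzlSS k x : wenzl k.+2 x =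
  wenzl k.+1 x - (qi k.+1 / qi k.+2) *: wenzl k.+1 (e k (wenzl k.+1 x)).
Proof. by []. Qed.

Lemma wenzl_lin k a x y : wenzl k (a *: x + y) = a *: wenzl k x + wenzl k y.
Proof.
elim: k a x y => [//|[//|k] IH] a x y.
rewrite !wenzlSS !IH e_lin IH; set c := _ / _.
rewrite !scalerBr scalerDr !scalerA opprD [c * a]mulrC !addrA.
by congr (_ - _); rewrite addrAC.
Qed.

Lemma e0 i : e i 0 = 0.
Proof.
have /eqP := e_lin i 1 0 0.
by rewrite !scale1r addr0 -subr_eq0 opprD addNKr oppr_eq0 => /eqP.
Qed.

Lemma e_sub i x a y : e i (x - a *: y) = e i x - a *: e i y.
Proof. by rewrite -!scaleNr [x + _]addrC e_lin addrC. Qed.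

Lemma wenzl_sub k x a y : wenzl k (x - a *: y) = wenzl k x - a *: wenzl k y.
Proof. by rewrite -!scaleNr [x + _]addrC wenzl_lin addrC. Qed.

Lemma wenzl0 k : wenzl k 0 = 0.
Proof.
have /eqP := wenzl_lin k 1 0 0.
by rewrite !scale1r addr0 -subr_eq0 opprD addNKr oppr_eq0 => /eqP.
Qed.

Lemma wenzl_scale k a x : wenzl k (a *: x) = a *: wenzl k x.
Proof. by rewrite -[a *: x in LHS]addr0 wenzl_lin wenzl0 addr0. Qed.

Lemma P_sub a x y : P x -> P y -> P (x - a *: y).
Proof. by move=> Px Py; rewrite addrC -scaleNr; apply: P_lin. Qed.

Lemma P_wenzl k x : (k <= m.+1)%N -> P x -> P (wenzl k x).
Proof.
elim: k x => [//|[//|k] IH] x km Px.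
have Pw : P (wenzl k.+1 x) by apply: IH Px; apply: ltnW.
rewrite wenzlSS; apply: P_sub => //.
by apply: IH (ltnW km) _; apply: P_e.
Qed.

Lemma wenzl_e_far k i x : (k <= i < m)%N -> P x ->
  wenzl k (e i x) = e i (wenzl k x).
Proof.
elim: k x => [//|[//|k] IH] x /andP[ki im] Px.
have kim : (k.+1 <= i < m)%N by rewrite im ltnW.
have km : (k.+1 <= m.+1)%N by lia.
have Pw : P (wenzl k.+1 x) by apply: P_wenzl.
have ek : (k < m)%N by lia.
rewrite !wenzlSS e_sub IH // e_far ?ki //.
by rewrite IH //; apply: P_e.
Qed.

(** Expanding wenzl j turns every term but the first into wenzl k applied to
    some e i with i.+1 < k, so a projection which kills cups absorbs the
    smaller ones. *)
Lemma wenzl_absorb k j x :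
  (forall i y, (i.+1 < k)%N -> P y -> wenzl k (e i y) = 0) ->
  (j <= k)%N -> (k <= m.+1)%N -> P x -> wenzl k (wenzl j x) = wenzl k x.
Proof.
move=> kill; elim: j x => [//|[//|j] IH] x jk km Px.
have jm : (j.+1 <= m.+1)%N by apply: leq_trans (ltnW jk) km.
have Pw : P (wenzl j.+1 x) by apply: P_wenzl.
have je : (j < m)%N by rewrite -ltnS; apply: leq_trans jk km.
rewrite wenzlSS wenzl_sub IH ?(ltnW jk) //.
rewrite IH ?(ltnW jk) //; last exact: P_e.
by rewrite kill // scaler0 subr0.
Qed.

(** Closing off the last string of the projection: the two terms of the
    recursion contribute d and - qi k / qi k.+1, and d qi k.+1 - qi k is qi
    k.+2. *)
Lemma wenzl_partial_trace k x : (k < m)%N -> P x ->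
  (forall i y, (i.+1 < k)%N -> P y -> wenzl k (e i y) = 0) ->
  e k (wenzl k.+1 (e k x)) = (qi k.+2 / qi k.+1) *: e k (wenzl k x).
Proof.
case: k => [|k] km Px kill.
  by rewrite eK // qiSS qi1 qi0 mulr1 subr0 divr1.
have Pw : P (wenzl k.+1 x) by apply: P_wenzl => //; lia.
have k'm : (k < m)%N by apply: ltnW.
rewrite wenzlSS [wenzl k.+1 (e k.+1 x)]wenzl_e_far ?leqnn //.
have Pe : P (e k (e k.+1 (wenzl k.+1 x))) by do 2! apply: P_e => //.
rewrite e_sub eK // -[e k.+1 (wenzl _ (e k _))]wenzl_e_far ?leqnn //.
rewrite e_braid // wenzl_e_far ?leqnn //.
rewrite wenzl_absorb //; last by lia.
by rewrite -scalerBl [qi k.+3]qiSS mulrBl mulfK.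
Qed.

(** Only the cup at the last two strings is not already killed by the smaller
    projection. For that cup wenzl_partial_trace produces the factor qi k.+2 /
    qi k.+1, and the coefficient in Wenzl's recursion is its inverse. *)
Lemma wenzl_kills k : (k <= m.+1)%N ->
  forall i x, (i.+1 < k)%N -> P x -> wenzl k (e i x) = 0.
Proof.
elim/ltn_ind: k => -[//|[//|k]] IH km i x ik Px.
have km1 : (k < m)%N by [].
have kill : forall i y, (i.+1 < k.+1)%N -> P y -> wenzl k.+1 (e i y) = 0.
  by apply: IH => //; apply: ltnW.
rewrite wenzlSS; case: (ltnP i.+1 k.+1) => [ik'|].
  by rewrite kill // e0 wenzl0 scaler0 subr0.
move=> ki; have {ik ki} -> : i = k by lia.
rewrite wenzl_partial_trace //; last by apply: IH => //; apply/ltnW/ltnW.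
rewrite -wenzl_e_far ?leqnn // wenzl_scale wenzl_absorb //; first last.
- exact: P_e.
- by lia.
by rewrite scalerA mulrA divfK // divff // scale1r subrr.
Qed.

End WenzlRecursion.

(** * The Temperley-Lieb action on functions of walks *)

Section WalkFunctions.
Variables (R : realType) (V : finType) (adj : rel V) (rt : V) (dim : V -> R).
Variable delta : R.
Local Notation C := R[i].
Local Notation "q ``_ k" := (nth rt q k) (at level 3, k at level 2).

Hypothesis adjC : symmetric adj.
Hypothesis pf : perron_frobenius adj dim delta.

Definition rdim (v : V) : C := (Num.sqrt (dim v))%:C.

Lemma dim_gt0 v : 0 < dim v. Proof. by case: pf. Qed.

Lemma rdim_neq0 v : rdim v != 0.
Proof. by rewrite /rdim fmorph_eq0 gt_eqF // sqrtr_gt0 dim_gt0. Qed.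

Lemma rdim2 v : rdim v * rdim v = (dim v)%:C.
Proof. by rewrite -rmorphM /= -expr2 sqr_sqrtr // ltW // dim_gt0. Qed.

Lemma bend_weightE v w : bend_weight dim v w = rdim v / rdim w.
Proof.
rewrite /bend_weight /rdim sqrtrM ?ltW ?dim_gt0 // sqrtrV ?ltW ?dim_gt0 //.
by rewrite rmorphM fmorphV.
Qed.

Definition walk (n : nat) (q : seq V) : bool := (size q == n) && sorted adj q.

Definition on_walks (n : nat) (psi : seq V -> C^o) : Prop :=
  forall q, ~~ walk n q -> psi q = 0.

(** The Temperley-Lieb generator: a cap above a cup. *)
Definition tl (k : nat) (psi : seq V -> C^o) : seq V -> C^o :=
  act dim (@Max R V adj rt k) (act dim (@Min R V adj rt k) psi).

Lemma tlE k psi q : (k.+2 < size q)%N ->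
  tl k psi q =
  if (q``_k == q``_k.+2) && adj q``_k q``_k.+1 then
    rdim q``_k.+1 / rdim q``_k *
      \sum_(v | adj q``_k v) rdim v / rdim q``_k * psi (set_nth rt q k.+1 v)
  else 0.
Proof.
move=> kq; rewrite /tl /act kq /=.
case: ifP => // /andP[/eqP qk _]; rewrite bend_weightE.
have k1q : (k < size q)%N by apply: ltn_trans kq.
have stk : size (take k q) = k by rewrite size_takel // ltnW.
have pk : nth rt (take k q ++ drop k.+2 q) k = q``_k.
  by rewrite nth_cat stk ltnn subnn nth_drop addn0 -qk.
congr (_ * _); rewrite pk; apply: eq_bigr => v _.
rewrite bend_weightE; congr (_ * psi _).
rewrite set_nthE (ltn_trans _ kq) //; congr (_ ++ _ :: _); last first.
  by rewrite drop_size_cat.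
rewrite take_cat stk ltnNge leqnSn /= subSn // subnn.
by rewrite (drop_nth rt kq) /= take0 -qk (take_nth rt k1q) cats1.
Qed.

Lemma set_spike k q v : (k.+2 < size q)%N -> q``_k == q``_k.+2 ->
  set_nth rt q k.+1 v = take k q ++ [:: q``_k, v, q``_k & drop k.+3 q].
Proof.
move=> kq /eqP qk; rewrite set_nthE (ltn_trans _ kq) //.
rewrite (take_nth rt); last by lia.
by rewrite cat_rcons (drop_nth rt kq) -qk.
Qed.

Lemma sorted_spike a x y b : adj x y ->
  sorted adj (a ++ [:: x, y, x & b]) = sorted adj (a ++ x :: b).
Proof. by case: a => [|c a] xy; rewrite /= ?cat_path /= [adj y x]adjC !xy. Qed.

Lemma walk_set n k q v : (k.+2 < size q)%N -> q``_k == q``_k.+2 ->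
  adj q``_k q``_k.+1 -> adj q``_k v -> walk n (set_nth rt q k.+1 v) = walk n q.
Proof.
move=> kq qk a1 a2; have k1q : (k.+1 < size q)%N by apply: ltn_trans kq.
have {2}-> : q = set_nth rt q k.+1 q``_k.+1.
  by rewrite set_nthE k1q -drop_nth // cat_take_drop.
rewrite /walk !size_set_nth !(set_spike _ kq qk).
by rewrite !sorted_spike.
Qed.

Lemma on_walks_tl n k psi : on_walks n psi -> on_walks n (tl k psi).
Proof.
move=> wpsi q nwq; case: (ltnP k.+2 (size q)) => kq; last first.
  by rewrite /tl /act ltnNge kq.
rewrite tlE //; case: ifP => // /andP[qk a1]; rewrite big1 ?mulr0 // => v a2.
by rewrite wpsi ?mulr0 // walk_set.
Qed.

Lemma nth_set i k q v : (set_nth rt q k v)``_i = if i == k then v else q``_i.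
Proof. by rewrite nth_set_nth. Qed.

Lemma walk_adj n q k : walk n q -> (k.+1 < n)%N -> adj q``_k q``_k.+1.
Proof. by case/andP=> /eqP <- /(sortedP rt) /[apply]. Qed.

Lemma tl_set k psi q v : (k.+2 < size q)%N ->
  tl k psi (set_nth rt q k.+1 v) =
  if (q``_k == q``_k.+2) && adj q``_k v then
    rdim v / rdim q``_k *
      \sum_(w | adj q``_k w) rdim w / rdim q``_k * psi (set_nth rt q k.+1 w)
  else 0.
Proof.
move=> kq; rewrite tlE; last by rewrite size_set_nth leq_max kq orbT.
rewrite !nth_set eqxx (ltn_eqF (ltnSn k)) (gtn_eqF (ltnSn k.+1)).
by case: ifP => // _; under eq_bigr do rewrite set_set_nth eqxx.
Qed.

Lemma sum_rdim2 v : \sum_(w | adj v w) rdim w / rdim v * (rdim w / rdim v) = delta%:C.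
Proof.
case: pf => _ pfv; have dv : dim v != 0 by rewrite gt_eqF // dim_gt0.
transitivity ((\sum_(w | adj v w) dim w) / dim v)%:C.
  rewrite rmorphM rmorph_sum fmorphV mulr_suml; apply: eq_bigr => w _.
  by rewrite mulrACA rdim2 -invfM rdim2.
by rewrite pfv mulfK.
Qed.

Lemma tlK n k psi : (k.+2 < n)%N -> on_walks n psi ->
  tl k (tl k psi) = delta%:C *: tl k psi.
Proof.
move=> kn wpsi; apply/funext => q; rewrite fctE /=.
case: (boolP (walk n q)) => [wq|nwq]; last first.
  by rewrite !(@on_walks_tl n) ?scaler0 //; apply: on_walks_tl.
have kq : (k.+2 < size q)%N by case/andP: wq => /eqP ->.
rewrite [tl k psi q]tlE // tlE //; case: ifP => [/andP[qk a1]|]; last by rewrite scaler0.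
rewrite /= -[RHS]/(_ * _) mulrCA; congr (_ * _).
under eq_bigr => v a2 do rewrite tl_set // qk a2 mulrA.
by rewrite -mulr_suml sum_rdim2.
Qed.

Lemma set_nth_id q k v : (k < size q)%N -> v = q``_k -> set_nth rt q k v = q.
Proof. by move=> kq ->; rewrite set_nthE kq -drop_nth // cat_take_drop. Qed.

(** Of the two neighbouring sums, the conditions on the spikes leave only the
    label that restores the walk, and the weights of the extrema cancel. *)
Lemma tl_braid n k psi : (k.+3 < n)%N -> on_walks n psi ->
  tl k.+1 (tl k (tl k.+1 psi)) = tl k.+1 psi.
Proof.
move=> kn wpsi; apply/funext => q.
case: (boolP (walk n q)) => [wq|nwq]; last first.
  by rewrite !(@on_walks_tl n) //; do ?apply: on_walks_tl.
have kq : (k.+3 < size q)%N by case/andP: wq => /eqP ->.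
have k1 : adj q``_k q``_k.+1 by apply: walk_adj wq _; lia.
have neq i j : (i == j + i.+1)%N = false by apply/negbTE; lia.
rewrite [LHS]tlE // [RHS]tlE //; case: ifP => // /andP[/eqP qk a1].
congr (_ * _); rewrite (bigD1 q``_k) /=; last by rewrite adjC.
rewrite [X in _ + X]big1 ?addr0 => [|v /andP[_ vk]]; last first.
  rewrite tlE; last by rewrite size_set_nth; lia.
  by rewrite !nth_set eqxx (neq k 1%N) eq_sym (negbTE vk) mulr0.
rewrite tlE; last by rewrite size_set_nth; lia.
rewrite !nth_set !eqxx (neq k 1%N) (neq k.+1 0%N) eqxx k1 /=.
rewrite (bigD1 q``_k.+1) //= [X in _ + X]big1 ?addr0 => [|v /andP[_ vk]]; last first.
  rewrite tlE; last by rewrite !size_set_nth; lia.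
  rewrite !nth_set !eqxx.
  rewrite (gtn_eqF (ltnSn k.+2)) (gtn_eqF (ltnW (ltnSn k.+2))).
  by rewrite -qk (negbTE vk) mulr0.
rewrite set_nth_id; first last.
- by rewrite nth_set (ltn_eqF (ltnSn k.+1)).
- by rewrite size_set_nth; lia.
rewrite tl_set // -qk eqxx adjC k1 /= !mulrA.
have n1 := rdim_neq0 q``_k.+1; have n0 := rdim_neq0 q``_k.
by rewrite -[RHS]mul1r; congr (_ * _); field; rewrite n1 n0.
Qed.

Lemma tl_far n i j psi : (i.+1 < j)%N -> (j.+2 < n)%N -> on_walks n psi ->
  tl i (tl j psi) = tl j (tl i psi).
Proof.
move=> ij jn wpsi; apply/funext => q.
case: (boolP (walk n q)) => [wq|nwq]; last first.
  by rewrite !(@on_walks_tl n) //; do ?apply: on_walks_tl.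
have jq : (j.+2 < size q)%N by case/andP: wq => /eqP ->.
have iq : (i.+2 < size q)%N by lia.
have nej x y : (x < y)%N -> (x == y) = false by move/ltn_eqF.
rewrite [LHS]tlE // [RHS]tlE //.
under eq_bigr => v _.
  rewrite tlE; last by rewrite size_set_nth; lia.
  have -> : (set_nth rt q i.+1 v)``_j = q``_j by rewrite nth_set gtn_eqF.
  have -> : (set_nth rt q i.+1 v)``_j.+1 = q``_j.+1.
    by rewrite nth_set gtn_eqF // ltnW.
  have -> : (set_nth rt q i.+1 v)``_j.+2 = q``_j.+2.
    by rewrite nth_set gtn_eqF // ltnW // ltnW.
  over.
under [in RHS]eq_bigr => v _.
  rewrite tlE; last by rewrite size_set_nth; lia.
  have -> : (set_nth rt q j.+1 v)``_i = q``_i by rewrite nth_set ltn_eqF //; lia.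
  have -> : (set_nth rt q j.+1 v)``_i.+1 = q``_i.+1.
    by rewrite nth_set ltn_eqF //; lia.
  have -> : (set_nth rt q j.+1 v)``_i.+2 = q``_i.+2.
    by rewrite nth_set ltn_eqF //; lia.
  over.
case: ifP => _; case: ifP => _ //=; do ?by rewrite big1 ?mulr0 // => v _; rewrite mulr0.
under eq_bigr do rewrite mulrCA mulr_sumr.
under [in RHS]eq_bigr do rewrite mulrCA mulr_sumr.
rewrite -mulr_sumr -[in RHS]mulr_sumr mulrCA exchange_big /=.
congr (_ * (_ * _)).
apply: eq_bigr => v _; apply: eq_bigr => w _.
by rewrite set_set_nth ltn_eqF 1?mulrCA //; lia.
Qed.

Lemma fct_linE a (x y : seq V -> C^o) q : (a *: x + y) q = a * x q + y q.
Proof. by []. Qed.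

Lemma fct_subE a (x y : seq V -> C^o) q : (x - a *: y) q = x q - a * y q.
Proof. by []. Qed.

Lemma tl_lin k a x y : tl k (a *: x + y) = a *: tl k x + tl k y.
Proof.
apply/funext => q; rewrite fct_linE /tl /act.
case: ifP => _; last by rewrite mulr0 addr0.
rewrite mulrCA -mulrDr; congr (_ * _).
rewrite mulr_sumr -big_split.
by apply: eq_bigr => v _; rewrite fct_linE mulrDr mulrCA.
Qed.

Lemma jones_wenzlE k psi q :
  jones_wenzl adj rt dim delta k psi q =
  wenzl tl (fun k => (qint delta k)%:C) k psi q.
Proof.
elim: k psi q => [//|[//|k] IH] psi q.
rewrite wenzlSS -scaleNr addrC fct_linE addrC mulNr -fmorph_div -IH.
have -> : wenzl tl (fun k => (qint delta k)%:C) k.+1 psi =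
    jones_wenzl adj rt dim delta k.+1 psi by apply/funext => p; rewrite IH.
by rewrite -IH.
Qed.

Hypothesis delta_ge2 : 2 <= delta.

(** For delta at least 2 the quantum integers increase, so that all the
    denominators in Wenzl's recursion are nonzero. *)
Lemma qint_gt0 k : 0 < qint delta k.+1.
Proof.
suff : (0 < qint delta k.+1) && (qint delta k <= qint delta k.+1) by case/andP.
elim: k => [|k /andP[IH1 IH2]]; first by rewrite /= ltr01 ler01.
have IH3 : qint delta k.+1 <= qint delta k.+2.
  have -> : qint delta k.+2 = delta * qint delta k.+1 - qint delta k by [].
  have : 0 <= (delta - 2) * qint delta k.+1 by rewrite mulr_ge0 ?subr_ge0 // ltW.
  by move: IH2; set a := qint delta k.+1; set b := qint delta k; lra.
by rewrite IH3 andbT (lt_le_trans IH1).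
Qed.

Definition wt (q : seq V) : C := \prod_(v <- q) rdim v.

Lemma wt_neq0 q : wt q != 0.
Proof. by rewrite /wt prodf_seq_neq0; apply/allP => v _; rewrite rdim_neq0. Qed.

(** The indicator of a walk, weighted so that all the spikes at a given place
    get the same coefficient in a cup. *)
Definition spot (g : seq V) : seq V -> C^o :=
  fun q => if q == g then wt q else 0.

Lemma on_walks_spot n g : walk n g -> on_walks n (spot g).
Proof. by move=> wg q nwq; rewrite /spot; case: eqP nwq => // ->; rewrite wg. Qed.

Lemma on_walks_lin n a x y : on_walks n x -> on_walks n y -> on_walks n (a *: x + y).
Proof. by move=> wx wy q nq; rewrite fct_linE wx // wy // mulr0 addr0. Qed.

Definition jw (n : nat) : (seq V -> C^o) -> (seq V -> C^o) :=
  wenzl tl (fun k => (qint delta k)%:C) n.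

Lemma jones_wenzl_jw k psi q : jones_wenzl adj rt dim delta k psi q = jw k psi q.
Proof. exact: jones_wenzlE. Qed.

Local Arguments jw : simpl never.

Lemma jw_lin n a x y : jw n (a *: x + y) = a *: jw n x + jw n y.
Proof. exact/wenzl_lin/tl_lin. Qed.

Lemma jw_scale n a x : jw n (a *: x) = a *: jw n x.
Proof. exact/wenzl_scale/tl_lin. Qed.

Lemma jw_sum n I (r : seq I) (F : I -> seq V -> C^o) :
  jw n (\sum_(i <- r) F i) = \sum_(i <- r) jw n (F i).
Proof.
elim: r => [|i r IH]; first by rewrite !big_nil; exact/wenzl0/tl_lin.
by rewrite !big_cons -IH -[F i in LHS]scale1r jw_lin scale1r.
Qed.

Lemma jw_kills_tl n i x : (i < n)%N -> on_walks n.+2 x -> jw n.+1 (tl i x) = 0.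
Proof.
move=> i_n wx; apply: (@wenzl_kills _ _ (on_walks n.+2) n _ delta%:C) => //.
- exact: on_walks_lin.
- by move=> k y _; apply: on_walks_tl.
- exact: tl_lin.
- by move=> k y kn; apply: tlK; lia.
- by move=> k y kn; apply: tl_braid; lia.
- by move=> k j y kjn; apply: tl_far; lia.
- by move=> k; rewrite -rmorphM -rmorphB.
- by move=> k; rewrite fmorph_eq0 gt_eqF // qint_gt0.
Qed.

Section Spots.
Variables (a b : seq V) (v : V).
Let q w := a ++ [:: v, w, v & b].
Let k := size a.

Lemma nth_spike w : [/\ (q w)``_k = v, (q w)``_k.+1 = w & (q w)``_k.+2 = v].
Proof.
by rewrite /q /k !nth_cat !ltnNge leqnn leqW // leqW // subnn subSnn -addn2 addKn.
Qed.

Lemma size_spike w : (k.+2 < size (q w))%N.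
Proof. by rewrite /q /k size_cat /=; lia. Qed.

Lemma set_spikes w u : set_nth rt (q w) k.+1 u = q u.
Proof.
have [n0 n1 n2] := nth_spike w; have kq := size_spike w.
rewrite set_spike // ?n0 ?n2 // /q /k take_size_cat // drop_cat.
by rewrite ltnNge -addn3 leq_addr /= addKn /= drop0.
Qed.

Lemma spikes_inj w u : q w = q u -> w = u.
Proof. by move=> wu; have [_ <- _] := nth_spike w; rewrite wu; case: (nth_spike u). Qed.

Lemma wt_spike w : wt (q w) * rdim v / rdim w = wt (a ++ v :: b) * rdim v * rdim v.
Proof.
have := rdim_neq0 w; rewrite /wt !big_cat !big_cons /=; set x := \prod_(_ <- b) _.
by move: (\prod_(_ <- a) _) => y w0; field.
Qed.

(** Summing out the label of one region amounts to applying a cap and a cup: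
    with the weights of spot every label counts the same. *)
Lemma spots_cup u : adj v u ->
  \sum_(w <- enum (adj v)) spot (q w) = ((dim v)%:C / (dim u)%:C) *: tl k (spot (q u)).
Proof.
move=> vu; apply/funext => p; rewrite -!rdim2.
rewrite -[RHS]/(_ * _).
have -> : (\sum_(w <- enum (adj v)) spot (q w)) p = \sum_(w <- enum (adj v)) spot (q w) p.
  by elim/big_rec2: _ => // w y1 y2 _ <-.
rewrite big_enum /=.
have [[w vw ->]|nop] : (exists2 w, adj v w & p = q w) \/ ~ (exists2 w, adj v w & p = q w).
- exact: EM.
- have [n0 n1 n2] := nth_spike w.
  rewrite (bigD1 w) //= big1 => [|w' /andP[_ /eqP ww']]; last first.
    by rewrite /spot; case: eqP => // /spikes_inj w'w; case: ww'.
  rewrite addr0 tlE ?size_spike // n0 n1 n2 eqxx vw.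
  rewrite (bigD1 u) //= big1 => [|w' /andP[_ /eqP ww']]; last first.
    by rewrite /spot set_spikes; case: eqP => [/spikes_inj//|]; rewrite mulr0.
  rewrite addr0 set_spikes /spot !eqxx.
  have := wt_spike w; have := wt_spike u; have := rdim_neq0.
  move=> r0 <- /(canRL (divfK (r0 _))) /(canRL (mulfK (r0 _))) ->.
  by field; rewrite !r0.
rewrite big1 => [|w vw]; last by rewrite /spot; case: eqP => // pw; case: nop; exists w.
case: (ltnP k.+2 (size p)) => [kp|]; last first.
  by move=> kp; rewrite /tl /act ltnNge kp mulr0.
rewrite tlE //; case: ifP => [/andP[/eqP pk pk1]|_]; last by rewrite mulr0.
rewrite big1 ?mulr0 // => w _; rewrite /spot; case: eqP; rewrite ?mulr0 // => pq.
have pv : p``_k = v.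
  by have [<- _ _] := nth_spike u; rewrite -pq nth_set ltn_eqF.
case: nop; exists p``_k.+1; first by rewrite -pv.
rewrite -(set_spikes u) -pq set_set_nth eqxx set_nth_id //.
by apply: ltn_trans kp.
Qed.

Lemma jw_spots n u : (size a + size b + 3 = n.+2)%N -> adj v u -> walk n.+2 (q u) ->
  jw n.+1 (\sum_(w <- enum (adj v)) spot (q w)) = 0.
Proof.
move=> ab vu wq; rewrite (spots_cup vu) jw_scale jw_kills_tl ?scaler0 //.
  by rewrite /k; lia.
exact: on_walks_spot.
Qed.

End Spots.

Lemma on_walksE n psi : on_walks n psi ->
  psi = \sum_(t : n.-tuple V | sorted adj t) (psi t / wt t) *: spot t.
Proof.
move=> wpsi; apply/funext => q.
have -> : (\sum_(t : n.-tuple V | sorted adj t) (psi t / wt t) *: spot t) q =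
    \sum_(t : n.-tuple V | sorted adj t) psi t / wt t * spot t q.
  by elim/big_rec2: _ => // t y1 y2 _ <-.
case: (boolP (walk n q)) => [wq|nwq]; last first.
  rewrite wpsi // big1 // => t st; rewrite /spot; case: eqP => [qt|]; last by rewrite mulr0.
  by case/negP: nwq; rewrite qt /walk size_tuple eqxx.
have /andP[qn sq] := wq.
rewrite (bigD1 (Tuple qn)) //= /spot eqxx divfK ?wt_neq0 // big1 ?addr0 // => t.
by case/andP=> _ tq; case: eqP => [qt|]; rewrite ?mulr0 //; case/eqP: tq; apply/val_inj.
Qed.

Lemma tl_ext n k x y : (k.+2 < n)%N -> (forall q, walk n q -> x q = y q) ->
  forall q, walk n q -> tl k x q = tl k y q.
Proof.
move=> kn xy q wq; have kq : (k.+2 < size q)%N by case/andP: wq => /eqP ->.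
rewrite !tlE //; case: ifP => // /andP[qk a1]; congr (_ * _).
by apply: eq_bigr => v a2; rewrite xy // walk_set.
Qed.

Lemma sub_congr (a1 a2 b1 b2 c x y : C) :
  a1 = a2 -> b1 = b2 -> x = a1 - c * b1 -> y = a2 - c * b2 -> x = y.
Proof. by move=> -> -> -> ->. Qed.

Lemma jwSS k x q : jw k.+2 x q = (jw k.+1 x q : C) -
  (qint delta k.+1)%:C / (qint delta k.+2)%:C * (jw k.+1 (tl k (jw k.+1 x)) q : C) :> C.
Proof. by rewrite /jw wenzlSS fct_subE. Qed.

Lemma jw01 x : (jw 0 x = x) * (jw 1 x = x).
Proof. by []. Qed.

Local Opaque jw.

(** The projection on k strings looks only at walks, although it is defined on
    all functions of sequences; this lets psi be replaced by its restriction
    to walks. *)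
Lemma jw_ext n k x y : (k < n)%N -> (forall q, walk n q -> x q = y q) ->
  forall q, walk n q -> jw k x q = jw k y q.
Proof.
elim: k x y => [|[|k] IH] x y kn xy q wq; try by rewrite !jw01 xy.
have {}IH z t : (forall q, walk n q -> z q = t q) ->
    forall q, walk n q -> jw k.+1 z q = jw k.+1 t q by apply: IH; apply: ltnW.
have tlxy q' : walk n q' -> tl k (jw k.+1 x) q' = tl k (jw k.+1 y) q'.
  by apply: tl_ext => //; apply: (IH x y).
have e1 := IH x y xy q wq; have e2 := IH _ _ tlxy q wq.
exact: sub_congr e1 e2 (jwSS k x q) (jwSS k y q).
Qed.

(** The functional psi |-> (f psi)(q0), read in the basis of weighted
    indicators of walks, has coefficients nu. Since f kills cups and spots_cup
    writes a cup as a sum over the label at the tip of a spike, nu satisfies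
    the relations of the preprojective algebra of the graph. *)
Lemma jones_wenzl_pairing n q0 : walk n.+2 q0 -> exists nu : seq V -> C,
  (forall a v b, \sum_(w | adj v w) nu (a ++ [:: v, w, v & b]) = 0) /\
  (forall psi, jones_wenzl adj rt dim delta n.+1 psi q0 =
     \sum_(t : n.+2.-tuple V | sorted adj t) psi t / wt t * nu t).
Proof.
(* Changing the tip of a spike preserves being a walk, so the terms of a relation
   are all walks or are all set to 0. *)
move=> wq0; exists (fun g => if walk n.+2 g then jw n.+1 (spot g) q0 else 0); split; last first.
  move=> psi; rewrite jones_wenzl_jw.
  pose psi' : seq V -> C^o := fun q => if walk n.+2 q then psi q else 0.
  have wpsi : on_walks n.+2 psi' by move=> q /negbTE; rewrite /psi' => ->.
  rewrite (@jw_ext n.+2 n.+1 _ psi') //; last by move=> q wq; rewrite /psi' wq.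
  rewrite {1}(on_walksE wpsi).
  rewrite -big_enum jw_sum /= big_enum /=.
  have -> : forall F : n.+2.-tuple V -> seq V -> C^o,
    (\sum_(t : n.+2.-tuple V | sorted adj t) F t) q0 =
     \sum_(t : n.+2.-tuple V | sorted adj t) F t q0.
    by move=> F; elim/big_rec2: _ => // t y1 y2 _ <-.
  by apply: eq_bigr => t st; rewrite jw_scale /psi'; have -> : walk n.+2 t by rewrite /walk size_tuple eqxx.
move=> a v b; case: (pickP (fun w => adj v w && walk n.+2 (a ++ [:: v, w, v & b]))).
  move=> u /andP[vu wu].
  have wall w : adj v w -> walk n.+2 (a ++ [:: v, w, v & b]).
    move=> vw; move: wu; rewrite /walk !size_cat /= => /andP[-> /=].
    by rewrite !sorted_spike.
  under eq_bigr => w vw do rewrite wall //.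
  rewrite -big_enum; transitivity (jw n.+1 (\sum_(w <- enum (adj v))
      spot (a ++ [:: v, w, v & b])) q0).
    by rewrite jw_sum; elim/big_rec2: _ => // t y1 y2 _ ->.
  rewrite (jw_spots _ vu) //.
  by case/andP: wu => /eqP; rewrite size_cat /=; lia.
move=> no; rewrite big1 // => w vw; case: ifP => // wq.
by have := no w; rewrite vw wq.
Qed.

(** * State sums of the tangles *)

Lemma big_tupleS (I : finType) n (F : seq I -> C) :
  \sum_(t : n.+1.-tuple I) F t = \sum_x \sum_(t : n.-tuple I) F (x :: t).
Proof.
rewrite pair_big /= (reindex (fun p : I * n.-tuple I => [tuple of p.1 :: p.2])) //=.
exists (fun t : n.+1.-tuple I => (thead t, behead_tuple t)) => [[x t] _|t _] /=.
  by congr pair; apply: val_inj.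
by rewrite [RHS]tuple_eta; apply: val_inj.
Qed.

Lemma big_tuple0 (I : finType) (F : seq I -> C) :
  \sum_(t : 0.-tuple I) F t = F [::].
Proof.
rewrite (bigD1 [tuple]) //= big1 ?addr0 // => t /negP[].
by apply/eqP/val_inj; case: t => -[].
Qed.

(** The coordinates of a box in which no square roots of dimensions are left:
    the Fourier transform becomes a rotation of the loop, and the state sums
    of the tangles get coefficients which are rational in the dimensions, up
    to a factor of the base vertex. *)
Definition hat (n : nat) (b : bool) (x : gpa R adj rt n b) (g : seq V) : C :=
  value x g * rdim g``_0 * rdim g``_n / wt g.

Lemma big_tuple3 (F : seq V -> C) :
  \sum_(t : 3.-tuple V) F t = \sum_u \sum_v \sum_w F [:: u; v; w].
Proof.
rewrite big_tupleS; apply: eq_bigr => u _.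
rewrite (big_tupleS _ (fun t => F (u :: t))); apply: eq_bigr => v _.
rewrite (big_tupleS _ (fun t => F [:: u, v & t])); apply: eq_bigr => w _.
by rewrite (big_tuple0 (fun t => F [:: u, v, w & t])).
Qed.

(** The arcs above a box force the labels of its three upper regions. *)
Lemma big_pick3 (a b c : V) (F : V -> V -> V -> C) :
  (forall u v w, [&& u == a, v == b & w == c] = false -> F u v w = 0) ->
  \sum_u \sum_v \sum_w F u v w = F a b c.
Proof.
move=> F0; rewrite (bigD1 a) //= [X in _ + X]big1 ?addr0 => [|u /negbTE ua]; last first.
  by do 2![rewrite big1 // => ? _]; rewrite F0 ?ua.
rewrite (bigD1 b) //= [X in _ + X]big1 ?addr0 => [|v /negbTE vb]; last first.
  by rewrite big1 // => ? _; rewrite F0 // vb andbF.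
rewrite (bigD1 c) //= [X in _ + X]big1 ?addr0 // => w /negbTE wc.
by rewrite F0 // wc !andbF.
Qed.

Lemma arcsS n q : state_sum dim (arcs R adj rt n.+1) q =
  act dim (Max R adj rt n) (state_sum dim (arcs R adj rt n)) q.
Proof. by rewrite /state_sum /arcs -[n.+1]addn1 iotaD map_cat /= foldl_cat. Qed.

Lemma arcs4E (p0 m1 m2 m3 p4 p5 p6 p7 p8 : V) :
  state_sum dim (arcs R adj rt 4) [:: p0; m1; m2; m3; p4; p5; p6; p7; p8] =
  if [&& m3 == p5, m2 == p6, m1 == p7, p0 == p8 & path adj p4 [:: p5; p6; p7; p8]]
  then rdim p4 / rdim p0 else 0.
Proof.
rewrite !arcsS /state_sum /= !bend_weightE mulr1 andbT.
have [r1 r2 r3] := And3 (rdim_neq0 m1) (rdim_neq0 m2) (rdim_neq0 m3).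
have [<-|] //= := eqVneq m3 p5.
have [<-|] /= := eqVneq m2 p6; last by rewrite mulr0 if_same.
have [<-|] /= := eqVneq m1 p7; last by rewrite !(mulr0, if_same).
have [<-|] /= := eqVneq p0 p8; last by rewrite !(mulr0, if_same).
rewrite (adjC p4) (adjC m3 m2) (adjC m2 m1) (adjC m1 p0).
case: (adj m3 p4) (adj m2 m3) (adj m1 m2) (adj p0 m1) => [] [] [] [] //=;
  rewrite ?mulr0 //.
by field; rewrite r1 r2 r3 rdim_neq0.
Qed.

Lemma arcs5E (p0 p1 m1 m2 m3 p5 p6 p7 p8 p9 p10 : V) :
  state_sum dim (arcs R adj rt 5) [:: p0; p1; m1; m2; m3; p5; p6; p7; p8; p9; p10] =
  if [&& m3 == p6, m2 == p7, m1 == p8, p1 == p9, p0 == p10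
       & path adj p5 [:: p6; p7; p8; p9; p10]]
  then rdim p5 / rdim p0 else 0.
Proof.
rewrite !arcsS /state_sum /= !bend_weightE mulr1 andbT.
have [r1 r2 r3 r4] := And4 (rdim_neq0 m1) (rdim_neq0 m2) (rdim_neq0 m3) (rdim_neq0 p1).
have [<-|] //= := eqVneq m3 p6.
have [<-|] /= := eqVneq m2 p7; last by rewrite mulr0 if_same.
have [<-|] /= := eqVneq m1 p8; last by rewrite !(mulr0, if_same).
have [<-|] /= := eqVneq p1 p9; last by rewrite !(mulr0, if_same).
have [<-|] /= := eqVneq p0 p10; last by rewrite !(mulr0, if_same).
rewrite (adjC p5) (adjC m3 m2) (adjC m2 m1) (adjC m1 p1) (adjC p1 p0).
case: (adj m3 p5) (adj m2 m3) (adj m1 m2) (adj p1 m1) (adj p0 p1) => [] [] [] [] [] //=;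
  rewrite ?mulr0 //.
by field; rewrite r1 r2 r3 r4 rdim_neq0.
Qed.

Lemma act_Box0 b (x : gpa R adj rt 4 b) psi q0 q1 q2 q3 q4 t :
  act dim (Box 0 x) psi [:: q0, q1, q2, q3, q4 & t] =
  \sum_u \sum_v \sum_w value x [:: q0; u; v; w; q4; q3; q2; q1] *
    psi [:: q0, u, v, w, q4 & t].
Proof.
by rewrite /act /= (big_tuple3 (fun m => value x (q0 :: m ++ [:: q4; q3; q2; q1]) *
  psi (q0 :: m ++ q4 :: t))).
Qed.

Lemma act_Box1 b (x : gpa R adj rt 4 b) psi q q0 q1 q2 q3 q4 t :
  act dim (Box 1 x) psi [:: q, q0, q1, q2, q3, q4 & t] =
  \sum_u \sum_v \sum_w value x [:: q0; u; v; w; q4; q3; q2; q1] *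
    psi [:: q, q0, u, v, w, q4 & t].
Proof.
by rewrite /act /= (big_tuple3 (fun m => value x (q0 :: m ++ [:: q4; q3; q2; q1]) *
  psi (q :: q0 :: m ++ q4 :: t))).
Qed.

Lemma down_tangleE b (x : gpa R adj rt 4 b) p0 p1 p2 p3 p4 p5 p6 p7 p8 :
  let p := [:: p0; p1; p2; p3; p4; p5; p6; p7; p8] in
  sorted adj p ->
  state_sum dim (down_tangle x) p =
  if p0 == p8 then
    hat x [:: p0; p7; p6; p5; p4; p3; p2; p1] * wt p / (rdim p0 * rdim p0 * rdim p0)
  else 0.
Proof.
move=> p sp; rewrite /state_sum /down_tangle foldl_rcons -/(state_sum _ _).
rewrite act_Box0 (@big_pick3 p7 p6 p5) => [|u v w uvw]; last first.
  rewrite arcs4E; case: ifP => [/and4P[wp vp up _]|]; rewrite ?mulr0 //.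
  by rewrite up vp wp in uvw.
have pp : path adj p4 [:: p5; p6; p7; p8].
  by move: sp; rewrite /= !andbT => /and5P[_ _ _ _ /and4P[-> -> -> ->]].
rewrite arcs4E !eqxx pp andbT /p /=; case: eqP => [<-|]; last by rewrite mulr0.
rewrite /hat /wt !big_cons !big_nil /=; field.
by rewrite !rdim_neq0.
Qed.

(** The factor 1 / (rdim q0)^3 depends on the base vertex only and is the same
    as in circ_tangleE, so it drops out of the relations. *)
Lemma j_tangleE b (x : gpa R adj rt 4 b) q0 q1 q2 q3 q4 q5 q6 q7 q8 q9 q10 :
  let q := [:: q0; q1; q2; q3; q4; q5; q6; q7; q8; q9; q10] in
  sorted adj q ->
  state_sum dim (j_tangle x) q / wt q =
  if (q0 == q10) && (q1 == q9) then
    hat x [:: q1; q8; q7; q6; q5; q4; q3; q2] / (dim q1)%:C /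
    (rdim q0 * rdim q0 * rdim q0)
  else 0.
Proof.
move=> q sq; rewrite /state_sum /j_tangle foldl_rcons -/(state_sum _ _).
rewrite act_Box1 (@big_pick3 q8 q7 q6) => [|u v w uvw]; last first.
  rewrite arcs5E; case: ifP => [/and4P[wp vp up _]|]; rewrite ?mulr0 //.
  by rewrite up vp wp in uvw.
have pp : path adj q5 [:: q6; q7; q8; q9; q10].
  by move: sq; rewrite /= !andbT => /and5P[_ _ _ _ /and5P[_ -> -> -> /andP[-> ->]]].
rewrite arcs5E !eqxx pp andbT /q /= andbC.
have [<-|] := eqVneq q0 q10; last by rewrite mulr0 mul0r.
have [<-|] /= := eqVneq q1 q9; last by rewrite mulr0 mul0r.
rewrite /hat /q /wt !big_cons !big_nil -rdim2 /=; field.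
by rewrite !rdim_neq0.
Qed.

Lemma act_Max3 psi q0 u v w q4 q5 t :
  act dim (Max R adj rt 3) psi [:: q0, u, v, w, q4, q5 & t] =
  if (w == q5) && adj w q4 then rdim q4 / rdim w * psi [:: q0, u, v, q5 & t] else 0.
Proof. by rewrite /act /= bend_weightE. Qed.

Local Arguments act : simpl never.

(** The two summed labels are those of the regions between the parallel
    strings which join the boxes; the third region at the top of the left box
    is forced by the arc to its right. *)
Lemma circ_tangleE b (x y : gpa R adj rt 4 b) q0 q1 q2 q3 q4 q5 q6 q7 q8 q9 q10 :
  let q := [:: q0; q1; q2; q3; q4; q5; q6; q7; q8; q9; q10] in
  sorted adj q ->
  state_sum dim (circ_tangle x y) q / wt q =
  if q0 == q10 then
    \sum_u \sum_v (dim u)%:C * (dim v)%:C *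
      hat x [:: q0; u; v; q5; q4; q3; q2; q1] *
      hat y [:: q0; q9; q8; q7; q6; q5; v; u] / (rdim q0 * rdim q0 * rdim q0)
  else 0.
Proof.
move=> q sq.
have -> : state_sum dim (circ_tangle x y) q = act dim (Box 0 x)
    (act dim (Max R adj rt 3) (act dim (Box 0 y) (state_sum dim (arcs R adj rt 4)))) q.
  by rewrite /state_sum /circ_tangle foldl_cat.
have pp : path adj q6 [:: q7; q8; q9; q10].
  by move: sq; rewrite /= !andbT => /and5P[_ _ _ _ /and5P[_ _ -> -> /andP[-> ->]]].
have q45 : adj q5 q4.
  by move: sq; rewrite adjC /= !andbT => /and5P[_ _ _ _ /andP[->]].
have inner u v : act dim (Box 0 y) (state_sum dim (arcs R adj rt 4))
    [:: q0; u; v; q5; q6; q7; q8; q9; q10] =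
    if q0 == q10 then value y [:: q0; q9; q8; q7; q6; q5; v; u] * (rdim q6 / rdim q0)
    else 0.
  rewrite act_Box0 (@big_pick3 q9 q8 q7) => [|u' v' w' uvw]; last first.
    rewrite arcs4E; case: ifP => [/and4P[wp vp up _]|]; rewrite ?mulr0 //.
    by rewrite up vp wp in uvw.
  by rewrite arcs4E !eqxx pp andbT /=; case: ifP => // _; rewrite mulr0.
rewrite act_Box0.
have outer u v : \sum_w value x [:: q0; u; v; w; q4; q3; q2; q1] *
    act dim (Max R adj rt 3) (act dim (Box 0 y) (state_sum dim (arcs R adj rt 4)))
      [:: q0; u; v; w; q4; q5; q6; q7; q8; q9; q10] =
    value x [:: q0; u; v; q5; q4; q3; q2; q1] * (rdim q4 / rdim q5 *
      if q0 == q10 then value y [:: q0; q9; q8; q7; q6; q5; v; u] * (rdim q6 / rdim q0)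
      else 0).
  rewrite (bigD1 q5) //= [X in _ + X]big1 => [|w /negbTE wq5].
    by rewrite addr0 act_Max3 eqxx q45 inner.
  by rewrite act_Max3 wq5 mulr0.
under eq_bigr => u _ do under eq_bigr => v _ do rewrite outer.
rewrite /q; case: ifP => [/eqP <-|_]; last first.
  by rewrite big1 ?mul0r // => u _; rewrite big1 // => v _; rewrite !mulr0.
rewrite mulr_suml; apply: eq_bigr => u _; rewrite mulr_suml; apply: eq_bigr => v _.
rewrite /hat /q /wt !big_cons !big_nil -!rdim2 /=; field.
by rewrite !rdim_neq0.
Qed.

End WalkFunctions.

(** * Boxes in the rescaled coordinates *)

Section Boxes.
Variables (R : realType) (V : finType) (adj : rel V) (rt : V) (dim : V -> R).
Variable delta : R.
Local Notation C := R[i].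
Local Notation gpa4 b := (gpa R adj rt 4 b).
Local Notation rdim := (rdim dim).

Hypothesis adjC : symmetric adj.
Hypothesis pf : perron_frobenius adj dim delta.

Lemma value_loop n b (x : gpa R adj rt n b) (g : loop adj rt n b) :
  value x (loop_seq g) = x g.
Proof.
rewrite /value /loop_seq; case: insubP => [t _ tg|]; last first.
  by rewrite size_tuple eqxx.
have -> : t = val g by apply: val_inj.
by rewrite /= valK.
Qed.

(** The boolean test for the sequences on which value is not 0 by convention. *)
Definition loopb (n : nat) (b : bool) (s : seq V) : bool :=
  [&& size s == n.*2, cycle adj s & odd (dist adj rt (nth rt s 0)) == b].

Lemma loop_of n b s : loopb n b s -> exists g : loop adj rt n b, loop_seq g = s.
Proof.
case/and3P=> sn cs ob; have L : is_loop adj rt b (Tuple sn) by rewrite /is_loop /= cs.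
by exists (exist _ (Tuple sn) L).
Qed.

Lemma value_out n b (x : gpa R adj rt n b) s : ~~ loopb n b s -> value x s = 0.
Proof.
rewrite /value; case: insubP => [t _ ts|//] /=.
case: insubP => // g gl _; case/negP; rewrite /loopb -ts.
by rewrite size_tuple eqxx.
Qed.

Lemma value_scale n b (x : gpa R adj rt n b) c s : value (c *: x) s = c * value x s.
Proof.
case: (boolP (loopb n b s)) => [/loop_of[g <-]|ns]; last by rewrite !value_out // mulr0.
by rewrite !value_loop ffunE.
Qed.

Lemma hat_scale n b (x : gpa R adj rt n b) c s : hat dim (c *: x) s = c * hat dim x s.
Proof. by rewrite /hat value_scale !mulrA. Qed.

Lemma hat_out n b (x : gpa R adj rt n b) s : ~~ loopb n b s -> hat dim x s = 0.
Proof. by move=> ns; rewrite /hat value_out // !mul0r. Qed.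

Lemma loopb_walk n b s : loopb n b s -> (0 < n)%N -> sorted adj (rcons s (head rt s)).
Proof. by case: s => [|v s] /and3P[/eqP sn cs _]; [case: n sn|]. Qed.

Hypothesis bip : forall v w, adj v w -> odd (dist adj rt w) = ~~ odd (dist adj rt v).

(** The square root in the definition of the Fourier transform is exactly the
    change of the weights sqrt(dim g_0 dim g_n) when the base point moves. *)
Lemma hat_fourier b (x : gpa4 b) s : size s = 8 ->
  hat dim (fourier dim x) s = hat dim x (rot 1 s).
Proof.
move: s => [|g0 [|g1 [|g2 [|g3 [|g4 [|g5 [|g6 [|g7 [|? ?]]]]]]]]] // _.
set s := [:: g0; _; _; _; _; _; _; _].
have dg v := dim_gt0 pf v; have rn v := rdim_neq0 pf v.
case: (boolP (loopb 4 (~~ b) s)) => [ls|ns]; last first.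
  rewrite hat_out // hat_out //; apply: contra ns.
  rewrite /loopb size_rot rot_cycle => /and3P[-> cs /eqP <-]; rewrite cs /=.
  have a01 : adj g0 g1 by case/andP: cs.
  by rewrite (bip a01) negbK.
have [g sg] := loop_of ls.
rewrite /hat -{1}sg value_loop ffunE sg /= /rot /=.
have ge v := ltW (dg v).
rewrite sqrtrM ?mulr_ge0 // sqrtrM // sqrtrV ?mulr_ge0 // sqrtrM //.
rewrite !rmorphM fmorphV rmorphM -!/(rdim _) /s /wt !big_cons !big_nil.
by field; rewrite !rn.
Qed.

Section Caps.
Variables (b : bool) (x : gpa4 b).
Hypothesis xU : uncappable dim x.

Lemma cap_sum k q : (k < 7)%N -> \sum_(v | adj (nth rt q k) v)
  rdim v / rdim (nth rt q k) * state_sum dim (down_tangle x) (take k.+1 q ++ v :: drop k q) = 0.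
Proof.
move=> k7; have := xU q (ltnW k7); rewrite /capped_tangle k7 /state_sum foldl_rcons => U.
by rewrite -[RHS]U /act; apply: eq_bigr => v _; rewrite (bend_weightE pf).
Qed.

(** The cap at the two strings next to the base point; the weight of the
    extremum and those of the coordinates combine to dim v. *)
Lemma hat_cap1 a c3 c4 c5 c6 c7 :
  \sum_(v | adj a v) (dim v)%:C * hat dim x [:: a; v; a; c3; c4; c5; c6; c7] = 0.
Proof.
case: (boolP (path adj a [:: c7; c6; c5; c4; c3; a])) => [pa|na]; last first.
  rewrite big1 // => v av; rewrite hat_out ?mulr0 //; apply: contra na.
  case/and3P=> _ + _; rewrite /= => /and5P[_ _ h3 h4 /and5P[h5 h6 h7 h8 _]].
  by rewrite (adjC a c7) h8 (adjC c7) h7 (adjC c6) h6 (adjC c5) h5 (adjC c4) h4 adjC h3.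
have := @cap_sum 6 [:: a; c7; c6; c5; c4; c3; a] isT; rewrite /=.
under eq_bigr => v av.
  rewrite (down_tangleE adjC pf) ?eqxx; last first.
    by move: pa; rewrite /= [adj v a]adjC av !andbT.
  rewrite (_ : _ * _ = wt dim [:: a; c7; c6; c5; c4; c3] / (rdim a * rdim a) *
    ((dim v)%:C * hat dim x [:: a; v; a; c3; c4; c5; c6; c7])); last first.
    by rewrite -(rdim2 pf) /wt !big_cons !big_nil; field; rewrite !(rdim_neq0 pf).
  over.
rewrite -mulr_sumr => /eqP; rewrite mulf_eq0 => /orP[|/eqP //].
by rewrite mulf_eq0 (negbTE (wt_neq0 pf _)) invr_eq0 mulf_eq0 (negbTE (rdim_neq0 pf a)).
Qed.

(** The cap around the next region. With rotations, these two positions give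
    all the caps. *)
Lemma hat_cap2 a c c4 c5 c6 c7 :
  \sum_(v | adj c v) (dim v)%:C * hat dim x [:: a; c; v; c; c4; c5; c6; c7] = 0.
Proof.
case: (boolP (path adj a [:: c7; c6; c5; c4; c; a])) => [pa|na]; last first.
  rewrite big1 // => v av; rewrite hat_out ?mulr0 //; apply: contra na.
  case/and3P=> _ + _; rewrite /= => /and5P[h1 _ _ h4 /and5P[h5 h6 h7 h8 _]].
  by rewrite (adjC a c7) h8 (adjC c7) h7 (adjC c6) h6 (adjC c5) h5 (adjC c4) h4 adjC h1.
have := @cap_sum 5 [:: a; c7; c6; c5; c4; c; a] isT; rewrite /=.
under eq_bigr => v av.
  rewrite (down_tangleE adjC pf) ?eqxx; last first.
    by move: pa; rewrite /= [adj v c]adjC av.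
  rewrite (_ : _ * _ = wt dim [:: a; c7; c6; c5; c4; c] / (rdim a * rdim a) *
    ((dim v)%:C * hat dim x [:: a; c; v; c; c4; c5; c6; c7])); last first.
    by rewrite -(rdim2 pf) /wt !big_cons !big_nil; field; rewrite !(rdim_neq0 pf).
  over.
rewrite -mulr_sumr => /eqP; rewrite mulf_eq0 => /orP[|/eqP //].
by rewrite mulf_eq0 (negbTE (wt_neq0 pf _)) invr_eq0 mulf_eq0 (negbTE (rdim_neq0 pf a)).
Qed.

End Caps.

(** The trace in the rescaled coordinates is a sum of products with rational
    weights in the dimensions. *)
Lemma trace_mulE b (x y : gpa4 b) v :
  trace_mul dim x y v =
  \sum_(p1 | adj v p1) \sum_(p2 | adj p1 p2) \sum_(p3 | adj p2 p3) \sum_(p4 | adj p3 p4)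
  \sum_m1 \sum_m2 \sum_m3
    (dim p1)%:C * (dim p2)%:C * (dim p3)%:C * (dim p4)%:C / (dim v)%:C *
    (dim m1)%:C * (dim m2)%:C * (dim m3)%:C *
    hat dim x [:: v; p1; p2; p3; p4; m3; m2; m1] *
    hat dim y [:: v; m1; m2; m3; p4; p3; p2; p1].
Proof.
have -> : trace_mul dim x y v = act dim (Min R adj rt 0) (act dim (Min R adj rt 1)
   (act dim (Min R adj rt 2) (act dim (Min R adj rt 3) (act dim (Box 0 y)
     (state_sum dim (down_tangle x)))))) [:: v].
  by rewrite /trace_mul /down_tangle -cats1 /state_sum !foldl_cat.
rewrite /= /act.
apply: eq_bigr => p1 _; rewrite mulr_sumr; apply: eq_bigr => p2 _.
rewrite mulrA !mulr_sumr; apply: eq_bigr => p3 _.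
rewrite mulrA !mulr_sumr; apply: eq_bigr => p4 _.
rewrite mulrA (big_tuple3 (fun m => value y (v :: m ++ p4 :: rev [:: p1; p2; p3]) *
  state_sum dim (down_tangle x) (v :: m ++ [:: p4; p3; p2; p1; v]))).
rewrite mulr_sumr; apply: eq_bigr => m1 _; rewrite mulr_sumr; apply: eq_bigr => m2 _.
rewrite mulr_sumr; apply: eq_bigr => m3 _.
rewrite -[v :: _ ++ p4 :: _]/[:: v; m1; m2; m3; p4; p3; p2; p1].
case: (boolP (loopb 4 b [:: v; m1; m2; m3; p4; p3; p2; p1])) => [ly|ny]; last first.
  by rewrite (value_out y ny) (hat_out y ny) mul0r !mulr0.
rewrite (down_tangleE adjC pf) ?eqxx; last exact: (loopb_walk ly).
rewrite !(bend_weightE pf) -!(rdim2 pf) /hat /= /wt !big_cons !big_nil; field.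
by rewrite !(rdim_neq0 pf).
Qed.

End Boxes.

(** * Exact computation in Z[sqrt 3] *)

Section Program.
Local Open Scope Z_scope.

(** The pair (a, b) stands for a + b sqrt 3. *)
Definition zr3 : Type := (Z * Z)%type.

Definition z0 : zr3 := (0, 0).
Definition z1 : zr3 := (1, 0).
Definition addz (x y : zr3) : zr3 := (x.1 + y.1, x.2 + y.2).
Definition oppz (x : zr3) : zr3 := (- x.1, - x.2).
Definition mulz (x y : zr3) : zr3 :=
  (x.1 * y.1 + 3 * (x.2 * y.2), x.1 * y.2 + x.2 * y.1).
Definition nilz (x : zr3) : bool := Z.eqb x.1 0 && Z.eqb x.2 0.

(** A formal combination of walks, to be paired with a functional nu; addf
    keeps the walks sorted so that equal walks are collected. *)
Definition form : Type := seq (zr3 * seq nat).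

Fixpoint cmpw (p q : seq nat) : comparison :=
  match p, q with
  | [::], [::] => Eq
  | [::], _ => Lt
  | _, [::] => Gt
  | x :: p', y :: q' =>
      match Nat.compare x y with Eq => cmpw p' q' | c => c end
  end.

Fixpoint addf (f : form) : form -> form :=
  match f with
  | [::] => id
  | (c, p) :: f' =>
      let fix add1 (g : form) : form :=
        match g with
        | [::] => f
        | (d, q) :: g' =>
            match cmpw p q with
            | Eq => (addz c d, p) :: addf f' g'
            | Lt => (c, p) :: addf f' g
            | Gt => (d, q) :: add1 g'
            end
        end in add1
  end.

Definition scalef (c : zr3) (f : form) : form := [seq (mulz c x.1, x.2) | x <- f].

Definition nbrs (v : nat) : seq nat :=
  nth [::] [:: [:: 1]; [:: 0; 2]; [:: 1; 3]; [:: 2; 4; 7; 8]; [:: 3; 5];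
               [:: 4; 6]; [:: 5]; [:: 3]; [:: 3]]%N v.

Fixpoint walks (k v : nat) : seq (seq nat) :=
  match k with
  | 0%N => [:: [::]]
  | k'.+1 => flatten [seq [seq w :: p | p <- walks k' w] | w <- nbrs v]
  end.

Definition even_vertex (v : nat) : bool := v \notin [:: 1; 3; 5]%N.

Section Reduction.
Variable piv : nat -> nat.

(** Searches for a spike v, piv v, v; pre is the reversed part of the walk
    before it. *)
Fixpoint backtrack (pre q : seq nat) : option (seq nat * nat * seq nat) :=
  match q with
  | v :: ((w :: u :: b) as t) =>
      if [&& v == u, w == piv v & w \in nbrs v] then Some (pre, v, b) else backtrack (v :: pre) t
  | _ => None
  end.

(** Modulo the relations of the preprojective algebra, the spike v, piv v, v
    is minus the sum of the other spikes at v. When piv v is the neighbour of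
    v in the direction of a fixed leaf, the walk moves away from that leaf at
    each step, so the rewriting ends; fuel only makes this a structural
    recursion, and soundness holds for every value of it. *)
Fixpoint nf (fuel : nat) (q : seq nat) : form :=
  match fuel, backtrack [::] q with
  | n.+1, Some (pre, v, b) =>
      foldr (fun w f => addf (scalef (oppz z1) (nf n (catrev pre [:: v, w, v & b]))) f)
        [::] [seq w <- nbrs v | w != piv v]
  | _, _ => [:: (z1, q)]
  end.

Definition nff (f : form) : form :=
  foldr (fun x g => addf (scalef x.1 (nf 60%N x.2)) g) [::] f.

End Reduction.

(** The dimension of v, divided by dim 0 at the even vertices and by delta dim
    0 at the odd ones. *)
Definition dn (v : nat) : zr3 :=
  nth z0 [:: (1, 0); (1, 0); (2, 1); (1, 1); (2, 1); (1, 0); (1, 0); (1, 1); (1, 1)] v.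

(** The cap relation at v, solved for the value at the loop whose peak at v is
    w. Peaks which point away from the centre are replaced by peaks towards
    it, and at the centre the arm 0 is expressed through the other three. At
    the ends of the arms 2 and 3 the relation has a single term. *)
Definition red (v w : nat) : option (seq (zr3 * nat)) :=
  match v, w with
  | 5%N, 6%N => Some [:: ((-2, -1), 4%N)]
  | 4%N, 5%N => Some [:: ((-1, -1), 3%N)]
  | 1%N, 0%N => Some [:: ((-2, -1), 2%N)]
  | 2%N, 1%N => Some [:: ((-1, -1), 3%N)]
  | 3%N, 2%N => Some [:: ((-1, 0), 4%N); ((1, -1), 7%N); ((1, -1), 8%N)]
  | 7%N, 3%N | 8%N, 3%N => Some [::]
  | _, _ => None
  end.

Definition table : Type := seq (seq nat * zr3).

Section Eval.
Variables (eps : zr3) (tbl : table).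

Fixpoint assoc (t : table) (g : seq nat) : option zr3 :=
  match t with
  | [::] => None
  | (p, z) :: t' => if cmpw p g is Eq then Some z else assoc t' g
  end.

Definition osum (ev : nat -> option zr3) (l : seq (zr3 * nat)) : option zr3 :=
  foldr (fun x s => if (ev x.2, s) is (Some y, Some z) then Some (addz (mulz x.1 y) z)
                    else None) (Some z0) l.

(** The value of an uncappable rotation eigenvector at a loop, computed from
    the table: a peak at one of the first two places is replaced by means of
    red, and otherwise the loop is rotated by two steps, which multiplies by
    the eigenvalue eps. None means that the fuel is exhausted. *)
Fixpoint evalh (fuel : nat) (g : seq nat) : option zr3 :=
  match fuel, g with
  | n.+1, [:: a, b, c, d & t] =>
    if assoc tbl g is Some z then Some z else
    match (if a == c then red a b else None) with
    | Some l => osum (fun w => evalh n [:: a, w, c, d & t]) l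
    | None =>
      match (if b == d then red b c else None) with
      | Some l => osum (fun w => evalh n [:: a, b, w, d & t]) l
      | None => omap (mulz eps) (evalh n (rot 2%N g))
      end
    end
  | _, _ => None
  end.
End Eval.

(** The values at all the loops are stored in a tree indexed by the vertices
    of the loop, since each of them is looked up many times. *)
Inductive trie : Type := Leaf of option zr3 | Node of seq trie.

Fixpoint build (f : seq nat -> option zr3) (k : nat) (v : nat) (pre : seq nat) : trie :=
  match k with
  | 0%N => Leaf (f (rev pre))
  | k'.+1 => Node [seq (if w \in nbrs v then build f k' w (w :: pre) else Leaf (Some z0))
                  | w <- iota 0%N 9%N]
  end.

Fixpoint get (t : trie) (g : seq nat) : option zr3 :=
  match t, g with
  | Leaf z, [::] => z
  | Node l, w :: g' => get (nth (Leaf (Some z0)) l w) g'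
  | _, _ => Some z0
  end.

(** All the evaluations have succeeded. *)
Fixpoint okt (t : trie) : bool :=
  match t with Leaf z => isSome z | Node l => all okt l end.

Definition loop_tree (eps : zr3) (tbl : table) : trie :=
  Node [seq (if even_vertex v then
     build (fun g => if head 0%N g \in nbrs (last 0%N g) then evalh eps tbl 100%N g else Some z0) 7%N v [:: v]
      else Leaf (Some z0)) | v <- iota 0%N 9%N].

(** The loops of the words in the arms, through the centre 3. *)
Definition ellz (a : seq nat) : seq nat :=
  flatten [seq [:: nth 0%N [:: 2; 4; 7; 8]%N j; 3%N] | j <- a].

(** Rescaled values at the loops of the words, in units of unit_value. Each is
    24 times the entry of the matrix A divided by dn of the second letter: the
    factor sqrt(d_{a_4} / d_{a_2}) in the prescription turns into 1 / d_{a_2}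
    in the rescaled coordinates. *)
Definition tableA : table := [seq (ellz x.1, x.2) | x <-
  [:: ([:: 1; 1; 1; 1]%N, (0, 0));
      ([:: 1; 1; 1; 2]%N, (132, -76)); ([:: 1; 1; 1; 3]%N, (-76, 44));
      ([:: 1; 1; 2; 3]%N, (-40, 24)); ([:: 1; 1; 3; 2]%N, (40, -24));
      ([:: 1; 2; 1; 2]%N, (48, -28)); ([:: 1; 2; 1; 3]%N, (12, -8));
      ([:: 1; 2; 3; 2]%N, (16, -8)); ([:: 1; 3; 1; 3]%N, (-32, 20));
      ([:: 1; 3; 2; 3]%N, (-16, 8)); ([:: 2; 3; 2; 3]%N, (0, 0))]].

Definition tableB : table := [seq (ellz x.1, x.2) | x <-
  [:: ([:: 1; 1; 1; 1]%N, (0, 0));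
      ([:: 1; 1; 1; 2]%N, (198, -114)); ([:: 1; 1; 1; 3]%N, (-18, 10));
      ([:: 1; 1; 2; 3]%N, (36, -20)); ([:: 1; 1; 3; 2]%N, (36, -20));
      ([:: 1; 2; 1; 2]%N, (180, -102)); ([:: 1; 2; 1; 3]%N, (18, -12));
      ([:: 1; 2; 3; 2]%N, (72, -44)); ([:: 1; 3; 1; 3]%N, (-4, 2));
      ([:: 1; 3; 2; 3]%N, (8, -4)); ([:: 2; 3; 2; 3]%N, (32, -16))]].

Definition treeA := loop_tree (oppz z1) tableA.
Definition treeB := loop_tree z1 tableB.

(** A tree holds the loops based at even vertices. At an odd vertex the box is
    a dual generator, whose value is that of the generator at the rotated
    loop. *)
Definition getz (t : trie) (g : seq nat) : zr3 :=
  odflt z0 (get t (if even_vertex (head 0%N g) then g else rot 1%N g)).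

(** This is (1 + sqrt 3) / dn v, which clears the denominator dim q1 of
    j_tangleE. *)
Definition codn (v : nat) : zr3 :=
  nth z0 [:: (1, 1); (1, 1); (-1, 1); (1, 0); (-1, 1); (1, 1); (1, 1); (1, 0); (1, 0)] v.

(** The coefficients of one relation after clearing denominators: cJ and the
    flag jB describe the term with j (the flag tells A from B), the others are
    the coefficients of the four products, with the sign for which the sum has
    to vanish. *)
Record row : Type := Row
  { cJ : zr3; jB : bool; cAA : zr3; cAB : zr3; cBA : zr3; cBB : zr3 }.

(** At a leaf the relation of the preprojective algebra has one term, so that
    nu vanishes at every walk with a spike at a leaf. *)
Fixpoint spur (q : seq nat) : bool :=
  match q with
  | v :: ((w :: u :: _) as t) => (v == u) && (nbrs v == [:: w]) || spur t
  | _ => false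
  end.

Section Check.
Variables (tA tB : trie) (r : row) (v : nat).

(** The last two steps of the walk go back along the first one, as the
    additional arc of j requires. *)
Definition jform : form :=
  [seq (mulz (mulz (cJ r) (codn (head 0%N a)))
          (getz (if jB r then tB else tA) (head 0%N a :: rev (behead a))), v :: a ++ [:: head 0%N a; v])
  | a <- walks 8%N v & head 0%N a \in nbrs (last v a)].

(** Reducing the halves of the walks on the side of the left box first, once
    for each pair of inner labels, keeps the intermediate combinations small. *)
Definition left_half (w : nat) (m : seq nat) (t : trie) (piv : nat -> nat) : form :=
  nff piv [seq (getz t (v :: m ++ rev a), v :: a) | a <- walks 5%N v & last v a == w].

Definition right_coef (m b : seq nat) (w : nat) (ca cb : zr3) : zr3 :=
  let g := rev b ++ w :: rev m in
  addz (mulz ca (getz tA g)) (mulz cb (getz tB g)).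

Definition circform (piv : nat -> nat) (w : nat) : form :=
  let bs := [seq b <- walks 5%N w | last w b == v] in
  flatten [seq (let dm := mulz (dn (nth 0%N m 0%N)) (dn (nth 0%N m 1%N)) in
    let la := left_half w m tA piv in let lb := left_half w m tB piv in
    flatten [seq (let ya := mulz dm (right_coef m b w (cAA r) (cAB r)) in
      let yb := mulz dm (right_coef m b w (cBA r) (cBB r)) in
      [seq (x.1, x.2 ++ b) | x <- addf (scalef ya la) (scalef yb lb)]) | b <- bs])
  | m <- walks 2%N v & w \in nbrs (last v m)].

Definition total (piv : nat -> nat) (cert : form) : form :=
  nff piv (cert ++ jform ++ flatten [seq circform piv w | w <- iota 0%N 9%N]).

End Check.

(** The neighbour in the direction of the end of arm 0; 9 is no vertex, so
    nothing is rewritten there. *)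
Definition piv0 (v : nat) : nat := nth 9%N [:: 9; 0; 1; 2; 3; 4; 5; 3; 3]%N v.
(** The same for the end of arm 1. *)
Definition piv6 (v : nat) : nat := nth 9%N [:: 1; 2; 3; 4; 5; 6; 9; 3; 3]%N v.

(** The rows of R, multiplied by 11 and 172163 and by -1, with the powers of
    the eigenvalue sigma that come from the dual generators; cJ collects the
    units of j_tangleE and circ_tangleE, 24 (1 + sqrt 3). *)
Definition even_rows : row * row :=
  (Row (264, 264) false z0 (6, 1) (-6, -1) z0,
   Row (4131912, 4131912) true
     (137208, 77672) (33708, 32332) (33708, 32332) (-52626, -80142)).

(** The rows of the other matrix, multiplied by delta and cleared of
    denominators in the same way; here cJ contains the factor 24 delta^2 (1 +
    sqrt 3) with delta^2 = 3 + sqrt 3. *)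
Definition odd_rows : row * row :=
  (Row (3955796064, 2637197376) false (-6084144, -3561888)
     (-3746019, -7492038) (3746019, 7492038) (-27263412, -16475976),
   Row (719235648, 479490432) true (-525168, -432288)
     (-3746019, 7492038) (3746019, -7492038) (-1229796, -2639304)).

(** For each base vertex, what remains of the two relations after the
    rewriting is a combination of walks with a spike at the leaf to which the
    pivots point. These multiples of the relation at the leaf cancel it. *)
Definition certificates : seq (form * form) :=
  [:: ([::], [::]);
      ([::], [::]);
      ([::], [:: ((-396663552, -396663552), [:: 2; 3; 4; 5; 6; 5; 6; 5; 4; 3; 2]%N)]);
      ([:: ((-350764429824, -211385276928), [:: 3; 2; 1; 0; 1; 0; 1; 0; 1; 2; 3]%N);
           ((-60692196096, -38956723968), [:: 3; 2; 1; 0; 1; 0; 1; 2; 3; 4; 3]%N);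
           ((-97007975424, -65125608960), [:: 3; 2; 1; 0; 1; 0; 1; 2; 3; 7; 3]%N);
           ((-60692196096, -38956723968), [:: 3; 4; 3; 2; 1; 0; 1; 0; 1; 2; 3]%N);
           ((-97007975424, -65125608960), [:: 3; 7; 3; 2; 1; 0; 1; 0; 1; 2; 3]%N)],
       [:: ((-17110891008, -10135706112), [:: 3; 2; 1; 0; 1; 0; 1; 0; 1; 2; 3]%N);
           ((2234403072, 2524743936), [:: 3; 2; 1; 0; 1; 0; 1; 2; 3; 4; 3]%N);
           ((9808634880, 4759147008), [:: 3; 2; 1; 0; 1; 0; 1; 2; 3; 7; 3]%N);
           ((2234403072, 2524743936), [:: 3; 4; 3; 2; 1; 0; 1; 0; 1; 2; 3]%N);
           ((9808634880, 4759147008), [:: 3; 7; 3; 2; 1; 0; 1; 0; 1; 2; 3]%N)]);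
      ([::], [:: ((-396663552, -396663552), [:: 4; 3; 2; 1; 0; 1; 0; 1; 2; 3; 4]%N)]);
      ([::], [::]);
      ([::], [::]);
      ([::], [:: ((104276736, 281877120), [:: 7; 3; 2; 1; 0; 1; 0; 1; 2; 3; 7]%N)]);
      ([::], [:: ((794671104, 276848000), [:: 8; 3; 2; 1; 0; 1; 0; 1; 2; 3; 8]%N)])].

Definition rows_at (v : nat) : row * row :=
  if even_vertex v then even_rows else odd_rows.

(** Pivots point to the end of arm 0 or arm 1 which is not close to the base
    vertex, so that few of the walks reach it. *)
Definition check_row (tA tB : trie) (r : row) (v : nat) (cert : form) : bool :=
  all (fun x => spur x.2) cert &&
  all (fun x => nilz x.1) (total tA tB r v (if (v <= 2)%N then piv6 else piv0) cert).

Definition trace_sum (tA : trie) : zr3 :=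
  foldr addz z0 [seq
    (let: p := x.1 in let: m := x.2 in
     mulz (foldr (fun v z => mulz (dn v) z) z1 (p ++ m))
       (mulz (getz tA (0%N :: p ++ rev m)) (getz tA (0%N :: m ++ rev p))))
  | x <- [seq (p, m) | p <- walks 4%N 0%N, m <- walks 3%N 0%N]
    & last 0%N x.1 \in nbrs (last 0%N x.2)].

(** The number 64 (1 + sqrt 3)^4 (12 + 8 sqrt 3), where (1 + sqrt 3)^4 = 28 +
    16 sqrt 3 and 64 comes from 24^2 / 9. *)
Definition trace_value : zr3 := mulz (64, 0) (mulz (28, 16) (12, 8)).

Definition check_all (tA tB : trie) : bool :=
  [&& okt tA, okt tB,
      nilz (addz (trace_sum tA) (oppz trace_value)) &
      all (fun v => let c := nth ([::], [::]) certificates v in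
             check_row tA tB (rows_at v).1 v c.1 && check_row tA tB (rows_at v).2 v c.2)
          (iota 0%N 9%N)].

Definition check : bool := check_all treeA treeB.

End Program.

Lemma check_true : check.
Proof. by vm_compute. Qed.

(** * Soundness of the computation with walks *)

Section Values.
Variable R : realType.
Local Notation C := R[i].

Lemma ofZD a b : ofZ (Z.add a b) = ofZ a + ofZ b :> R.
Proof. by rewrite /ofZ -intrD -(rmorphD ssrZ.int_of_Z). Qed.

Lemma ofZM a b : ofZ (Z.mul a b) = ofZ a * ofZ b :> R.
Proof. by rewrite /ofZ -intrM -(rmorphM ssrZ.int_of_Z). Qed.

Lemma ofZN a : ofZ (Z.opp a) = - ofZ a :> R.
Proof. by rewrite /ofZ -mulrNz -(rmorphN ssrZ.int_of_Z). Qed.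

Definition evr (x : zr3) : R := ofZ x.1 + ofZ x.2 * Num.sqrt 3.
Definition ev (x : zr3) : C := (evr x)%:C.

Lemma sqrt3K : Num.sqrt 3 * Num.sqrt 3 = 3 :> R.
Proof. by rewrite -expr2 sqr_sqrtr ?ler0n. Qed.

Lemma evD x y : ev (addz x y) = ev x + ev y.
Proof. by rewrite /ev -rmorphD; congr _%:C; rewrite /evr /addz !ofZD; ring. Qed.

Lemma evN x : ev (oppz x) = - ev x.
Proof. by rewrite /ev -rmorphN; congr _%:C; rewrite /evr /oppz !ofZN; ring. Qed.

Lemma evM x y : ev (mulz x y) = ev x * ev y.
Proof.
case: x y => [a b] [c d]; rewrite /ev -rmorphM; congr _%:C; rewrite /evr.
rewrite -[(mulz _ _).1]/(Z.add (Z.mul a c) (Z.mul 3 (Z.mul b d))).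
rewrite -[(mulz _ _).2]/(Z.add (Z.mul a d) (Z.mul b c)) !(ofZD, ofZM).
have -> : ofZ 3 = Num.sqrt 3 * Num.sqrt 3 :> R by rewrite sqrt3K.
by rewrite [(a, b).1]/= [(a, b).2]/= [(c, d).1]/= [(c, d).2]/=; ring.
Qed.

Lemma ev0 : ev z0 = 0. Proof. by rewrite /ev /evr mul0r addr0. Qed.
Lemma ev1 : ev z1 = 1. Proof. by rewrite /ev /evr mul0r addr0. Qed.

Lemma ev_nil x : nilz x -> ev x = 0.
Proof.
case: x => a b /andP[/Z.eqb_eq /= -> /Z.eqb_eq /= ->].
exact: ev0.
Qed.

Lemma cmpw_eq p q : cmpw p q = Eq -> p = q.
Proof.
elim: p q => [|x p IH] [|y q] //=; case E: (Nat.compare x y) => // /IH ->.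
by move/Nat.compare_eq: E => ->.
Qed.

Section Pairing.
Variable nu : seq nat -> C.

Definition pair_with (f : form) : C := \sum_(x <- f) ev x.1 * nu x.2.

Lemma pair_cons x f : pair_with (x :: f) = ev x.1 * nu x.2 + pair_with f.
Proof. exact: big_cons. Qed.

Lemma pair_nil : pair_with [::] = 0.
Proof. exact: big_nil. Qed.

Lemma pair_cat f g : pair_with (f ++ g) = pair_with f + pair_with g.
Proof. exact: big_cat. Qed.

Lemma pair_flatten s : pair_with (flatten s) = \sum_(f <- s) pair_with f.
Proof. by rewrite /pair_with big_flatten. Qed.

Lemma pair_scale c f : pair_with (scalef c f) = ev c * pair_with f.
Proof.
rewrite /pair_with big_map mulr_sumr; apply: eq_bigr => x _.
by rewrite evM mulrA.
Qed.

Lemma pair_add f g : pair_with (addf f g) = pair_with f + pair_with g.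
Proof.
elim: f g => [|[c p] f IH] g; first by rewrite pair_nil add0r.
elim: g => [|[d q] g IHg] /=; first by rewrite pair_nil addr0.
case E: (cmpw p q); rewrite pair_cons.
- by rewrite IH evD mulrDl -(cmpw_eq E) !pair_cons /= addrACA.
- by rewrite IH !pair_cons addrA.
- by rewrite IHg !pair_cons /= addrCA.
Qed.

Lemma pair_all_nil f : all (fun x => nilz x.1) f -> pair_with f = 0.
Proof.
by move=> f0; rewrite /pair_with big_seq big1 // => x /(allP f0)/ev_nil ->; rewrite mul0r.
Qed.

End Pairing.

(** The relations of the preprojective algebra of the tree. *)
Definition cap_free (nu : seq nat -> C) : Prop := forall a v b,
  \sum_(w <- nbrs v) nu (a ++ [:: v, w, v & b]) = 0.

Lemma cap_free_cat nu b : cap_free nu -> cap_free (fun a => nu (a ++ b)).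
Proof.
move=> nuf a v b'; rewrite -[RHS](nuf a v (b' ++ b)).
by apply: eq_bigr => w _; rewrite -catA.
Qed.

Lemma nbrs_uniq v : uniq (nbrs v).
Proof. by do 9?case: v => [//|v]; rewrite /nbrs nth_default. Qed.

Lemma backtrackP piv pre q p v b : backtrack piv pre q = Some (p, v, b) ->
  piv v \in nbrs v /\ catrev pre q = catrev p [:: v, piv v, v & b].
Proof.
elim: q pre => [//|x q IH] pre; case: q IH => [//|w q]; case: q => [//|u q] IH.
rewrite [backtrack _ _ _]/=; case: ifP => [/and3P[/eqP <- /eqP -> wn]|_].
  by case=> <- <- <-.
by move/IH.
Qed.

Section NormalForm.
Variables (nu : seq nat -> C) (piv : nat -> nat).
Hypothesis nuf : cap_free nu.

(** One step of the rewriting is the relation of nu at v, solved for the term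
    of the pivot. *)
Lemma nf_pair n q : pair_with nu (nf piv n q) = nu q.
Proof.
elim: n q => [|n IH] q; first by rewrite /= pair_cons pair_nil ev1 mul1r addr0.
rewrite /=; case E: backtrack => [[[p v] b]|]; last first.
  by rewrite pair_cons pair_nil ev1 mul1r addr0.
have [pn] := backtrackP E; rewrite /= => ->.
have := nuf (rev p) v b; rewrite (bigD1_seq _ pn (nbrs_uniq v)) /=.
rewrite -catrevE => /eqP; rewrite addr_eq0 => /eqP ->.
rewrite -big_filter; elim: [seq w <- nbrs v | w != piv v] => [|w r IHr].
  by rewrite big_nil oppr0 pair_nil.
rewrite /= pair_add IHr pair_scale IH evN ev1 mulN1r big_cons opprD -catrevE.
by [].
Qed.

Lemma nff_pair f : pair_with nu (nff piv f) = pair_with nu f.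
Proof.
elim: f => [//|x f IH].
rewrite -[nff _ _]/(addf (scalef x.1 (nf piv 60 x.2)) (nff piv f)).
by rewrite pair_add pair_scale nf_pair pair_cons IH.
Qed.

Lemma spur0 a q : spur q -> nu (a ++ q) = 0.
Proof.
elim: q a => [//|v q IH] a; case: q IH => [//|w q]; case: q => [//|u q] IH.
rewrite [spur _]/= => /orP[/andP[/eqP <- /eqP vw]|].
  by have := nuf a v q; rewrite vw big_seq1.
by move=> sq; rewrite -cat_rcons; apply: IH.
Qed.

End NormalForm.

Definition nadj : rel nat := fun v w => w \in nbrs v.

Lemma nbrs_lt v w : w \in nbrs v -> (w < 9)%N && (v < 9)%N.
Proof.
do 9?[case: v => [|v]; first by rewrite /nbrs /= !inE => /pred2P[] -> || by rewrite /nbrs /= !inE => /eqP -> || by rewrite /nbrs /= !inE => /or4P[] /eqP ->].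
by rewrite /nbrs nth_default.
Qed.

Lemma nadjC : symmetric nadj.
Proof.
have sym v w : nadj v w -> nadj w v.
  move=> vw; have /andP[w9 v9] := nbrs_lt vw.
  have /allP/(_ v) : all (fun v => all (fun w => nadj v w ==> nadj w v) (iota 0 9)) (iota 0 9).
    by vm_compute.
  by rewrite mem_iota => /(_ v9)/allP/(_ w); rewrite mem_iota => /(_ w9)/implyP; apply.
by move=> v w; apply/idP/idP; apply: sym.
Qed.

Local Arguments walks : simpl never.

Lemma walksS k v :
  walks k.+1 v = flatten [seq [seq w :: p | p <- walks k w] | w <- nbrs v].
Proof. by []. Qed.

Lemma big_walksS k v (F : seq nat -> C) :
  \sum_(p <- walks k.+1 v) F p = \sum_(w <- nbrs v) \sum_(p <- walks k w) F (w :: p).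
Proof.
by rewrite walksS big_flatten big_map; apply: eq_bigr => w _; rewrite big_map.
Qed.

Lemma big_walks0 v (F : seq nat -> C) : \sum_(p <- walks 0 v) F p = F [::].
Proof. exact: big_seq1. Qed.

Lemma big_walks_cat m n v (F : seq nat -> C) :
  \sum_(p <- walks (m + n) v) F p =
  \sum_(a <- walks m v) \sum_(b <- walks n (last v a)) F (a ++ b).
Proof.
elim: m v F => [|m IH] v F; first by rewrite add0n big_walks0.
by rewrite addSn !big_walksS; apply: eq_bigr => w _; rewrite IH.
Qed.

Lemma mem_walks k v p : (p \in walks k v) = (size p == k) && path nadj v p.
Proof.
elim: k v p => [|k IH] v p; first by case: p.
rewrite walksS; apply/flatten_mapP/andP => [[w vw /mapP[q]]|].
  by rewrite IH => /andP[/eqP <- wq] ->; split=> //=; rewrite [nadj v w]vw.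
case: p => [[]//|w p] [sp /andP[vw wp]]; exists w => //.
by apply: map_f; rewrite IH -eqSS sp.
Qed.

Lemma big_nbrs_pick (v y : nat) (F : nat -> C) :
  \sum_(x <- nbrs v) (if x == y then F x else 0) = if y \in nbrs v then F y else 0.
Proof.
case: ifP => [yv|/negP yv].
  rewrite (bigD1_seq y) ?nbrs_uniq //= eqxx big1 ?addr0 // => x /negbTE -> //.
by rewrite big_seq big1 // => x xv; case: eqP => // xy; case: yv; rewrite -xy.
Qed.

Section Rows.
Variables (nu : seq nat -> C) (tA tB : trie) (r : row).
Hypothesis nuf : cap_free nu.
Local Notation X t g := (ev (getz t g)).

(** The contribution of j to the relation at a walk, up to the factor of the
    base vertex. *)
Definition jval (q : seq nat) : C :=
  if q is [:: q0; q1; q2; q3; q4; q5; q6; q7; q8; q9; q10] then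
    if (q9 == q1) && (q10 == q0) then
      ev (cJ r) * ev (codn q1) *
      X (if jB r then tB else tA) [:: q1; q8; q7; q6; q5; q4; q3; q2]
    else 0
  else 0.

Lemma jform_pair v :
  pair_with nu (jform tA tB r v) = \sum_(p <- walks 10 v) jval (v :: p) * nu (v :: p).
Proof.
rewrite (big_walks_cat 8 2) /pair_with /jform big_map big_filter big_mkcond.
rewrite big_seq [RHS]big_seq; apply: eq_bigr => a; rewrite mem_walks => /andP[].
move: a => [|q1 [|q2 [|q3 [|q4 [|q5 [|q6 [|q7 [|q8 [|? ?]]]]]]]]] // _ va.
rewrite [head _ _]/= [last _ _]/= big_walksS.
pose G q9 q10 := jval [:: v; q1; q2; q3; q4; q5; q6; q7; q8; q9; q10] *
  nu [:: v; q1; q2; q3; q4; q5; q6; q7; q8; q9; q10].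
rewrite (eq_bigr (fun q9 => if q9 == q1 then
    \sum_(q10 <- nbrs q1) (if q10 == v then G q1 v else 0) else 0)); last first.
  move=> q9 _; rewrite big_walksS.
  under eq_bigr => q10 _ do rewrite big_walks0.
  case: (eqVneq q9 q1) => [->|/negbTE ne].
    apply: eq_bigr => q10 _; case: (eqVneq q10 v) => [->//|/negbTE ne].
    by rewrite /jval /= ne andbF mul0r.
  by rewrite big1 // => q10 _; rewrite /jval /= ne mul0r.
rewrite big_nbrs_pick; case: ifP => // _; rewrite big_nbrs_pick.
have -> : v \in nbrs q1 by rewrite -/(nadj q1 v) nadjC; case/andP: va.
by rewrite /G /jval !eqxx !evM /=.
Qed.

(** The contribution of the four products, with the loops of circ_tangleE; the
    inner labels m run over walks because the boxes vanish off loops. *)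
Definition cval (q : seq nat) : C :=
  if q is [:: q0; q1; q2; q3; q4; q5; q6; q7; q8; q9; q10] then
    if q10 == q0 then
      \sum_(m <- walks 2 q0 | q5 \in nbrs (last q0 m))
        ev (dn (nth 0%N m 0)) * ev (dn (nth 0%N m 1)) *
        (let gS := q0 :: m ++ [:: q5; q4; q3; q2; q1] in
         let gT := [:: q10; q9; q8; q7; q6; q5] ++ rev m in
         X tA gS * (ev (cAA r) * X tA gT + ev (cAB r) * X tB gT) +
         X tB gS * (ev (cBA r) * X tA gT + ev (cBB r) * X tB gT))
    else 0
  else 0.

Local Arguments cval : simpl never.
Local Arguments jval : simpl never.
Local Arguments circform : simpl never.
Local Arguments jform : simpl never.

Lemma left_half_pair v w m t piv b :
  pair_with (fun a => nu (a ++ b)) (left_half v w m t piv) =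
  \sum_(a <- walks 5 v | last v a == w) X t (v :: m ++ rev a) * nu ((v :: a) ++ b).
Proof.
rewrite /left_half nff_pair; last exact: cap_free_cat.
by rewrite /pair_with big_map big_filter.
Qed.

Lemma cvalE v w a b : a \in walks 5 v -> last v a = w -> b \in walks 5 w ->
  cval (v :: a ++ b) = if last w b == v then
    \sum_(m <- walks 2 v | w \in nbrs (last v m))
      ev (dn (nth 0%N m 0)) * ev (dn (nth 0%N m 1)) *
      (let gS := v :: m ++ rev a in let gT := rev b ++ w :: rev m in
       X tA gS * (ev (cAA r) * X tA gT + ev (cAB r) * X tB gT) +
       X tB gS * (ev (cBA r) * X tA gT + ev (cBB r) * X tB gT))
  else 0.
Proof.
rewrite !mem_walks => /andP[+ _] + /andP[+ _].
move: a => [|q1 [|q2 [|q3 [|q4 [|q5 [|? ?]]]]]] // _ <-.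
by move: b => [|q6 [|q7 [|q8 [|q9 [|q10 [|? ?]]]]]].
Qed.

Lemma right_coefE m b w ca cb :
  ev (right_coef tA tB m b w ca cb) =
  ev ca * X tA (rev b ++ w :: rev m) + ev cb * X tB (rev b ++ w :: rev m).
Proof. by rewrite /right_coef evD !evM. Qed.

(** The walks are cut in the middle, at w; the coefficient of a walk splits
    into a factor for each half once the inner labels m are fixed. *)
Lemma circform_pair v w piv :
  pair_with nu (circform tA tB r v piv w) =
  \sum_(a <- walks 5 v | last v a == w) \sum_(b <- walks 5 w)
    cval (v :: a ++ b) * nu (v :: a ++ b).
Proof.
rewrite /circform pair_flatten big_map big_filter.
transitivity (\sum_(m <- walks 2 v | w \in nbrs (last v m))
  \sum_(b <- walks 5 w | last w b == v) \sum_(a <- walks 5 v | last v a == w)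
    ev (dn (nth 0%N m 0)) * ev (dn (nth 0%N m 1)) *
      (let gS := v :: m ++ rev a in let gT := rev b ++ w :: rev m in
       X tA gS * (ev (cAA r) * X tA gT + ev (cAB r) * X tB gT) +
       X tB gS * (ev (cBA r) * X tA gT + ev (cBB r) * X tB gT)) *
    nu (v :: a ++ b)).
  apply: eq_bigr => m _; rewrite pair_flatten big_map big_filter; apply: eq_bigr => b _.
  set f := addf _ _; transitivity (pair_with (fun a => nu (a ++ b)) f).
    by rewrite /pair_with big_map.
  rewrite /f pair_add !pair_scale !left_half_pair !evM !right_coefE.
  rewrite !mulr_sumr -big_split; apply: eq_bigr => a _ /=; ring.
rewrite exchange_big [RHS]exchange_big big_mkcond big_seq [RHS]big_seq /=.
apply: eq_bigr => b wb; case: ifP => [bv|/negbT bv]; last first.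
  rewrite big_seq_cond big1 // => a /andP[va /eqP la].
  by rewrite (cvalE va la wb) (negbTE bv) mul0r.
rewrite exchange_big big_seq_cond [RHS]big_seq_cond /=.
apply: eq_bigr => a /andP[va /eqP la].
by rewrite (cvalE va la wb) bv mulr_suml.
Qed.

Lemma total_pair v piv cert : (v < 9)%N -> all (fun x => spur x.2) cert ->
  pair_with nu (total tA tB r v piv cert) =
  \sum_(p <- walks 10 v) (jval (v :: p) + cval (v :: p)) * nu (v :: p).
Proof.
move=> v9 sc; rewrite /total nff_pair // 2!pair_cat jform_pair pair_flatten.
have -> : pair_with nu cert = 0.
  rewrite /pair_with big_seq big1 // => x /(allP sc) sx.
  by rewrite (spur0 nuf [::]) ?mulr0.
rewrite add0r; under [RHS]eq_bigr do rewrite mulrDl.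
rewrite big_split; congr (_ + _); rewrite big_map (big_walks_cat 5 5).
under eq_bigr do rewrite circform_pair big_mkcond /=.
rewrite exchange_big big_seq [RHS]big_seq; apply: eq_bigr => a.
rewrite mem_walks => /andP[sa va].
rewrite (bigD1_seq (last v a)) ?iota_uniq ?eqxx //; last first.
  rewrite mem_iota; move: sa va; case/lastP: a => // a x _.
  by rewrite rcons_path last_rcons => /andP[_ /nbrs_lt/andP[]].
apply: etrans (addr0 _); congr (_ + _).
by apply: big1 => w /negbTE wl; rewrite eq_sym wl.
Qed.

(** Rewriting does not change the pairing with nu, the certificate pairs to 0,
    and the normal form of the total is 0. *)
Lemma check_row_sound v cert : (v < 9)%N -> check_row tA tB r v cert ->
  \sum_(p <- walks 10 v) (jval (v :: p) + cval (v :: p)) * nu (v :: p) = 0.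
Proof. by move=> v9 /andP[sc /(pair_all_nil nu)]; rewrite total_pair. Qed.

End Rows.
End Values.

(** * Soundness of the evaluation of boxes *)

Section Evaluation.
Variable R : realType.
Local Notation C := R[i].
Local Notation ev := (@ev R).

Lemma get_node (F : nat -> trie) w p : (w < 9)%N ->
  get (Node [seq F v | v <- iota 0 9]) (w :: p) = get (F w) p.
Proof. by do 9?case: w => [//|w]. Qed.

Lemma okt_node (F : nat -> trie) w : (w < 9)%N ->
  okt (Node [seq F v | v <- iota 0 9]) -> okt (F w).
Proof.
move=> w9; rewrite -[okt _]/(all okt _) all_map => /allP/(_ w); apply.
by rewrite mem_iota.
Qed.

Lemma build_sound f k v pre p : okt (build f k v pre) -> path nadj v p -> size p = k ->
  exists2 z, f (rev pre ++ p) = Some z & get (build f k v pre) p = Some z.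
Proof.
elim: k v pre p => [|k IH] v pre [|w p] // ok.
  by rewrite cats0; move: ok => /=; case: (f _) => // z; exists z.
case/andP=> vw wp [sp]; have /andP[w9 _] := nbrs_lt vw.
have vw' : w \in nbrs v := vw; have := okt_node w9 ok; rewrite vw' => okw.
have [z fz gz] := IH w (w :: pre) p okw wp sp.
exists z; first by rewrite -cat_rcons -rev_cons.
by rewrite -[build _ _ _ _]/(Node _) get_node // vw'.
Qed.

Section LoopFunction.
Variables (h : seq nat -> C) (mu t d : C) (eps : zr3) (tbl : table).
Let D v : C := if even_vertex v then t * ev (dn v) else t * d * ev (dn v).

Hypotheses (t0 : t != 0) (d0 : d != 0).
Hypothesis cap1 : forall a s, size s = 5 ->
  \sum_(w <- nbrs a) D w * h [:: a, w, a & s] = 0.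
Hypothesis cap2 : forall a b s, size s = 4 ->
  \sum_(w <- nbrs b) D w * h [:: a, b, w, b & s] = 0.
Hypothesis h_rot : forall g, size g = 8 -> h g = ev eps * h (rot 2 g).
Hypothesis h_tbl : forall p z, (p, z) \in tbl -> h p = mu * ev z.
Hypothesis h_out : forall v p, path nadj v p -> size p = 7 ->
  v \notin nbrs (last v p) -> h (v :: p) = 0.

Let s : C := (Num.sqrt 3)%:C.

Lemma ssK : s * s = 3.
Proof. by rewrite /s -rmorphM /= sqrt3K rmorph_nat. Qed.

Lemma evE (a b : Z) : ev (a, b) = (ofZ a)%:C + (ofZ b)%:C * s.
Proof. by rewrite /ev /evr rmorphD rmorphM. Qed.

Lemma s_neq : 1 + s != 0 /\ 2 + s != 0.
Proof.
have s0 : 0 < Num.sqrt 3 :> R by rewrite sqrtr_gt0 ltr0n.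
have c (k : R) : 0 <= k -> k%:C + s != 0.
  by move=> k0; rewrite -rmorphD fmorph_eq0 gt_eqF // ltr_wpDl.
have := c 2 (ler0n _ _); have := c 1 ler01.
by rewrite rmorph1 (rmorph_nat _ 2).
Qed.

(** Each entry of red is one of the cap relations; at the centre the
    coefficient 2 + sqrt 3 of arm 1 equals that of arm 0, and division by it
    uses s * s = 3. *)
Lemma red_sound v w l (G : nat -> C) : red v w = Some l ->
  \sum_(x <- nbrs v) D x * G x = 0 -> G w = \sum_(y <- l) ev y.1 * G y.2.
Proof.
have cancel (k x y : C) : k != 0 -> k * (x - y) = 0 -> x = y.
  by move=> k0 /eqP; rewrite mulf_eq0 (negbTE k0) subr_eq0 => /eqP.
have z2 : ofZ 2 = 2 :> R by []. have zm2 : ofZ (-2) = -2 :> R by [].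
have z1 : ofZ 1 = 1 :> R by []. have zm1 : ofZ (-1) = -1 :> R by [].
have z0 : ofZ 0 = 0 :> R by [].
have td0 : t * d != 0 by rewrite mulf_neq0.
do 9?[case: v => [|v]]; do 9?[case: w => [|w]] => //= -[<-];
  rewrite /D !big_cons !big_nil /= /dn /= !evE !(z0, z1, z2, zm1, zm2) ?rmorphN ?rmorph0 ?rmorph1 ?(rmorph_nat _ 2).
- by move=> E; apply: (cancel t) => //; rewrite -[RHS]E; ring.
- by move=> E; apply: (cancel (t * d)) => //; rewrite -[RHS]E; ring.
- have [_ s2] := s_neq; move=> E; apply: (cancel (t * (2 + s))); first exact: mulf_neq0.
  transitivity (0 - t * (G 7%N + G 8%N) * (3 - s * s)); last by rewrite ssK subrr mulr0 subr0.
  by rewrite -[X in _ = X - _]E; ring.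
- by move=> E; apply: (cancel (t * d)) => //; rewrite -[RHS]E; ring.
- by move=> E; apply: (cancel t) => //; rewrite -[RHS]E; ring.
- have [s1 _] := s_neq; move=> E; apply: (cancel (t * d * (1 + s))).
    exact: mulf_neq0.
  by rewrite -[RHS]E; ring.
- have [s1 _] := s_neq; move=> E; apply: (cancel (t * d * (1 + s))).
    exact: mulf_neq0.
  by rewrite -[RHS]E; ring.
Qed.

Lemma osum_sound F (H : nat -> C) l z :
  (forall w y, F w = Some y -> H w = mu * ev y) ->
  osum F l = Some z -> \sum_(y <- l) ev y.1 * H y.2 = mu * ev z.
Proof.
move=> FH; elim: l z => [|[c w] l IH] z /=; first by case=> <-; rewrite big_nil ev0 mulr0.
case E: (F w) => [y|//]; case E': (osum F l) => [y'|//] [<-].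
by rewrite big_cons /= (FH _ _ E) (IH _ E') evD evM; ring.
Qed.

Lemma assoc_mem (T : table) g z : assoc T g = Some z -> (g, z) \in T.
Proof.
elim: T => [//|[p y] T IH] /=; case E: (cmpw p g) => [||].
- by case=> <-; rewrite (cmpw_eq E) mem_head.
- by rewrite inE => /IH ->; rewrite orbT.
- by rewrite inE => /IH ->; rewrite orbT.
Qed.

(** A function on loops which satisfies the two caps and the rotation, and
    which agrees with the table up to the common factor mu, is computed by
    evalh. *)
Lemma evalh_sound n g z : size g = 8 -> evalh eps tbl n g = Some z -> h g = mu * ev z.
Proof.
elim: n g z => [//|n IH] [|a [|b [|c [|e s']]]] z // [sz] /=.
case E: (assoc tbl _) => [y|]; first by case=> <-; apply/h_tbl/assoc_mem.
have rotP : omap (mulz eps) (evalh eps tbl n (rot 2 [:: a, b, c, e & s'])) = Some z ->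
    h [:: a, b, c, e & s'] = mu * ev z.
  case E': (evalh _ _ _ _) => [y|] //= [<-].
  by rewrite h_rot /= ?sz // (IH _ _ _ E') ?evM ?size_rot /= ?sz //; ring.
have peak2 : match (if b == e then red b c else None) with
    | Some l => osum (fun w => evalh eps tbl n [:: a, b, w, e & s']) l
    | None => omap (mulz eps) (evalh eps tbl n (rot 2 [:: a, b, c, e & s'])) end = Some z ->
    h [:: a, b, c, e & s'] = mu * ev z.
  case: (b =P e) => [be|//]; case Er: (red b c) => [l|//]; rewrite -be => os.
  rewrite (red_sound (G := fun w => h [:: a, b, w, b & s']) Er).
    by refine (osum_sound (H := fun w => h _) _ os) => w y; apply: IH; rewrite /= sz.
  by apply: cap2; case: sz.
case: (a =P c) => [ac|//]; case Er: (red a b) => [l|//]; rewrite -ac => os.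
rewrite (red_sound (G := fun w => h [:: a, w, a, e & s']) Er).
  by refine (osum_sound (H := fun w => h _) _ os) => w y; apply: IH; rewrite /= sz.
by apply: cap1; rewrite /= sz.
Qed.

Lemma loop_tree_sound v p : okt (loop_tree eps tbl) -> even_vertex v ->
  path nadj v p -> size p = 7 ->
  h (v :: p) = mu * ev (odflt z0 (get (loop_tree eps tbl) (v :: p))).
Proof.
move=> ok ev_v vp sp.
have v9 : (v < 9)%N by case: p vp sp => // w p /andP[/nbrs_lt/andP[]].
have := okt_node v9 ok; rewrite ev_v => okv.
have [z fz gz] := build_sound okv vp sp.
rewrite get_node // ev_v gz /=; move: fz; rewrite -[rev [:: v] ++ p]/(v :: p).
have sg : size (v :: p) = 8 by rewrite /= sp.
case: ifP => [_|/negbT ng]; first exact: evalh_sound.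
by case=> <-; rewrite h_out // ev0 mulr0.
Qed.

End LoopFunction.
End Evaluation.

(** * The tree 3311 *)

Lemma adj3311E (v w : 'I_9) : adj3311 v w = nadj v w.
Proof.
pose a (x y : nat) := ((x, y) \in edges3311) || ((y, x) \in edges3311).
have : all (fun x => all (fun y => a x y == nadj x y) (iota 0 9)) (iota 0 9).
  by vm_compute.
move=> /allP/(_ v); rewrite mem_iota => /(_ (ltn_ord v))/allP/(_ w).
by rewrite mem_iota => /(_ (ltn_ord w))/eqP.
Qed.

Lemma adj3311C : symmetric adj3311.
Proof. by move=> v w; rewrite !adj3311E nadjC. Qed.

(** A walk from the root alternates between the two classes of vertices, and
    the explicit paths show that the distance is attained. *)
Lemma dist3311 (v : 'I_9) : odd (dist adj3311 root3311 v) = ~~ even_vertex v.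
Proof.
pose W k := walk_ends adj3311 root3311 k.
have WS k (x y : 'I_9) : x \in W k -> adj3311 x y -> y \in W k.+1.
  by move=> xk xy; rewrite inE; apply/existsP; exists x; rewrite xk.
have parity k (x : 'I_9) : x \in W k -> odd k = ~~ even_vertex x.
  elim: k x => [|k IH] x; first by rewrite inE => /eqP ->.
  rewrite inE => /existsP[y /andP[/IH /= -> yx]].
  have : all (fun v => all (fun w => nadj v w ==> (even_vertex w == ~~ even_vertex v))
    (iota 0 9)) (iota 0 9) by vm_compute.
  move=> /allP/(_ y); rewrite mem_iota => /(_ (ltn_ord y))/allP/(_ x).
  by rewrite mem_iota => /(_ (ltn_ord x))/implyP; rewrite -adj3311E => /(_ yx)/eqP ->.
have reach (p : seq nat) (x : 'I_9) k : x \in W k -> path nadj x p ->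
    inord (last (x : nat) p) \in W (k + size p)%N.
  elim: p x k => [|y p IH] x k xk /=; first by rewrite inord_val addn0.
  case/andP=> xy yp; have /andP[y9 _] := nbrs_lt xy.
  rewrite -[y]/(val (Ordinal y9)) addnS -addSn; apply: IH => //.
  by apply: WS xk _; rewrite adj3311E.
have root0 : root3311 \in W 0 by rewrite inE.
have [k k9 vk] : exists2 k, (k < 9)%N & v \in W k.
  have r p := reach p root3311 0%N root0.
  have vE : v = inord v by rewrite inord_val.
  case: (v : nat) (ltn_ord v) vE => [|[|[|[|[|[|[|[|[|//]]]]]]]]] _ ->.
  - by exists 0%N => //; apply: (r [::]).
  - by exists 1%N => //; apply: (r [:: 1]%N).
  - by exists 2%N => //; apply: (r [:: 1; 2]%N).
  - by exists 3%N => //; apply: (r [:: 1; 2; 3]%N).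
  - by exists 4%N => //; apply: (r [:: 1; 2; 3; 4]%N).
  - by exists 5%N => //; apply: (r [:: 1; 2; 3; 4; 5]%N).
  - by exists 6%N => //; apply: (r [:: 1; 2; 3; 4; 5; 6]%N).
  - by exists 4%N => //; apply: (r [:: 1; 2; 3; 7]%N).
  - by exists 4%N => //; apply: (r [:: 1; 2; 3; 8]%N).
apply: parity; rewrite /dist card_ord.
have hs : has (fun k => v \in W k) (iota 0 9).
  by apply/hasP; exists k; rewrite // mem_iota.
have := nth_find 0%N hs; rewrite nth_iota //.
by move: hs; rewrite has_find size_iota.
Qed.

Section WalkSums.
Variable C : nmodType.

Lemma sum_adj3311 (v : 'I_9) (F : 'I_9 -> C) :
  \sum_(w | adj3311 v w) F w = \sum_(w <- nbrs v) F (inord w).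
Proof.
transitivity (\sum_(0 <= w < 9 | w \in nbrs v) F (inord w)).
  rewrite big_mkord; apply: eq_big => w; first by rewrite adj3311E.
  by rewrite inord_val.
rewrite -big_filter; apply: perm_big; apply: uniq_perm.
- by rewrite filter_uniq // iota_uniq.
- exact: nbrs_uniq.
move=> w; rewrite mem_filter mem_index_iota /= andb_idr // => wv.
by have /andP[] := nbrs_lt wv.
Qed.
End WalkSums.

Section WalkSumsC.
Variable R : realType.
Local Notation C := R[i].

Lemma sum_tuple_path k (v : 'I_9) (F : seq nat -> C) :
  \sum_(t : k.-tuple 'I_9 | path adj3311 v t) F [seq val w | w <- t] =
  \sum_(p <- walks k v) F p.
Proof.
elim: k v F => [|k IH] v F.
  rewrite big_mkcond (big_tuple0 (fun t => if path adj3311 v t then F (map val t) else 0)).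
  by rewrite big_walks0.
rewrite big_mkcond (big_tupleS _ (fun t => if path adj3311 v t then F (map val t) else 0)).
transitivity (\sum_(w | adj3311 v w) \sum_(p <- walks k w) F (val w :: p)).
  rewrite [RHS]big_mkcond; apply: eq_bigr => w _ /=; case: ifP => vw; last first.
    by rewrite big1.
  by rewrite -big_mkcond /= (IH w (fun p => F (val w :: p))).
rewrite sum_adj3311 big_walksS big_seq [RHS]big_seq; apply: eq_bigr => w vw.
by rewrite /= inordK //; case/andP: (nbrs_lt vw).
Qed.

(** Sums over walks in the tree become sums over the lists that the
    computation enumerates. *)
Lemma sum_tuple_walks k (F : seq nat -> C) :
  \sum_(t : k.+1.-tuple 'I_9 | sorted adj3311 t) F [seq val w | w <- t] =
  \sum_(v <- iota 0 9) \sum_(p <- walks k v) F (v :: p).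
Proof.
rewrite big_mkcond (big_tupleS _ (fun t => if sorted adj3311 t then F (map val t) else 0)).
rewrite -[iota 0 9]/(index_iota 0 9) big_mkord; apply: eq_bigr => v _ /=.
by rewrite -big_mkcond /= (sum_tuple_path k v (fun p => F (val v :: p))).
Qed.

End WalkSumsC.

(** * The values of A and B *)

Section Dimensions.
Variables (R : realType) (dim : 'I_9 -> R) (delta : R).
Hypothesis pf : perron_frobenius adj3311 dim delta.
Local Notation C := R[i].
Local Notation s := (Num.sqrt 3 : R).
Let d k := dim (inord k).
Let t := d 0%N.

Lemma s_gt1 : 1 < s.
Proof. by rewrite -[ltLHS]sqrtr1 ltr_sqrt ?ltr1n. Qed.

(** Starting at the end of arm 0, the eigenvector equations give all the
    dimensions as multiples of t. The equation at the centre then reads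
    (delta^2 - 3)^2 = 3, and the sign is determined by the positivity of
    delta^2 - 2. *)
Lemma dims3311 :
  [/\ delta * delta = 3 + s, 0 < delta
    & forall k, (k < 9)%N ->
      d k = (if even_vertex k then t else t * delta) * evr R (dn k)].
Proof.
have gt0 k : 0 < d k by case: pf => gt0 _; apply: gt0.
have nb k : (k < 9)%N -> \sum_(w <- nbrs k) d w = delta * d k.
  move=> k9; case: pf => _ /(_ (inord k)) <-.
  by rewrite (sum_adj3311 (inord k) dim) /= inordK.
have := nb 0%N isT; have := nb 1%N isT; have := nb 2%N isT; have := nb 3%N isT.
have := nb 4%N isT; have := nb 5%N isT; have := nb 6%N isT; have := nb 7%N isT.
have := nb 8%N isT; rewrite !big_cons !big_nil !addr0.
move=> e8 e7 e6 e5 e4 e3 e2 e1 e0.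
have t0 := gt0 0%N; have d7 := gt0 7%N; rewrite -/t in t0 e1 e0.
have de : 0 < delta by rewrite -(pmulr_lgt0 _ t0) -e0.
have d2E : d 2%N = (delta * delta - 1) * t by rewrite e0 in e1; nra.
have d3E : d 3%N = delta * (delta * delta - 2) * t.
  have -> : d 3%N = delta * d 2%N - d 1%N by rewrite -e2; ring.
  by rewrite d2E e0; ring.
have d4E : d 4%N = (delta * delta - 1) * d 6%N.
  have -> : d 4%N = delta * d 5%N - d 6%N by rewrite -e5; ring.
  by rewrite e6; ring.
have d3E' : d 3%N = delta * (delta * delta - 2) * d 6%N.
  have -> : d 3%N = delta * d 4%N - d 5%N by rewrite -e4; ring.
  by rewrite d4E e6; ring.
have d7E : d 7%N = (delta * delta - 2) * t.
  by apply: (mulfI (lt0r_neq0 de)); rewrite -e7 d3E; ring.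
have d8E : d 8%N = (delta * delta - 2) * t.
  by apply: (mulfI (lt0r_neq0 de)); rewrite -e8 d3E; ring.
have x2 : 0 < delta * delta - 2 by rewrite -(pmulr_lgt0 _ t0) -d7E.
(* Comparing the two expressions of dim c, from the arms 0 and 1. *)
have d6E : d 6%N = t.
  apply: (mulfI (lt0r_neq0 (mulr_gt0 de x2))).
  by rewrite -d3E' d3E.
rewrite d6E in d4E e6.
have q : (delta * delta - 3 - s) * (delta * delta - 3 + s) = 0.
  apply: (mulIf (lt0r_neq0 t0)); rewrite mul0r.
  move: e3; rewrite d2E d4E d7E d8E d3E => e3.
  transitivity ((delta * delta - 3) * (delta * delta - 3) * t - s * s * t); first by ring.
  rewrite sqrt3K; apply/eqP; rewrite subr_eq0 -subr_eq0; apply/eqP.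
  transitivity (delta * (delta * (delta * delta - 2) * t) -
    ((delta * delta - 1) * t + ((delta * delta - 1) * t + ((delta * delta - 2) * t + (delta * delta - 2) * t)))).
    by ring.
  by rewrite -e3 subrr.
have dd : delta * delta = 3 + s.
  move/eqP: q; rewrite mulf_eq0 => /orP[|] /eqP; first by lra.
  by have := s_gt1; lra.
split=> // k k9.
have z2 : ofZ 2 = 2 :> R by []. have z1 : ofZ 1 = 1 :> R by [].
have z0 : ofZ 0 = 0 :> R by [].
case: k k9 => [|[|[|[|[|[|[|[|[|//]]]]]]]]] _;
  rewrite /evr /dn /= !(z0, z1, z2) ?(e0, e6, d2E, d3E, d4E, d6E, d7E, d8E) ?dd -/t; ring.
Qed.

Lemma delta_ge2 : 2 <= delta.
Proof.
have [dd d0 _] := dims3311; have s1 := s_gt1.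
rewrite leNgt; apply/negP => d2.
have : delta * delta < 2 * 2 by rewrite ltr_pM // ltW.
by rewrite dd; lra.
Qed.

End Dimensions.

Section Hats.
Variables (R : realType) (dim : 'I_9 -> R) (delta : R).
Hypothesis pf : perron_frobenius adj3311 dim delta.
Local Notation C := R[i].
Local Notation s := (Num.sqrt 3 : R).
Local Notation ev := (@ev R).

Let t : R := dim (inord 0).

(** Loops of natural numbers, as used in the computation. *)
Definition nhat (S : gpa3311 R 4 false) (g : seq nat) : C :=
  hat dim S [seq inord v | v <- g].

(** The common factor of the prescribed values, chosen so that the tables have
    integral entries. *)
Definition unit_value (kappa : R) : C :=
  (kappa / (24 * (t * t * t) * (delta * delta) * ((1 + s) * (1 + s))))%:C.

Lemma bip3311 (v w : 'I_9) : adj3311 v w ->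
  odd (dist adj3311 root3311 w) = ~~ odd (dist adj3311 root3311 v).
Proof.
rewrite !dist3311 negbK adj3311E => vw.
have : all (fun v => all (fun w => nadj v w ==> (even_vertex w == ~~ even_vertex v))
    (iota 0 9)) (iota 0 9) by vm_compute.
move=> /allP/(_ v); rewrite mem_iota => /(_ (ltn_ord v))/allP/(_ w).
by rewrite mem_iota vw => /(_ (ltn_ord w))/eqP ->; rewrite negbK.
Qed.

Section OneBox.
Variables (S : gpa3311 R 4 false) (eps : bool) (tbl : table) (kappa : R).
Hypothesis SU : uncappable dim S.
Let sgn : zr3 := if eps then oppz z1 else z1.
Hypothesis Srho : rho dim S = ev sgn *: S.
Hypothesis Stbl : forall p z, (p, z) \in tbl -> nhat S p = unit_value kappa * ev z.
Hypothesis Sok : okt (loop_tree sgn tbl).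

Lemma inord_nbrs a (F : nat -> C) :
  \sum_(w <- nbrs a) (dim (inord w))%:C * F w =
  \sum_(w <- nbrs a) (if even_vertex w then t%:C * ev (dn w)
     else t%:C * delta%:C * ev (dn w)) * F w.
Proof.
have [_ _ dE] := dims3311 pf.
rewrite big_seq [RHS]big_seq; apply: eq_bigr => w /nbrs_lt/andP[w9 _].
by congr (_ * _); rewrite dE // -/t; case: ifP => _; rewrite !rmorphM.
Qed.

Lemma nbrs_sum0 a (F : 'I_9 -> C) :
  \sum_(w | adj3311 (inord a) w) F w = 0 -> \sum_(w <- nbrs a) F (inord w) = 0.
Proof.
case: (ltnP a 9) => a9; last by rewrite /nbrs nth_default // big_nil.
by rewrite sum_adj3311 inordK.
Qed.

Lemma nhat_sound v p : even_vertex v -> path nadj v p -> size p = 7 ->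
  nhat S (v :: p) = unit_value kappa * ev (getz (loop_tree sgn tbl) (v :: p)).
Proof.
move=> ev_v vp sp; rewrite /getz [head _ _]/= ev_v.
have [dd d0 _] := dims3311 pf; have [t0 _] : 0 < t /\ True by case: pf => ->.
apply: (@loop_tree_sound _ (nhat S) _ t%:C delta%:C) => //.
- by rewrite fmorph_eq0 gt_eqF.
- by rewrite fmorph_eq0 gt_eqF.
- move=> a [|c3 [|c4 [|c5 [|c6 [|c7 [|? ?]]]]]] // _.
  rewrite -inord_nbrs; apply: (nbrs_sum0 (F := fun w => (dim w)%:C * hat dim S
    [:: inord a; w; inord a; inord c3; inord c4; inord c5; inord c6; inord c7])).
  exact: hat_cap1 adj3311C pf _ _ SU _ _ _ _ _ _.
- move=> a c [|c4 [|c5 [|c6 [|c7 [|? ?]]]]] // _.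
  rewrite -inord_nbrs; apply: (nbrs_sum0 (F := fun w => (dim w)%:C * hat dim S
    [:: inord a; inord c; w; inord c; inord c4; inord c5; inord c6; inord c7])).
  exact: hat_cap2 adj3311C pf _ _ SU _ _ _ _ _ _.
- move=> g sg; rewrite /nhat map_rot.
  have -> : rot 2 [seq inord v | v <- g] = rot 1 (rot 1 [seq inord v | v <- g]) :> seq 'I_9.
    by rewrite -rotS ?size_map ?sg.
  rewrite -!(hat_fourier pf bip3311) ?size_rot ?size_map //.
  transitivity (ev sgn * hat dim (ev sgn *: S) [seq inord v | v <- g]).
    rewrite hat_scale mulrA /sgn; case: eps; rewrite ?evN !ev1.
      by rewrite mulrNN !mul1r.
    by rewrite !mul1r.
  by rewrite -Srho.
move=> u q uq sq; apply: contraNeq => hn.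
case: (boolP (loopb adj3311 root3311 4 false (inord u :: [seq inord v | v <- q]))) => [|no].
  case/and3P=> _ + _; rewrite /= rcons_path => /andP[_].
  have lt x : x \in u :: q -> (x < 9)%N.
    move: uq; rewrite inE => uq /predU1P[->|].
      by case: q sq uq {hn} => // x' q _ /andP[/nbrs_lt/andP[]].
    elim: q u uq {sq hn} => // y q IH u /andP[uy yq]; rewrite inE => /predU1P[->|].
      by case/andP: (nbrs_lt uy).
    exact: IH yq.
  rewrite (last_map (fun v => inord v : 'I_9)) adj3311E /= !inordK ?lt ?mem_head //.
  exact: mem_last.
by rewrite /nhat /= hat_out ?eqxx in hn.
Qed.

End OneBox.
End Hats.

Section Generators.
Variables (R : realType) (dim : 'I_9 -> R) (delta kappa : R).
Hypothesis pf : perron_frobenius adj3311 dim delta.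
Local Notation C := R[i].
Local Notation s := (Num.sqrt 3 : R).
Local Notation ev := (@ev R).
Local Notation evr := (@evr R).

Let t : R := dim (inord 0).

Lemma evr_lit (a b : Z) (x y : R) : ofZ a = x -> ofZ b = y -> evr (a, b) = x + y * s.
Proof. by move=> <- <-. Qed.

Lemma ellzE (a : seq nat) : all (fun j => j < 4)%N a ->
  [seq inord v : 'I_9 | v <- ellz a] = ell a.
Proof.
elim: a => [//|j a IH] /= /andP[j4 /IH].
rewrite /ell /ellz /= => ->.
have -> : inord 3 = c3311 by apply: val_inj; rewrite /= inordK.
congr [:: _, _ & _]; apply: val_inj.
by case: j j4 => [|[|[|[|//]]]] _; rewrite /u3311 /= inordK.
Qed.

Lemma dim_at k : (k < 9)%N ->
  dim (inord k) = (if even_vertex k then t else t * delta) * evr (dn k).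
Proof. by have [_ _ dE] := dims3311 pf; apply: dE. Qed.

(** Here hat contributes the weight sqrt(dim u_{a_1} dim u_{a_3}) / prod sqrt
    dim, which with the factor sqrt(d_{a_4} / d_{a_2}) of the prescription
    leaves 1 / (dim c ^ 2 dim u_{a_2}). *)
Lemma table_entry (S : gpa3311 R 4 false) a1 a2 a3 a4 (x : R) z :
  all (fun j => j < 4)%N [:: a1; a2; a3; a4] ->
  prescribed dim kappa S [:: a1; a2; a3; a4] x ->
  24 * x = evr (dn (val (u3311 a2))) * evr z ->
  nhat dim S (ellz [:: a1; a2; a3; a4]) = unit_value dim delta kappa * ev z.
Proof.
move=> a_lt + xz; rewrite /prescribed /nhat ellzE // /hat => ->.
set v := u3311 a4; set w := u3311 a2; rewrite /= -/v -/w.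
have bw : (Num.sqrt (dim v / dim w))%:C = rdim dim v / rdim dim w.
  exact: bend_weightE pf v w.
rewrite 2!rmorphM /= bw.
have dc : dim c3311 = t * delta * (1 + s).
  have -> : c3311 = inord 3 by apply: val_inj; rewrite /= inordK.
  by rewrite dim_at // (evr_lit (x := 1) (y := 1)) // mul1r.
have dw : dim w = t * evr (dn w).
  rewrite -{1}[w]inord_val dim_at ?ltn_ord //.
  have ev_u j : (j < 4)%N -> even_vertex (u3311 j) by do 4?case: j => [//|j].
  by rewrite ev_u //; case/and3P: a_lt.
rewrite /unit_value /wt !big_cons !big_nil /= -/v -/w.
transitivity ((kappa * x)%:C / ((dim c3311)%:C * (dim c3311)%:C * (dim w)%:C)).
  rewrite -!(rdim2 pf) rmorphM /=; field.
  by rewrite !(rdim_neq0 pf).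
rewrite -!rmorphM -fmorphV -!rmorphM; congr _%:C.
have [_ d0 _] := dims3311 pf; have t0 : 0 < t by case: pf => p0 _; apply: p0.
have s0 : 0 < 1 + s by have := s_gt1 R; lra.
have w0 : 0 < dim w by case: pf => p0 _; apply: p0.
have ew : evr (dn w) != 0.
  by apply/eqP => e0; move: w0; rewrite dw e0 mulr0 ltxx.
rewrite dc dw; have -> : x = evr (dn w) * evr z / 24 by rewrite -xz; field.
rewrite -/t; field.
by rewrite ew !(lt0r_neq0 _) //; apply: addr_gt0.
Qed.

Variables (A B : gpa3311 R 4 false).
Hypothesis AB : generators3311 dim kappa A B.

Ltac literals := rewrite /= ?(evr_lit erefl erefl);
  repeat match goal with
  | |- context [ @ofZ R (Zpos ?p) ] =>
      let n := eval vm_compute in (Pos.to_nat p) in change (@ofZ R (Zpos p)) with (n%:R : R)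
  | |- context [ @ofZ R (Zneg ?p) ] =>
      let n := eval vm_compute in (Pos.to_nat p) in change (@ofZ R (Zneg p)) with (- n%:R : R)
  | |- context [ @ofZ R Z0 ] => change (@ofZ R Z0) with (0 : R)
  end.

Lemma tables_sound p z :
  ((p, z) \in tableA -> nhat dim A p = unit_value dim delta kappa * ev z) /\
  ((p, z) \in tableB -> nhat dim B p = unit_value dim delta kappa * ev z).
Proof.
case: AB => [[_ _ [A1111 _]] [_ _ [B1111 _]] tAB _ _].
pose e k := nth ([::], (0, 0)) (table3311 R) k.
have tk k : (k < 10)%N -> prescribed dim kappa A (e k).1 (e k).2.1 /\
    prescribed dim kappa B (e k).1 (e k).2.2.
  move=> k10; apply: tAB; have -> : ((e k).1, ((e k).2.1, (e k).2.2)) = e k.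
    by case: (e k) => a [].
  exact: mem_nth.
have s2 := sqrt3K R.
have zero S : value S (ell [:: 1; 1; 1; 1]%N) = 0 ->
    nhat dim S (ellz [:: 1; 1; 1; 1]%N) = unit_value dim delta kappa * ev z0.
  by move=> S0; rewrite /nhat ellzE // /hat S0 !mul0r ev0 mulr0.
split=> /mapP[[a z'] az [-> ->]] {p z}; move: az; rewrite !inE;
  (case/predU1P => [[-> ->]|]; first exact: zero).
- case/predU1P => [[-> ->]|]; first by apply: table_entry (tk 0%N isT).1 _ => //; literals; lra.
  case/predU1P => [[-> ->]|]; first by apply: table_entry (tk 1%N isT).1 _ => //; literals; lra.
  case/predU1P => [[-> ->]|]; first by apply: table_entry (tk 2%N isT).1 _ => //; literals; lra.
  case/predU1P => [[-> ->]|]; first by apply: table_entry (tk 3%N isT).1 _ => //; literals; lra.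
  case/predU1P => [[-> ->]|]; first by apply: table_entry (tk 4%N isT).1 _ => //; literals; lra.
  case/predU1P => [[-> ->]|]; first by apply: table_entry (tk 5%N isT).1 _ => //; literals; lra.
  case/predU1P => [[-> ->]|]; first by apply: table_entry (tk 6%N isT).1 _ => //; literals; lra.
  case/predU1P => [[-> ->]|]; first by apply: table_entry (tk 7%N isT).1 _ => //; literals; lra.
  case/predU1P => [[-> ->]|]; first by apply: table_entry (tk 8%N isT).1 _ => //; literals; lra.
  by case/eqP=> -> ->; apply: table_entry (tk 9%N isT).1 _ => //; literals; lra.
- case/predU1P => [[-> ->]|]; first by apply: table_entry (tk 0%N isT).2 _ => //; literals; lra.
  case/predU1P => [[-> ->]|]; first by apply: table_entry (tk 1%N isT).2 _ => //; literals; lra.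
  case/predU1P => [[-> ->]|]; first by apply: table_entry (tk 2%N isT).2 _ => //; literals; lra.
  case/predU1P => [[-> ->]|]; first by apply: table_entry (tk 3%N isT).2 _ => //; literals; lra.
  case/predU1P => [[-> ->]|]; first by apply: table_entry (tk 4%N isT).2 _ => //; literals; lra.
  case/predU1P => [[-> ->]|]; first by apply: table_entry (tk 5%N isT).2 _ => //; literals; lra.
  case/predU1P => [[-> ->]|]; first by apply: table_entry (tk 6%N isT).2 _ => //; literals; lra.
  case/predU1P => [[-> ->]|]; first by apply: table_entry (tk 7%N isT).2 _ => //; literals; lra.
  case/predU1P => [[-> ->]|]; first by apply: table_entry (tk 8%N isT).2 _ => //; literals; lra.
  by case/eqP=> -> ->; apply: table_entry (tk 9%N isT).2 _ => //; literals; lra.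
Qed.

End Generators.

(** * The normalization kappa = 1 *)

Section Normalization.
Variables (R : realType) (dim : 'I_9 -> R) (delta kappa : R).
Hypothesis pf : perron_frobenius adj3311 dim delta.
Local Notation C := R[i].
Local Notation s := (Num.sqrt 3 : R).
Local Notation ev := (@ev R).
Local Notation evr := (@evr R).
Variables (A B : gpa3311 R 4 false).
Hypothesis AB : generators3311 dim kappa A B.

Let t : R := dim (inord 0).

Lemma okA : okt treeA. Proof. by have /andP[] := check_true. Qed.
Lemma okB : okt treeB. Proof. by have /and3P[] := check_true. Qed.

Lemma nhatA v p : even_vertex v -> path nadj v p -> size p = 7 ->
  nhat dim A (v :: p) = unit_value dim delta kappa * ev (getz treeA (v :: p)).
Proof.
case: AB => [[AU Arho _] _ _ _ _]; apply: (nhat_sound pf (eps := true) AU _ _ okA).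
- by rewrite evN ev1 scaleN1r.
- by move=> q z; have [] := tables_sound pf AB q z.
Qed.

Lemma nhatB v p : even_vertex v -> path nadj v p -> size p = 7 ->
  nhat dim B (v :: p) = unit_value dim delta kappa * ev (getz treeB (v :: p)).
Proof.
case: AB => [_ [BU Brho _] _ _ _]; apply: (nhat_sound pf (eps := false) BU _ _ okB).
- by rewrite ev1 scale1r.
- by move=> q z; have [] := tables_sound pf AB q z.
Qed.

Lemma sum_adj_nat v (F : 'I_9 -> C) : (v < 9)%N ->
  \sum_(w | adj3311 (inord v) w) F w = \sum_(w <- nbrs v) F (inord w).
Proof. by move=> v9; rewrite sum_adj3311 inordK. Qed.

Lemma nadj_parity v w : nadj v w -> even_vertex w = ~~ even_vertex v.
Proof.
move=> vw; have /andP[w9 v9] := nbrs_lt vw.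
have := @bip3311 (inord v) (inord w); rewrite adj3311E !dist3311 !inordK // => /(_ vw).
by rewrite negbK => <-; rewrite negbK.
Qed.

Lemma ev_trace_sum : ev (trace_sum treeA) =
  \sum_(p <- walks 4 0) \sum_(m <- walks 3 0 | last 0%N p \in nbrs (last 0%N m))
    ev (foldr (fun v z => mulz (dn v) z) z1 (p ++ m)) *
    (ev (getz treeA (0%N :: p ++ rev m)) * ev (getz treeA (0%N :: m ++ rev p))).
Proof.
rewrite /trace_sum.
have evS (l : seq zr3) : ev (foldr addz z0 l) = \sum_(z <- l) ev z.
  by elim: l => [|z l IH]; rewrite ?big_nil ?ev0 // big_cons -IH -evD.
rewrite evS big_map big_filter big_mkcond big_allpairs /=.
apply: eq_bigr => p _; rewrite [RHS]big_mkcond; apply: eq_bigr => m _.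
by case: ifP => // _; rewrite !evM.
Qed.

Lemma sum_adj_walks4 v (F : seq 'I_9 -> C) : (v < 9)%N ->
  \sum_(p1 | adj3311 (inord v) p1) \sum_(p2 | adj3311 p1 p2)
    \sum_(p3 | adj3311 p2 p3) \sum_(p4 | adj3311 p3 p4) F [:: p1; p2; p3; p4] =
  \sum_(p <- walks 4 v) F [seq inord w | w <- p].
Proof.
move=> v9; rewrite sum_adj_nat // big_walksS big_seq [RHS]big_seq.
apply: eq_bigr => p1 /nbrs_lt/andP[lt1 _]; rewrite sum_adj_nat // big_walksS big_seq [RHS]big_seq.
apply: eq_bigr => p2 /nbrs_lt/andP[lt2 _]; rewrite sum_adj_nat // big_walksS big_seq [RHS]big_seq.
apply: eq_bigr => p3 /nbrs_lt/andP[lt3 _]; rewrite sum_adj_nat // big_walksS.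
by apply: eq_bigr => p4 _; rewrite big_walks0.
Qed.

Lemma sum_walks3 v (F : seq 'I_9 -> C) : (v < 9)%N ->
  (forall p, ~~ path adj3311 (inord v) p -> F p = 0) ->
  \sum_m1 \sum_m2 \sum_m3 F [:: m1; m2; m3] = \sum_(m <- walks 3 v) F [seq inord w | w <- m].
Proof.
move=> v9 F0; rewrite -big_tuple3.
have := sum_tuple_path 3 (inord v) (fun m => F [seq inord w | w <- m]).
rewrite inordK // => <-; rewrite [RHS]big_mkcond; apply: eq_bigr => m _.
rewrite -map_comp (eq_map (g := id)) => [|w]; last exact: inord_val.
by rewrite map_id; case: ifP => // /negbT /F0.
Qed.

Local Arguments getz : simpl never.

(** The trace at the root, where dim v is t: the powers of t and delta in the
    weights and in unit_value cancel. *)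
Lemma trace_mul_root : trace_mul dim A A (inord 0) =
  (kappa * kappa / (576 * (28 + 16 * s)))%:C * ev (trace_sum treeA).
Proof.
rewrite (trace_mulE adj3311C pf) ev_trace_sum mulr_sumr.
pose L p m := if (p, m) is ([:: p1; p2; p3; p4], [:: m1; m2; m3]) then
  (dim p1)%:C * (dim p2)%:C * (dim p3)%:C * (dim p4)%:C / (dim (inord 0))%:C *
  (dim m1)%:C * (dim m2)%:C * (dim m3)%:C *
  hat dim A [:: inord 0; p1; p2; p3; p4; m3; m2; m1] *
  hat dim A [:: inord 0; m1; m2; m3; p4; p3; p2; p1] else 0.
have LE p1 p2 p3 p4 m1 m2 m3 : L [:: p1; p2; p3; p4] [:: m1; m2; m3] =
  (dim p1)%:C * (dim p2)%:C * (dim p3)%:C * (dim p4)%:C / (dim (inord 0))%:C *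
  (dim m1)%:C * (dim m2)%:C * (dim m3)%:C *
  hat dim A [:: inord 0; p1; p2; p3; p4; m3; m2; m1] *
  hat dim A [:: inord 0; m1; m2; m3; p4; p3; p2; p1] by [].
transitivity (\sum_(p <- walks 4 0) \sum_m1 \sum_m2 \sum_m3
  L [seq inord w | w <- p] [:: m1; m2; m3]).
  by rewrite -(sum_adj_walks4 (fun p => \sum_m1 \sum_m2 \sum_m3 L p [:: m1; m2; m3])).
rewrite big_seq [RHS]big_seq; apply: eq_bigr => p; rewrite mem_walks => /andP[sp pp].
rewrite (sum_walks3 (v := 0)) //; last first.
  move=> m nm; move: p sp pp => [|p1 [|p2 [|p3 [|p4 [|? ?]]]]] // _ _.
  case: m nm => [|m1 [|m2 [|m3 [|? ?]]]] // nm; rewrite /L /=.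
  rewrite [X in _ * X]hat_out ?mulr0 //; apply: contra nm.
  by case/and3P=> _ /= /and4P[-> -> -> _].
rewrite mulr_sumr [RHS]big_mkcond big_seq [RHS]big_seq; apply: eq_bigr => m.
rewrite mem_walks => /andP[sm pm].
move: p sp pp => [|p1 [|p2 [|p3 [|p4 [|? ?]]]]] // _ /and5P[e1 e2 e3 e4 _].
move: m sm pm => [|m1 [|m2 [|m3 [|? ?]]]] // _ /and4P[f1 f2 f3 _].
rewrite [last _ _]/= [last _ _]/= [map _ _]/= [map _ _]/= LE; case: ifP => [e5|/negbT ne]; last first.
  rewrite [X in _ * X]hat_out ?mulr0 //; apply: contra ne.
  case/and3P=> _ /= /and5P[_ _ _]; rewrite adj3311E !inordK //.
  - by case/andP: (nbrs_lt e4).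
  - by case/andP: (nbrs_lt f3).
have e5' : nadj p4 m3 by rewrite nadjC.
have hp : path nadj 0%N [:: p1; p2; p3; p4; m3; m2; m1].
  by rewrite /= e1 e2 e3 e4 e5' nadjC f3 nadjC f2.
have hm : path nadj 0%N [:: m1; m2; m3; p4; p3; p2; p1].
  by rewrite /= f1 f2 f3 [nadj m3 _]e5 nadjC e4 nadjC e3 nadjC e2.
have := nhatA (v := 0%N) isT hp erefl; have := nhatA (v := 0%N) isT hm erefl.
rewrite /nhat /= => -> ->.
have dC k (b : bool) : (k < 9)%N -> even_vertex k = b ->
    (dim (inord k))%:C = (if b then t%:C else t%:C * delta%:C) * ev (dn k).
  by move=> k9 <-; rewrite (dim_at pf) // rmorphM -/t; case: ifP; rewrite ?rmorphM.
have lt v w : nadj v w -> (w < 9)%N by move=> /nbrs_lt/andP[].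
have E1 := nadj_parity e1; have E2 := nadj_parity e2; have E3 := nadj_parity e3.
have E4 := nadj_parity e4; have F1 := nadj_parity f1; have F2 := nadj_parity f2.
have F3 := nadj_parity f3.
rewrite E1 in E2; rewrite E2 in E3; rewrite E3 in E4; rewrite F1 in F2; rewrite F2 in F3.
rewrite (dC _ _ (lt _ _ e1) E1) (dC _ _ (lt _ _ e2) E2) (dC _ _ (lt _ _ e3) E3).
rewrite (dC _ _ (lt _ _ e4) E4) (dC _ _ (lt _ _ f1) F1) (dC _ _ (lt _ _ f2) F2).
rewrite (dC _ _ (lt _ _ f3) F3) -/t !evM /= ev1 mulr1 /unit_value -/t.
have [dd d0 _] := dims3311 pf; have t0 : 0 < t by case: pf => p0 _; apply: p0.
have s0 : 0 < 1 + s by have := s_gt1 R; lra.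
have -> : 28 + 16 * s = (1 + s) * (1 + s) * ((1 + s) * (1 + s)).
  have s2 := sqrt3K R; have -> : (1 + s) * (1 + s) = 4 + 2 * s by lra.
  by lra.
rewrite !(rmorphM, fmorphV) /=; field.
have c0 (x : R) : 0 < x -> x%:C != 0 by move=> x0; rewrite fmorph_eq0 gt_eqF.
by apply/and3P; split; [have := c0 _ s0; rewrite rmorphD | exact: c0 | exact: c0].
Qed.

Lemma trace_sumE : ev (trace_sum treeA) = (64 * (28 + 16 * s) * (12 + 8 * s))%:C.
Proof.
have /and4P[_ _ /ev_nil] := check_true.
move/(_ R)/eqP; rewrite evD evN subr_eq0 => /eqP -> _.
rewrite /trace_value !evM /ev -!rmorphM; congr _%:C.
rewrite !(evr_lit erefl erefl).
have lit n : ofZ (Z.of_nat n) = n%:R :> R.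
  by rewrite /ofZ (_ : ssrZ.int_of_Z _ = n) // -[RHS]ssrZ.Z_of_intK.
by rewrite (lit 64%N) (lit 0%N) (lit 28%N) (lit 16%N) (lit 12%N) (lit 8%N) mul0r addr0 mulrA.
Qed.

(** The trace is proportional to the square of kappa, and the computed
    constant is the prescribed one at kappa = 1. *)
Lemma kappa1 : kappa = 1.
Proof.
have s1 := s_gt1 R; case: AB => _ _ _ k0 /(_ (inord 0)); rewrite dist3311 inordK // => /(_ isT).
rewrite trace_mul_root trace_sumE -rmorphM => /(fmorph_inj _) E.
have q0 : 28 + 16 * s != 0 by rewrite gt_eqF //; lra.
have r0 : 12 + 8 * s != 0 by rewrite gt_eqF //; lra.
have kk : kappa * kappa = 1.
  apply: (mulIf r0); transitivity (9 * ((12 + 8 * s) / 9)); last by field.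
  by rewrite -E; field.
have /eqP : (kappa - 1) * (kappa + 1) = 0.
  by transitivity (kappa * kappa - 1); [ring | rewrite kk subrr].
by rewrite mulf_eq0 => /orP[] /eqP; lra.
Qed.

End Normalization.

(** * Nearest roots of biquadratic polynomials *)

Section SignTests.
Local Open Scope Z_scope.

(** A sufficient condition for a + b sqrt 3 > 0, from 1.7320 < sqrt 3 <
    1.7321. *)
Definition posz (x : zr3) : bool :=
  0 <? 10000 * x.1 + (if 0 <=? x.2 then 17320 else 17321) * x.2.

(** With M = 10^12, the conditions say in units of 10^-6 that the square root
    of (n + m sqrt 3) / k4 lies strictly between lo and hi and that the square
    root of (n - m sqrt 3) / k4 lies outside. *)
Definition nearest_test (k4 n m lo hi : Z) : bool :=
  let M := 10 ^ 12 in
  [&& 0 <? k4, 0 <? lo, 0 <? hi, posz (n, - m),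
      posz (M * n - lo * lo * k4, M * m), posz (hi * hi * k4 - M * n, - (M * m)) &
      posz (lo * lo * k4 - M * n, M * m) || posz (M * n - hi * hi * k4, - (M * m))].

(** The roots of k4 x^4 + k2 x^2 + k0 in x^2 are e (n + m sqrt 3) / k4 and e
    (n - m sqrt 3) / k4. *)
Definition biquadratic (k4 k2 k0 e n m : Z) : bool :=
  (k2 =? - (e * 2 * n)) && (k0 * k4 =? n * n - 3 * (m * m)).

End SignTests.

Section NearestRoots.
Variable R : realType.
Local Notation C := R[i].
Local Notation s := (Num.sqrt 3 : R).
Local Notation evr := (@evr R).

Lemma ofZB a b : ofZ (Z.sub a b) = ofZ a - ofZ b :> R.
Proof. by rewrite /Z.sub ofZD ofZN. Qed.

Lemma ofZ_lt a b : Z.ltb a b -> ofZ a < ofZ b :> R.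
Proof. by move=> ab; rewrite /ofZ ltr_int; lia. Qed.

Lemma ofZ_ge0 a : Z.le 0 a -> 0 <= ofZ a :> R.
Proof. by move=> a0; rewrite /ofZ ler0z; lia. Qed.

Lemma ofZ_le0 a : Z.le a 0 -> ofZ a <= 0 :> R.
Proof. by move=> a0; rewrite /ofZ lerz0; lia. Qed.

Lemma ofZ_0 : ofZ 0 = 0 :> R. Proof. by []. Qed.
Lemma ofZ_3 : ofZ 3 = 3 :> R. Proof. by []. Qed.

Local Opaque ofZ.

Lemma ofZ_gt0 a : Z.ltb 0 a -> 0 < ofZ a :> R.
Proof. by rewrite -ofZ_0; exact: ofZ_lt. Qed.

Lemma sqrt3_bounds : (ofZ 17320 : R) < ofZ 10000 * s < ofZ 17321.
Proof.
have s0 : 0 <= s by rewrite sqrtr_ge0.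
have p0 : 0 <= ofZ 10000 :> R by apply/ltW/ofZ_gt0.
have ss : ofZ 10000 * s * (ofZ 10000 * s) = ofZ (Z.mul (Z.mul 10000 10000) 3).
  by rewrite mulrACA sqrt3K !ofZM ofZ_3.
have sq (x y : R) : 0 <= y -> x * x < y * y -> x < y.
  by move=> y0; apply: contraTT; rewrite -!leNgt => yx; apply: ler_pM.
apply/andP; split; apply: sq.
- by apply: mulr_ge0.
- by rewrite ss -ofZM; apply: ofZ_lt.
- exact/ltW/ofZ_gt0.
by rewrite ss -ofZM; apply: ofZ_lt.
Qed.

Lemma posz_gt0 x : posz x -> 0 < evr x.
Proof.
case: x => a b; rewrite /posz /evr [(a, b).1]/= [(a, b).2]/= => /ofZ_lt.
have /andP[lo hi] := sqrt3_bounds.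
have p0 : 0 < ofZ 10000 :> R by apply: ofZ_gt0.
rewrite ofZD !ofZM => ab; rewrite -(pmulr_rgt0 _ p0) mulrDr mulrCA.
apply: lt_le_trans ab _; rewrite lerD2l mulrC.
case: (Z.leb_spec 0 b) => b0.
  by apply: ler_wpM2l; [exact: ofZ_ge0 | exact: (ltW lo)].
by apply: ler_wnM2l; [exact/ofZ_le0/Z.lt_le_incl | exact: (ltW hi)].
Qed.

Lemma horner_biquadratic k4 k2 k0 (x : C) :
  (Poly [seq (ofZ k)%:C | k <- rev [:: k4; Z0; k2; Z0; k0]]).[x] =
  (ofZ k4)%:C * (x * x * (x * x)) + (ofZ k2)%:C * (x * x) + (ofZ k0)%:C.
Proof.
rewrite horner_Poly /=; have -> : (ofZ 0)%:C = 0 :> C by [].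
ring.
Qed.

Lemma normC_real (x : R) : `|x%:C| = `|x|%:C.
Proof. by rewrite normc_def /= expr0n addr0 sqrtr_sqr. Qed.

(** The four roots are a, - a, b and - b times u, on the line through u which
    contains z as well; among them the one closest to z is found by comparing
    real numbers. *)
Lemma lambda_line (u : C) (e a b z : R) k4 k2 k0 :
  `|u| = 1 -> u * u = e%:C -> e * e = 1 -> ofZ k4 != 0 :> R ->
  ofZ k2 = - (e * ofZ k4 * (a * a + b * b)) ->
  ofZ k0 = ofZ k4 * (a * a) * (b * b) ->
  `|a - z| < `|a + z| -> `|a - z| < `|b - z| -> `|a - z| < `|b + z| ->
  lambda [:: k4; Z0; k2; Z0; k0] (z%:C * u) = a%:C * u.
Proof.
move=> u1 uu ee k40 e2 e0 d1 d2 d3; rewrite /lambda; set p := Poly _.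
have dist (c : R) : `|c%:C * u - z%:C * u| = `|c - z|%:C.
  by rewrite -mulrBl normrM u1 mulr1 -rmorphB normC_real.
have rootP x : root p x -> x = a%:C * u \/ `|a%:C * u - z%:C * u| < `|x - z%:C * u|.
  rewrite rootE horner_biquadratic e2 e0 => /eqP px.
  have : (ofZ k4)%:C * ((x - a%:C * u) * (x - (- a)%:C * u) *
      ((x - b%:C * u) * (x - (- b)%:C * u))) = 0.
    rewrite -[RHS]px !(rmorphN, rmorphM, rmorphD) /=.
    transitivity ((ofZ k4)%:C * (x * x * (x * x) - (a%:C * a%:C + b%:C * b%:C) * (x * x) * (u * u) +
       a%:C * a%:C * (b%:C * b%:C) * ((u * u) * (u * u)))); first by ring.
    rewrite uu -[e%:C * e%:C]rmorphM ee rmorph1; ring.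
  move/eqP; rewrite !mulf_eq0 fmorph_eq0 (negbTE k40) /=.
  case/orP=> /orP[]; rewrite subr_eq0 => /eqP ->; [by left | right | right | right].
  - by rewrite !dist ltcR -[- a - z]opprD normrN.
  - by rewrite !dist ltcR.
  - by rewrite !dist ltcR -[- b - z]opprD normrN.
have pa : root p (a%:C * u).
  rewrite rootE horner_biquadratic e2 e0 !(rmorphN, rmorphM, rmorphD) /=; apply/eqP.
  transitivity ((ofZ k4)%:C * (a%:C * a%:C) * ((a%:C * a%:C * (u * u * (u * u))) - e%:C * (a%:C * a%:C + b%:C * b%:C) * (u * u) + b%:C * b%:C)); first by ring.
  rewrite uu -mulrA; set E := e%:C; have EE : E * E = 1 by rewrite -rmorphM ee.
  transitivity ((ofZ k4)%:C * (a%:C * a%:C * ((a%:C * a%:C + b%:C * b%:C) * (1 - E * E)))).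
    transitivity ((ofZ k4)%:C * (a%:C * a%:C * (a%:C * a%:C * (E * E) - (a%:C * a%:C + b%:C * b%:C) * (E * E) + b%:C * b%:C))).
      by ring.
    by rewrite EE; ring.
  by rewrite EE subrr !mulr0.
apply: xget_unique.
  split=> // x /rootP[->|/ltW] //.
by move=> y [/rootP[//|d] /(_ _ pa)/(lt_le_trans d)]; rewrite ltxx.
Qed.

Lemma evr_pair a b : evr (a, b) = ofZ a + ofZ b * s. Proof. by []. Qed.

Lemma lt_of_sqr (x y : R) : 0 <= y -> x * x < y * y -> x < y.
Proof. by move=> y0; apply: contraTT; rewrite -!leNgt => yx; apply: ler_pM. Qed.

Lemma diff_sq (x y : R) : (x + y * s) * (x - y * s) = x * x - 3 * (y * y).
Proof. by have := sqrt3K R; move: s => q <-; ring. Qed.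

(** The root a lies in the interval (lo, hi) with centre z, in units of 10^-6.
    The other roots are outside it, hence further away. *)
Lemma lambda_biquadratic (u : C) (e k4 k2 k0 n m lo hi : Z) (a z : R) :
  `|u| = 1 -> u * u = (ofZ e)%:C -> ofZ e * ofZ e = 1 :> R ->
  biquadratic k4 k2 k0 e n m -> nearest_test k4 n m lo hi ->
  0 < a -> a * a * ofZ k4 = evr (n, m) ->
  ofZ (Z.pow 10 6) * (2 * z) = ofZ lo + ofZ hi ->
  lambda [:: k4; Z0; k2; Z0; k0] (z%:C * u) = a%:C * u.
Proof.
move=> u1 uu ee /andP[/Z.eqb_eq e2 /Z.eqb_eq e0].
case/and5P=> /ofZ_gt0 K0 /ofZ_gt0 lo0 /ofZ_gt0 hi0 /posz_gt0 b0.
case/and3P=> /posz_gt0 alo /posz_gt0 ahi test.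
move=> a0 aE zE; set T := ofZ (Z.pow 10 6) in zE; set K := ofZ k4 in K0 aE.
have T0 : 0 < T by apply: ofZ_gt0.
have TT : ofZ (Z.pow 10 12) = T * T by rewrite /T -ofZM.
move: b0 alo ahi test; rewrite !evr_pair !ofZN.
move: (Z.pow 10 12) TT => M TT.
set L := ofZ lo in lo0 zE *; set H := ofZ hi in hi0 zE *.
set N := ofZ n in aE *; set m' := ofZ m in aE *; rewrite !(ofZB, ofZM) TT -/N -/m' -/K -/L -/H.
rewrite evr_pair -/N -/m' in aE.
move=> b0 alo ahi test; pose b := Num.sqrt ((N - m' * s) / K).
have bE : b * b * K = N - m' * s.
  by rewrite -expr2 sqr_sqrtr ?divfK ?gt_eqF // ltW // divr_gt0 // -mulNr.
have sc (x : R) : (T * x) * (T * x) * K = T * T * (x * x * K) by ring.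
have lt_sc (x y : R) : 0 <= y -> x * x * K < y * y * K -> x < y.
  by move=> y0; rewrite ltr_pM2r //; apply: lt_of_sqr.
have Ta0 : 0 <= T * a by apply: mulr_ge0; apply: ltW.
have Tb0 : 0 <= T * b by apply: mulr_ge0; [apply: ltW | apply: sqrtr_ge0].
have La : L < T * a by apply: lt_sc => //; rewrite sc aE; lra.
have aH : T * a < H by apply: (lt_sc _ _ (ltW hi0)); rewrite sc aE; lra.
have bLH : T * b < L \/ H < T * b.
  case/orP: test => /posz_gt0; rewrite evr_pair ?ofZN !(ofZB, ofZM) TT -/N -/m' -/K -/L -/H => t.
    by left; apply: (lt_sc _ _ (ltW lo0)); rewrite sc bE; lra.
  by right; apply: lt_sc => //; rewrite sc bE; lra.
have [l lE] : exists l, L = T * l by exists (L / T); rewrite mulrC divfK ?gt_eqF.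
have [h hE] : exists h, H = T * h by exists (H / T); rewrite mulrC divfK ?gt_eqF.
move: lo0 La aH bLH zE; rewrite lE hE !ltr_pM2l // -mulrDr => lo0 la ah blh.
have {lo0} l0 : 0 < l by rewrite -(pmulr_rgt0 _ T0).
move=> /(mulfI (lt0r_neq0 T0)) zE.
have b_ge0 : 0 <= b by apply: sqrtr_ge0.
have near : `|a - z| < (h - l) / 2 by rewrite ltr_distl; clear -la ah zE; apply/andP; split; lra.
have far (y : R) : (h - l) / 2 <= y \/ (h - l) / 2 <= - y -> `|a - z| < `|y|.
  by move=> yl; apply: lt_le_trans near _; rewrite ler_normr; apply/orP.
apply: (lambda_line (e := ofZ e) (b := b)) => //.
- by rewrite gt_eqF.
- rewrite e2 !(ofZN, ofZM) -/N; congr (- _).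
  have -> : ofZ 2 = 2 :> R by [].
  rewrite -/K -!mulrA; congr (_ * _).
  transitivity (a * a * K + b * b * K); last by ring.
  by rewrite aE bE; lra.
- apply: (mulIf (lt0r_neq0 K0)); rewrite -[LHS]ofZM e0 ofZB !ofZM ofZ_3 -/N -/m' -/K.
  transitivity (a * a * K * (b * b * K)); last by ring.
  by rewrite aE bE diff_sq.
- by apply: far; left; clear -la l0 ah zE; lra.
- by apply: far; move: (b) blh => y; clear -zE; case=> ?; [right | left]; lra.
- by apply: far; left; move: (b) b_ge0 => y; clear -zE l0; lra.
Qed.

End NearestRoots.

(** * The entries of the relation matrices *)

Section Entries.
Local Open Scope Z_scope.

(** The value is Y / (N D) times u, where D^2 = Dz; D is delta for the entries
    which lie in delta^-1 Q(sqrt 3). The decimal approximation is wide enough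
    for an interval of radius 1000 10^-6. *)
Definition entry_test (k4 k2 k0 e n m c : Z) (j : nat) (Y : zr3) (N : Z) (Dz : zr3) : bool :=
  let z := c * 10 ^ Z.of_nat j in
  [&& biquadratic k4 k2 k0 e n m, nearest_test k4 n m (z - 1000) (z + 1000),
      posz Y, 0 <? N,
      nilz (addz (mulz (mulz Y Y) (k4, 0)) (oppz (mulz (mulz (n, m) Dz) (N * N, 0)))) &
      e * e =? 1].

End Entries.

Section Matrices.
Variable R : realType.
Local Notation C := R[i].
Local Notation s := (Num.sqrt 3 : R).
Local Notation evr := (@evr R).

Lemma evrM x y : evr (mulz x y) = evr x * evr y.
Proof. by have /(congr1 (@complex.Re R)) := evM R x y; rewrite /ev -rmorphM. Qed.

Lemma evr_nil x y : nilz (addz x (oppz y)) -> evr x = evr y.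
Proof.
move=> /(ev_nil R); rewrite evD evN => /eqP; rewrite subr_eq0 => /eqP.
by rewrite /ev => /(fmorph_inj _).
Qed.

Lemma evr_int a : evr (a, Z0) = ofZ a.
Proof. by rewrite /evr /= ofZ_0 mul0r addr0. Qed.

Local Opaque ofZ.

Lemma ofZ_pow10 k : ofZ (Z.pow 10 (Z.of_nat k)) = 10 ^+ k :> R.
Proof.
elim: k => [|k IH]; first by rewrite expr0; have := ev1 R; rewrite /ev /z1 evr_int => /(congr1 (@complex.Re R)).
have z10 : ofZ 10 = 10 :> R by [].
by rewrite Nat2Z.inj_succ Z.pow_succ_r ?ofZM ?IH ?z10 ?exprS //; apply: Nat2Z.is_nonneg.
Qed.

Lemma lambda_entry (u : C) (D : R) e k4 k2 k0 n m c k j Y N Dz :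
  (k + j = 6)%N -> `|u| = 1 -> u * u = (ofZ e)%:C -> 0 < D -> D * D = evr Dz ->
  entry_test k4 k2 k0 e n m c j Y N Dz ->
  lambda [:: k4; Z0; k2; Z0; k0] ((decimal c k)%:C * u) = (evr Y / (ofZ N * D))%:C * u.
Proof.
move=> kj u1 uu D0 DD /and5P[bq nt Yp Np /andP[YN /Z.eqb_eq ee]].
have Y0 : 0 < evr Y by apply: posz_gt0.
have N0 : 0 < ofZ N :> R by apply: ofZ_gt0.
have {}YN := evr_nil YN; rewrite !evrM !evr_int ofZM -DD in YN.
apply: (lambda_biquadratic u1 uu _ bq nt).
- by rewrite -ofZM ee -evr_int; have := ev1 R; rewrite /ev => /(congr1 (@complex.Re R)).
- by rewrite divr_gt0 ?mulr_gt0.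
- transitivity (evr Y * evr Y * ofZ k4 / (ofZ N * ofZ N * (D * D))).
    by field; rewrite !lt0r_neq0.
  by rewrite YN; field; rewrite !lt0r_neq0.
have z6 : Z.pow 10 6 = Z.pow 10 (Z.of_nat (k + j)) by rewrite kj.
rewrite z6 ofZB ofZD ofZM !ofZ_pow10 /decimal exprD.
have t0 : (10 : R) ^+ k != 0 by rewrite expf_neq0 // pnatr_eq0.
move: (ofZ 1000) (10 ^+ j) (10 ^+ k) (ofZ c) t0 => x y w d w0.
have -> : w * y * (2 * (d / w)) = 2 * (d * y) by field.
by ring.
Qed.

End Matrices.

Section Coefficients.
Variables (R : realType) (delta : R).
Local Notation C := R[i].
Local Notation s := (Num.sqrt 3 : R).
Local Notation evr := (@evr R).
Hypothesis delta_gt0 : 0 < delta.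
Hypothesis delta2 : delta * delta = 3 + s.

Lemma imE (x : R) : x*i = x%:C * 'i.
Proof. by simpc. Qed.

Lemma decimalN c k : decimal (Z.opp c) k = - decimal c k :> R.
Proof. by rewrite /decimal ofZN mulNr. Qed.

Lemma imNE c k : (decimal (Z.opp c) k)*i = (decimal c k)%:C * - 'i :> C.
Proof. by rewrite imE decimalN rmorphN mulNr mulrN. Qed.

Lemma reNE c k : (decimal (Z.opp c) k)%:C = (decimal c k)%:C * - 1 :> C.
Proof. by rewrite decimalN rmorphN mulrN1. Qed.

Lemma norm_i : `|'i| = 1 :> C.
Proof. by rewrite normc_def /= expr0n expr1n add0r sqrtr1. Qed.

Lemma sqr_i : 'i * 'i = (ofZ (Zneg xH))%:C :> C.
Proof. by simpc. Qed.

(** The entries, multiplied by D, as elements of Q(sqrt 3) times u. *)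
Lemma entry_line (u : C) (D : R) e k4 k2 k0 n m c k j Y N Dz :
  `|u| = 1 -> u * u = (ofZ e)%:C -> 0 < D -> D * D = evr Dz -> (k + j = 6)%N ->
  entry_test k4 k2 k0 e n m c j Y N Dz ->
  lambda [:: k4; Z0; k2; Z0; k0] ((decimal c k)%:C * u) * D%:C = (evr Y / ofZ N)%:C * u.
Proof.
move=> u1 uu D0 DD kj test; rewrite (lambda_entry kj u1 uu D0 DD test) mulrAC.
congr (_ * u); rewrite -rmorphM; congr _%:C.
have N0 : ofZ N != 0 :> R.
  by case/and5P: test => _ _ _ /ofZ_gt0 N0 _; rewrite gt_eqF.
have D1 : D != 0 by rewrite gt_eqF.
by move: (ofZ N) N0 => N' N0; field; rewrite N0.
Qed.

Lemma norm_Ni : `|- 'i| = 1 :> C. Proof. by rewrite normrN norm_i. Qed.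
Lemma sqr_Ni : - 'i * - 'i = (ofZ (Zneg xH))%:C :> C.
Proof. by rewrite mulrNN sqr_i. Qed.
Lemma norm_N1 : `|- 1| = 1 :> C. Proof. by rewrite normrN1. Qed.
Lemma sqr_N1 : - 1 * - 1 = (ofZ (Zpos xH))%:C :> C.
Proof. by rewrite mulrNN mulr1. Qed.
Lemma norm_1 : `|1| = 1 :> C. Proof. exact: normr1. Qed.
Lemma sqr_1 : 1 * 1 = (ofZ (Zpos xH))%:C :> C.
Proof. by rewrite mulr1. Qed.

Local Arguments entry_line u D (e k4 k2 k0 n m c)%_Z_scope k j Y%_Z_scope N%_Z_scope Dz.

Let z31 : zr3 := (Zpos 3, Zpos 1).
Let z10 : zr3 := (Zpos 1, Z0).

Lemma delta2E : delta * delta = evr z31.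
Proof. by rewrite delta2 /evr /= mul1r. Qed.

Lemma one2E : 1 * 1 = evr z10 :> R.
Proof. by rewrite mulr1 /evr /= mul0r addr0. Qed.

Local Opaque ofZ lambda decimal.

Lemma relR01 : relR R ord0 (inord 1) = (evr (Zpos 6, Zpos 1) / ofZ 11)%:C * 'i.
Proof.
rewrite /relR /mx24 mxE inordK //= imE -[LHS]mulr1.
by refine (@entry_line _ _ (-1) 121 78 9 39 12 7029 4 2 (Zpos 6, Zpos 1) 11 z10 norm_i sqr_i ltr01 one2E erefl _); vm_compute.
Qed.

Lemma relR02 : relR R ord0 (inord 2) = (evr (Zpos 6, Zpos 1) / ofZ 11)%:C * - 'i.
Proof.
rewrite /relR /mx24 mxE inordK //= (imNE (Zpos 7029)) -[LHS]mulr1.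
by refine (@entry_line _ _ (-1) 121 78 9 39 12 7029 4 2 (Zpos 6, Zpos 1) 11 z10 norm_Ni sqr_Ni ltr01 one2E erefl _); vm_compute.
Qed.

Lemma relRcheck00 : relRcheck R ord0 (inord 0) * delta%:C = (evr (Zpos 276552, Zpos 161904) / ofZ 1248673)%:C * - 1.
Proof.
rewrite /relRcheck /mx24 mxE inordK //= (reNE (Zpos 205052)).
by refine (@entry_line _ _ 1 1559184260929 (-65569974336) 497664 32784987168 18921587616 205052 6 0 (Zpos 276552, Zpos 161904) 1248673 z31 norm_N1 sqr_N1 delta_gt0 delta2E erefl _); vm_compute.
Qed.

Lemma relRcheck01 : relRcheck R ord0 (inord 1) * delta%:C = (evr (Zpos 3, Zpos 6) / ofZ 22)%:C * 'i.
Proof.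
rewrite /relRcheck /mx24 mxE inordK //= imE.
by refine (@entry_line _ _ (-1) 3872 648 27 324 (-12) 27984 5 1 (Zpos 3, Zpos 6) 22 z31 norm_i sqr_i delta_gt0 delta2E erefl _); vm_compute.
Qed.

Lemma relRcheck02 : relRcheck R ord0 (inord 2) * delta%:C = (evr (Zpos 3, Zpos 6) / ofZ 22)%:C * - 'i.
Proof.
rewrite /relRcheck /mx24 mxE inordK //= (imNE (Zpos 27984)).
by refine (@entry_line _ _ (-1) 3872 648 27 324 (-12) 27984 5 1 (Zpos 3, Zpos 6) 22 z31 norm_Ni sqr_Ni delta_gt0 delta2E erefl _); vm_compute.
Qed.

Lemma relRcheck03 : relRcheck R ord0 (inord 3) * delta%:C = (evr (Zpos 1239246, Zpos 748908) / ofZ 1248673)%:C * 1.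
Proof.
rewrite /relRcheck /mx24 mxE inordK //= -[(decimal _ _)%:C]mulr1.
by refine (@entry_line _ _ 1 1559184260929 (-1362157739172) 2305430424 681078869586 391694539050 93378 5 1 (Zpos 1239246, Zpos 748908) 1248673 z31 norm_1 sqr_1 delta_gt0 delta2E erefl _); vm_compute.
Qed.

Lemma relRcheck10 : relRcheck R (inord 1) (inord 0) * delta%:C = (evr (Zpos 131292, Zpos 108072) / ofZ 1248673)%:C * - 1.
Proof.
rewrite /relRcheck /mx24 mxE inordK // inordK //= (reNE (Zpos 11725)).
by refine (@entry_line _ _ 1 1559184260929 (-23898282768) 33872256 11949141384 5476278888 11725 5 1 (Zpos 131292, Zpos 108072) 1248673 z31 norm_N1 sqr_N1 delta_gt0 delta2E erefl _); vm_compute.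
Qed.

Lemma relRcheck11 : relRcheck R (inord 1) (inord 1) * delta%:C = (evr (Zneg 3, Zpos 6) / ofZ 4)%:C * - 'i.
Proof.
rewrite /relRcheck /mx24 mxE inordK // inordK //= (imNE (Zpos 850)).
by refine (@entry_line _ _ (-1) 512 4896 3267 2448 (-1200) 850 3 3 (Zneg 3, Zpos 6) 4 z31 norm_Ni sqr_Ni delta_gt0 delta2E erefl _); vm_compute.
Qed.

Lemma relRcheck12 : relRcheck R (inord 1) (inord 2) * delta%:C = (evr (Zneg 3, Zpos 6) / ofZ 4)%:C * 'i.
Proof.
rewrite /relRcheck /mx24 mxE inordK // inordK //= imE.
by refine (@entry_line _ _ (-1) 512 4896 3267 2448 (-1200) 850 3 3 (Zneg 3, Zpos 6) 4 z31 norm_i sqr_i delta_gt0 delta2E erefl _); vm_compute.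
Qed.

Lemma relRcheck13 : relRcheck R (inord 1) (inord 3) * delta%:C = (evr (Zpos 307449, Zpos 659826) / ofZ 1248673)%:C * 1.
Proof.
rewrite /relRcheck /mx24 mxE inordK // inordK //= -[(decimal _ _)%:C]mulr1.
by refine (@entry_line _ _ 1 3118368521858 (-1989820501362) 313826716467 994910250681 (-61152958395) 53393 5 1 (Zpos 307449, Zpos 659826) 1248673 z31 norm_1 sqr_1 delta_gt0 delta2E erefl _); vm_compute.
Qed.

End Coefficients.

(** * From walks to diagrams *)

Section Relations.
Variables (R : realType) (dim : 'I_9 -> R) (delta : R).
Hypothesis pf : perron_frobenius adj3311 dim delta.
Local Notation C := R[i].
Local Notation s := (Num.sqrt 3 : R).
Local Notation ev := (@ev R).
Local Notation evr := (@evr R).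
Local Notation t := (dim (inord 0)).
Local Notation jw10 := (jones_wenzl adj3311 root3311 dim delta 10).
Local Notation vx := (map (fun v => inord v : 'I_9)).

Lemma map_val_inord (g : seq 'I_9) : vx (map val g) = g.
Proof. by rewrite -map_comp map_id_in // => v _ /=; rewrite inord_val. Qed.

(** A combination of state sums vanishes after attaching the projection if the
    functionals nu annihilate its coefficients, already on the walks from each
    single vertex. *)
Lemma jones_wenzl_relation (psi : seq 'I_9 -> C) (r : 'I_4 -> C) (phi : 'I_4 -> seq 'I_9 -> C) q :
  walk adj3311 11 q ->
  (forall nu, cap_free nu -> forall v, (v < 9)%N ->
     \sum_(p <- walks 10 v) ((psi (vx (v :: p)) - \sum_l r l * phi l (vx (v :: p))) /
        wt dim (vx (v :: p))) * nu (v :: p) = 0) ->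
  jw10 psi q = \sum_l r l * jw10 (phi l) q.
Proof.
move=> wq H; have [nu [nu0 nuE]] := jones_wenzl_pairing root3311 adj3311C pf (delta_ge2 pf) wq.
have cf : cap_free (fun g => nu (vx g)).
  move=> a v b; under eq_bigr do rewrite map_cat /=.
  by apply: nbrs_sum0 (nu0 _ _ _).
apply/eqP; rewrite -subr_eq0; apply/eqP.
rewrite !nuE; under [X in _ - X]eq_bigr do rewrite nuE mulr_sumr.
rewrite exchange_big -sumrB /=.
pose F g := ((psi (vx g) - \sum_l r l * phi l (vx g)) / wt dim (vx g)) * nu (vx g).
transitivity (\sum_(g : 11.-tuple 'I_9 | sorted adj3311 g) F [seq val w | w <- g]).
  apply: eq_bigr => g _; rewrite /F map_val_inord !mulrBl !mulr_suml.
  by congr (_ - _); apply: eq_bigr => l _; rewrite !mulrA.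
rewrite sum_tuple_walks big_seq big1 // => v; rewrite mem_iota => /andP[_ v9].
exact: (H _ cf v v9).
Qed.

(** The values of a box, in units of c, are read off a tree. The dual
    generators satisfy this with the tree of the generator. *)
Definition box_values b (S : gpa3311 R 4 b) (tr : trie) (c : C) : Prop :=
  forall v p, even_vertex v = ~~ b -> path nadj v (rcons p v) -> size p = 7 ->
    hat dim S (vx (v :: p)) = c * ev (getz tr (v :: p)).

Lemma inord_eq (v w : nat) : (v < 9)%N -> (w < 9)%N -> (inord v == inord w :> 'I_9) = (v == w).
Proof. by move=> v9 w9; rewrite -val_eqE /= !inordK. Qed.

Lemma path_lt v p : (v < 9)%N -> path nadj v p -> all (fun w => w < 9)%N p.
Proof.
elim: p v => //= w p IH v v9 /andP[/nbrs_lt/andP[w9 _] wp].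
by rewrite w9 (IH w).
Qed.

Lemma path_vx v p : (v < 9)%N -> path nadj v p -> path adj3311 (inord v) (vx p).
Proof.
elim: p v => //= w p IH v v9 /andP[vw wp]; have /andP[w9 _] := nbrs_lt vw.
by rewrite adj3311E !inordK // [nadj v w]vw (IH w).
Qed.

Section InnerSum.
Variables (b : bool) (S T : gpa3311 R 4 b).

(** Off loops the boxes vanish, so the labels of the inner regions run over
    walks of length 2. *)
Lemma circ_walks q0 q1 q2 q3 q4 q5 q6 q7 q8 q9 : (q0 < 9)%N -> (q5 < 9)%N ->
  \sum_u \sum_w (dim u)%:C * (dim w)%:C *
    hat dim S (inord q0 :: u :: w :: vx [:: q5; q4; q3; q2; q1]) *
    hat dim T (vx [:: q0; q9; q8; q7; q6; q5] ++ [:: w; u]) =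
  \sum_(m <- walks 2 q0 | q5 \in nbrs (last q0 m))
    (dim (inord (nth 0%N m 0)))%:C * (dim (inord (nth 0%N m 1)))%:C *
    hat dim S (vx (q0 :: m ++ [:: q5; q4; q3; q2; q1])) *
    hat dim T (vx ([:: q0; q9; q8; q7; q6; q5] ++ rev m)).
Proof.
move=> q09 q59; pose F (u w : 'I_9) := (dim u)%:C * (dim w)%:C *
    hat dim S (inord q0 :: u :: w :: vx [:: q5; q4; q3; q2; q1]) *
    hat dim T (vx [:: q0; q9; q8; q7; q6; q5] ++ [:: w; u]).
transitivity (\sum_(u | adj3311 (inord q0) u) \sum_(w | adj3311 u w)
    if adj3311 w (inord q5) then F u w else 0).
  rewrite [RHS]big_mkcond; apply: eq_bigr => u _; case: ifP => a1; last first.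
    rewrite big1 // => w _; rewrite hat_out ?mulr0 ?mul0r //.
    by rewrite /loopb /= a1 /= ?andbF.
  rewrite [RHS]big_mkcond; apply: eq_bigr => w _; case: ifP => a2; last first.
    rewrite hat_out ?mulr0 ?mul0r //.
    by rewrite /loopb /= a2 /= ?andbF.
  case: ifP => a3 //; rewrite hat_out ?mulr0 ?mul0r //.
  by rewrite /loopb /= a3 /= ?andbF.
rewrite sum_adj3311 inordK // [RHS]big_mkcond big_walksS big_seq [RHS]big_seq.
apply: eq_bigr => u /nbrs_lt/andP[u9 _].
rewrite sum_adj3311 inordK // big_walksS big_seq [RHS]big_seq.
apply: eq_bigr => w /nbrs_lt/andP[w9 _].
by rewrite big_walks0 adj3311E !inordK.
Qed.

End InnerSum.

Section OneRow.
Variables (b : bool) (S T : gpa3311 R 4 b).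
Variable J : gpa3311 R 4 (~~ b).
Variables (tA tB : trie) (r : row) (cJr cS cT K : C) (w : nat -> C).
Hypothesis HJ : box_values J (if jB r then tB else tA) cJr.
Hypothesis HS : box_values S tA cS.
Hypothesis HT : box_values T tB cT.
Let tq : R := if b then t else t * delta.
Hypothesis KJ : cJr = K * ev (cJ r) * (tq * (1 + s))%:C.
Let t2d : C := (t * (t * delta))%:C.
Hypothesis K0 : - w 0%N * t2d * cS * cS = K * ev (cAA r).
Hypothesis K1 : - w 1%N * t2d * cS * cT = K * ev (cAB r).
Hypothesis K2 : - w 2%N * t2d * cT * cS = K * ev (cBA r).
Hypothesis K3 : - w 3%N * t2d * cT * cT = K * ev (cBB r).

Let left_box (l : nat) := if (l < 2)%N then S else T.
Let right_box (l : nat) := if odd l then T else S.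

Lemma realCM (x y : R) : (x * y)%:C = x%:C * y%:C.
Proof. exact: rmorphM. Qed.

Let z11 : zr3 := (Zpos xH, Zpos xH).

Lemma dnK v : (v < 9)%N -> ev (dn v) * ev (codn v) = (1 + s)%:C.
Proof.
have -> : (1 + s)%:C = ev z11 by congr _%:C; rewrite /evr /= mul1r.
move=> v9; rewrite -evM; congr ev.
have /allP/(_ v) : all (fun v => mulz (dn v) (codn v) == z11) (iota 0 9) by [].
by rewrite mem_iota => /(_ v9)/eqP.
Qed.

Lemma inv_dim v : (v < 9)%N -> even_vertex v = b ->
  ((dim (inord v))%:C)^-1 = ev (codn v) / (tq * (1 + s))%:C.
Proof.
move=> v9 vb; have [_ d0 _] := dims3311 pf; have t0 : 0 < t by case: pf.
have s0 : 0 < 1 + s by have := s_gt1 R; lra.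
have tq0 : tq != 0 by rewrite /tq; case: (b); rewrite lt0r_neq0 // mulr_gt0.
have D0 : (dim (inord v))%:C != 0 :> C by rewrite fmorph_eq0 gt_eqF //; case: pf.
have T0 : (tq * (1 + s))%:C != 0 :> C by rewrite fmorph_eq0 mulf_neq0 // gt_eqF.
apply: (mulfI D0); rewrite mulfV // mulrA; apply: (mulIf T0); rewrite mul1r divfK //.
rewrite (dim_at pf) // vb -/tq !realCM -(dnK v9).
by rewrite -[RHS]mulrA.
Qed.

Lemma dim_edge u v : nadj u v ->
  (dim (inord u))%:C * (dim (inord v))%:C = t2d * (ev (dn u) * ev (dn v)).
Proof.
move=> uv; have /andP[v9 u9] := nbrs_lt uv.
rewrite (dim_at pf u9) (dim_at pf v9) (nadj_parity uv) /t2d /ev.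
by case: (even_vertex u); rewrite /= !realCM; ring.
Qed.

(** Under the matching conditions KJ and K0 to K3 on the units, the
    coefficient of the relation at a walk is, up to a factor of the base
    vertex, the number computed by the row. *)
Lemma relation_walk v p : (v < 9)%N -> even_vertex v = ~~ b -> p \in walks 10 v ->
  (state_sum dim (j_tangle J) (vx (v :: p)) -
     \sum_(l < 4) w l * state_sum dim (circ_tangle (left_box l) (right_box l)) (vx (v :: p))) /
    wt dim (vx (v :: p)) =
  K / (rdim dim (inord v) * rdim dim (inord v) * rdim dim (inord v)) *
    (jval R tA tB r (v :: p) + cval R tA tB r (v :: p)).
Proof.
move=> v9 vb; rewrite mem_walks => /andP[sp vp].
have sq : sorted adj3311 (vx (v :: p)) by exact: path_vx.
have p9 := path_lt v9 vp.
move: p sp vp sq p9 => [|q1 [|q2 [|q3 [|q4 [|q5 [|q6 [|q7 [|q8 [|q9 [|q10 [|? ?]]]]]]]]]]] //.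
move=> _ vp sq p9; rewrite mulrBl (j_tangleE adj3311C pf) // mulr_suml.
under eq_bigr => l _ do rewrite -mulrA (circ_tangleE adj3311C pf) //.
have /and5P[a1 a2 a3 a4 /and5P[a5 a6 a7 a8 /andP[a9 _]]] := p9.
have /andP[a10 _] : (q10 < 9)%N && true by case/and5P: p9 => _ _ _ _ /and5P[_ _ _ _ /andP[_ ->]].
set rd := rdim dim _ * _ * _; rewrite mulrDr /jval /cval !inord_eq // (eq_sym v) andbC (eq_sym q1).
congr (_ + _).
  case: ifP => [/andP[/eqP q91 /eqP q10v]|_]; last by rewrite mulr0.
  have q1b : even_vertex q1 = ~~ ~~ b by rewrite (nadj_parity (proj1 (andP vp))) vb.
  have q1p : path nadj q1 [:: q8; q7; q6; q5; q4; q3; q2; q1].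
    move: vp; rewrite q91 /= !andbT => /and5P[_ h1 h2 h3 /and5P[h4 h5 h6 h7 /andP[h8 _]]].
    by apply/and5P; split; last apply/and4P; last split; rewrite nadjC.
  rewrite (HJ (p := [:: q8; q7; q6; q5; q4; q3; q2]) q1b q1p erefl).
  rewrite (inv_dim a1) ?KJ; last by rewrite q1b negbK.
  have T0 : (tq * (1 + s))%:C != 0 :> C.
    have [_ d0 _] := dims3311 pf; have t0 : 0 < t by case: pf.
    have s0 : 0 < 1 + s by have := s_gt1 R; lra.
    by rewrite fmorph_eq0 mulf_neq0 ?gt_eqF // /tq; case: (b); rewrite // mulr_gt0.
  rewrite -[RHS]mulr1 -(mulfV T0); move: (_^-1) ((tq * (1 + s))%:C) => D' D.
  by move: (rd^-1) => rd'; ring.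
case: ifP => [/eqP q10v|_]; last by rewrite big1 ?oppr0 ?mulr0 // => l _; rewrite mulr0.
pose G l m := (dim (inord (nth 0%N m 0)))%:C * (dim (inord (nth 0%N m 1)))%:C *
    hat dim (left_box l) (vx (v :: m ++ [:: q5; q4; q3; q2; q1])) *
    hat dim (right_box l) (vx ([:: v; q9; q8; q7; q6; q5] ++ rev m)).
transitivity (- \sum_(l < 4) w l * (\sum_(m <- walks 2 v | q5 \in nbrs (last v m)) G l m / rd)).
  congr (- _); apply: eq_bigr => l _; congr (_ * _).
  rewrite -mulr_suml /G -(@circ_walks b) // mulr_suml; apply: eq_bigr => u _.
  by rewrite mulr_suml.
under eq_bigr => l _ do rewrite mulr_sumr.
rewrite exchange_big -sumrN mulr_sumr big_seq_cond [RHS]big_seq_cond.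
apply: eq_bigr => m /andP[]; rewrite mem_walks => /andP[].
move: m => [|m0 [|m1 [|? ?]]] // _ vm m5.
have back x y : nadj x y -> nadj y x by rewrite nadjC.
have m15 : nadj m1 q5 by exact: m5.
move: vm vp; rewrite q10v /= andbT => /andP[g0 g1].
rewrite !andbT => /and5P[h1 h2 h3 h4 /and5P[h5 h6 h7 h8 /andP[h9 h10]]].
have vS : path nadj v [:: m0; m1; q5; q4; q3; q2; q1; v].
  by rewrite /= g0 g1 m15 (back _ _ h1) (back _ _ h2) (back _ _ h3) (back _ _ h4) (back _ _ h5).
have vT : path nadj v [:: q9; q8; q7; q6; q5; m1; m0; v].
  by rewrite /= (back _ _ h6) (back _ _ h7) (back _ _ h8) (back _ _ h9) (back _ _ h10)
    (back _ _ m15) (back _ _ g1) (back _ _ g0).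
pose pS := [:: m0; m1; q5; q4; q3; q2; q1]; pose pT := [:: q9; q8; q7; q6; q5; m1; m0].
have hS := HS (p := pS) vb vS erefl; have hT := HT (p := pS) vb vS erefl.
have hS' := HS (p := pT) vb vT erefl; have hT' := HT (p := pT) vb vT erefl.
have eS (l : nat) : hat dim (left_box l) (vx (v :: pS)) = (if (l < 2)%N then cS else cT) *
    ev (getz (if (l < 2)%N then tA else tB) (v :: pS)).
  by rewrite /left_box; case: ifP.
have eT (l : nat) : hat dim (right_box l) (vx (v :: pT)) = (if odd l then cT else cS) *
    ev (getz (if odd l then tB else tA) (v :: pT)).
  by rewrite /right_box; case: ifP.
have hF (l : nat) : G l [:: m0; m1] = t2d * (ev (dn m0) * ev (dn m1)) *
    ((if (l < 2)%N then cS else cT) *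
      ev (getz (if (l < 2)%N then tA else tB) (v :: pS))) *
    ((if odd l then cT else cS) *
      ev (getz (if odd l then tB else tA) (v :: pT))).
  by rewrite -/pS -/pT -eS -eT -dim_edge.
under eq_bigr do rewrite hF.
rewrite !big_ord_recl big_ord0 /= /bump /=.
set XS := ev (getz tA (v :: pS)); set YS := ev (getz tB (v :: pS)).
set XT := ev (getz tA (v :: pT)); set YT := ev (getz tB (v :: pT)).
rewrite -[w (1 + 0)%N]/(w 1%N) -[w (1 + (1 + 0))%N]/(w 2%N) -[w (1 + (1 + (1 + 0)))%N]/(w 3%N).
transitivity ((- w 0%N * t2d * cS * cS * (XS * XT) + - w 1%N * t2d * cS * cT * (XS * YT) +
   - w 2%N * t2d * cT * cS * (YS * XT) + - w 3%N * t2d * cT * cT * (YS * YT)) *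
   (ev (dn m0) * ev (dn m1)) * rd^-1).
  by ring.
by rewrite K0 K1 K2 K3; ring.
Qed.

(** For base vertices of the other parity all the boxes vanish. *)
Lemma relation_out v p : (v < 9)%N -> even_vertex v != ~~ b -> p \in walks 10 v ->
  (state_sum dim (j_tangle J) (vx (v :: p)) -
     \sum_(l < 4) w l * state_sum dim (circ_tangle (left_box l) (right_box l)) (vx (v :: p))) /
    wt dim (vx (v :: p)) = 0.
Proof.
move=> v9 vb; rewrite mem_walks => /andP[sp vp].
have sq : sorted adj3311 (vx (v :: p)) by exact: path_vx.
move: p sp vp sq => [|q1 [|q2 [|q3 [|q4 [|q5 [|q6 [|q7 [|q8 [|q9 [|q10 [|? ?]]]]]]]]]]] //.
move=> _ /andP[vq1 _] sq; have /andP[q19 _] := nbrs_lt vq1.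
rewrite mulrBl (j_tangleE adj3311C pf) // mulr_suml.
rewrite hat_out ?mul0r ?if_same; last first.
  rewrite /loopb /= dist3311 inordK // (nadj_parity vq1) negbK.
  by rewrite (negbTE (_ : even_vertex v != ~~ b)) // !andbF.
rewrite big1 ?subrr // => l _; rewrite -mulrA (circ_tangleE adj3311C pf) //.
rewrite big1 ?if_same ?mulr0 // => x _; rewrite big1 // => y _.
rewrite hat_out ?mulr0 ?mul0r // /loopb /= dist3311 inordK //.
by move: vb; case: even_vertex => /=; case: (b); rewrite ?andbF.
Qed.

Hypothesis checked_row : forall v, (v < 9)%N -> even_vertex v = ~~ b ->
  exists cert, check_row tA tB r v cert.

Lemma jellyfish_row q : walk adj3311 11 q ->
  jw10 (state_sum dim (j_tangle J)) q =
  \sum_(l < 4) w l * jw10 (state_sum dim (circ_tangle (left_box l) (right_box l))) q.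
Proof.
move=> wq; apply: (jones_wenzl_relation (r := fun l : 'I_4 => w l)
  (phi := fun l : 'I_4 => state_sum dim (circ_tangle (left_box l) (right_box l))) wq).
move=> nu nu0 v v9; case: (eqVneq (even_vertex v) (~~ b)) => [vb|nb]; last first.
  by rewrite big_seq big1 // => p vp; rewrite relation_out ?mul0r.
rewrite big_seq; under eq_bigr => p vp do rewrite relation_walk // -mulrA.
have [cert cv] := checked_row v9 vb.
by rewrite -big_seq -mulr_sumr (check_row_sound nu0 v9 cv) mulr0.
Qed.

End OneRow.

End Relations.

(** * The four relations *)

Section BottomElements.
Variables (R : realType) (V : finType) (adj : rel V) (rt : V).
Hypothesis adjC : symmetric adj.

Lemma bottom_walk n b (g : loop adj rt n.+1 b) :
  walk adj (n.*2).+3 (nth rt (loop_seq g) 0 :: rev (loop_seq g)).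
Proof.
rewrite /loop_seq; case: g => t /= /andP[ct _].
rewrite /walk /= size_rev size_tuple eqxx /=.
case: t ct => -[|x p] //= sp ct.
have -> : path adj x (rev (x :: p)) = sorted adj (rev (x :: rcons p x)).
  by rewrite -rcons_cons rev_rcons.
by rewrite rev_sorted (eq_sorted (_ : _ =2 adj)) // => y z; rewrite adjC.
Qed.

Lemma bottom_relation n b (psi : seq V -> R[i]) m (w : 'I_m -> R[i]) (phi : 'I_m -> seq V -> R[i]) :
  (forall q, walk adj (n.*2).+3 q -> psi q = \sum_l w l * phi l q) ->
  bottom_elt adj rt n.+1 b psi = \sum_l w l *: bottom_elt adj rt n.+1 b (phi l).
Proof.
move=> H; apply/ffunP => g; rewrite ffunE sum_ffunE H ?bottom_walk //.
by apply: eq_bigr => l _; rewrite !ffunE.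
Qed.

End BottomElements.

Section Rows.
Variables (R : realType) (dim : 'I_9 -> R) (delta kappa : R).
Hypothesis pf : perron_frobenius adj3311 dim delta.
Local Notation C := R[i].
Local Notation s := (Num.sqrt 3 : R).
Local Notation ev := (@ev R).
Local Notation evr := (@evr R).
Local Notation t := (dim (inord 0)).
Local Notation vx := (map (fun v => inord v : 'I_9)).
Local Notation jw10 := (jones_wenzl adj3311 root3311 dim delta 10).
Variables (A B : gpa3311 R 4 false).
Hypothesis AB : generators3311 dim kappa A B.
Local Notation mu := (unit_value dim delta kappa).

Lemma box_valuesA : box_values dim A treeA mu.
Proof.
move=> v p vb vp sp; apply: nhatA AB _ _ vb _ sp => //.
by move: vp; rewrite rcons_path => /andP[].
Qed.

Lemma box_valuesB : box_values dim B treeB mu.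
Proof.
move=> v p vb vp sp; apply: nhatB AB _ _ vb _ sp => //.
by move: vp; rewrite rcons_path => /andP[].
Qed.

(** The Fourier transform rotates loops, and a loop based at an odd vertex is
    looked up after the same rotation. *)
Lemma box_values_checked (S : gpa3311 R 4 false) tr sigma c : box_values dim S tr c ->
  box_values dim (b := true) (checked dim sigma S) tr (sigma^-1 * c).
Proof.
move=> HS v [|u p] vb vp sp //.
have sv : size [seq inord w : 'I_9 | w <- v :: u :: p] = 8 by rewrite size_map; exact: (congr1 succn sp).
have hF : hat dim (b := true) (fourier dim S) (vx (v :: u :: p)) = _ := hat_fourier pf bip3311 S sv.
rewrite /checked hat_scale hF -map_rot /rot /= -mulrA.
congr (_ * _); case/andP: vp => vu up.
have ub : even_vertex u = ~~ false by rewrite (nadj_parity vu) vb.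
rewrite cats1 HS //; last 2 first.
- by rewrite rcons_path last_rcons [nadj v u]vu andbT; exact: up.
- by move: sp; rewrite size_rcons.
by rewrite /getz [head _ _]/= [head _ (v :: _)]/= ub vb /rot /= cats1.
Qed.

Hypothesis kappa1 : kappa = 1.

Lemma rows_nz : [/\ t != 0, delta != 0 & 1 + s != 0].
Proof.
have [_ d0 _] := dims3311 pf; have s1 := s_gt1 R.
by split; rewrite gt_eqF //; [case: pf | lra].
Qed.

Lemma unit_valueK : mu * (24 * (t * t * t) * (delta * delta) * ((1 + s) * (1 + s)))%:C = 1.
Proof.
have [t0 d0 S0] := rows_nz; rewrite /unit_value kappa1 -realCM div1r mulVf //.
by rewrite !mulf_neq0 // pnatr_eq0.
Qed.

Lemma checked_rows v : (v < 9)%N -> exists c,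
  check_row treeA treeB (rows_at v).1 v c.1 && check_row treeA treeB (rows_at v).2 v c.2.
Proof.
move=> v9; have /and4P[_ _ _ /allP/(_ v)] := check_true.
by rewrite mem_iota => /(_ v9) cv; exists (nth ([::], [::]) certificates v).
Qed.

(** The product of two boxes carries the unit t^2 delta mu^2 and the box in j
    carries sigma^-1 mu / (t delta (1 + sqrt 3)); by unit_valueK their
    quotient is sigma / (24 (1 + sqrt 3)), which explains the coefficient of
    j. *)
Lemma even_relation (r : row) N (w : nat -> C) sigma :
  sigma != 0 -> ofZ N != 0 :> R -> cJ r = mulz (Zpos 24, Zpos 24) (N, Z0) ->
  - (sigma * w 0%N) * (ofZ N)%:C = ev (cAA r) ->
  - (sigma * w 1%N) * (ofZ N)%:C = ev (cAB r) ->
  - (sigma * w 2%N) * (ofZ N)%:C = ev (cBA r) ->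
  - (sigma * w 3%N) * (ofZ N)%:C = ev (cBB r) ->
  (r = even_rows.1 \/ r = even_rows.2) ->
  forall q, walk adj3311 11 q ->
  jw10 (state_sum dim (j_tangle (checked dim sigma (if jB r then B else A)))) q =
  \sum_(l < 4) w l * jw10 (state_sum dim
    (circ_tangle (if (l < 2)%N then A else B) (if odd l then B else A))) q.
Proof.
move=> s0 N0 cJE w0 w1 w2 w3 rE q wq.
have [t0 d0 S0] := rows_nz.
have cJE' : ev (cJ r) = (24 * (1 + s) * ofZ N)%:C.
  rewrite cJE evM realCM; congr (_ * _); last by rewrite /ev evr_int.
  by congr _%:C; rewrite /evr mulrDr mulr1.
have D0 : (t * delta * (1 + s))%:C * ev (cJ r) != 0.
  by rewrite cJE' -realCM fmorph_eq0 !mulf_neq0 // pnatr_eq0.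
(* K is forced by the matching condition for the term with j. *)
pose K := sigma^-1 * mu / ((t * delta * (1 + s))%:C * ev (cJ r)).
have coef x : - x * (t * (t * delta))%:C * mu * mu = K * (- (sigma * x) * (ofZ N)%:C).
  apply: (mulIf D0); rewrite [RHS]mulrAC divfK //.
  apply: (mulIf s0); rewrite cJE'.
  transitivity (- x * sigma * mu * (ofZ N)%:C * (mu * (24 * (t * t * t) * (delta * delta) * ((1 + s) * (1 + s)))%:C)).
    by rewrite !realCM; ring.
  by rewrite unit_valueK; move: mu (ofZ N)%:C => m n; field.
apply: (jellyfish_row (b := false) (tA := treeA) (tB := treeB) (r := r)
  (cJr := sigma^-1 * mu) (cS := mu) (cT := mu) (K := K) pf _ box_valuesA box_valuesB) wq.
- by case: (jB r); apply: box_values_checked; [exact: box_valuesB | exact: box_valuesA].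
- by rewrite /K -[RHS]mulrA [X in _ = _ * X]mulrC divfK.
- by rewrite coef w0.
- by rewrite coef w1.
- by rewrite coef w2.
- by rewrite coef w3.
move=> v v9 vb; have [c] := checked_rows v9; rewrite /rows_at vb => /andP[c1 c2].
by case: rE => ->; [exists c.1 | exists c.2].
Qed.

(** As before, with the base vertices of the boxes exchanged: the unit of j
    has no factor delta in the denominator, which gives the factor delta of
    the entries and delta^2 in the coefficient of j. *)
Lemma odd_relation (r : row) N (w : nat -> C) sA sB :
  ofZ N != 0 :> R -> cJ r = mulz (Zpos 144, Zpos 96) (N, Z0) ->
  - (w 0%N * delta%:C) * (sA^-1 * sA^-1) * (ofZ N)%:C = ev (cAA r) ->
  - (w 1%N * delta%:C) * (sA^-1 * sB^-1) * (ofZ N)%:C = ev (cAB r) ->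
  - (w 2%N * delta%:C) * (sB^-1 * sA^-1) * (ofZ N)%:C = ev (cBA r) ->
  - (w 3%N * delta%:C) * (sB^-1 * sB^-1) * (ofZ N)%:C = ev (cBB r) ->
  (r = odd_rows.1 \/ r = odd_rows.2) ->
  forall q, walk adj3311 11 q ->
  jw10 (state_sum dim (j_tangle (if jB r then B else A))) q =
  \sum_(l < 4) w l * jw10 (state_sum dim
    (circ_tangle (if (l < 2)%N then checked dim sA A else checked dim sB B)
                 (if odd l then checked dim sB B else checked dim sA A))) q.
Proof.
move=> N0 cJE w0 w1 w2 w3 rE q wq.
have [t0 d0 S0] := rows_nz; have [dd _ _] := dims3311 pf.
have cJE' : ev (cJ r) = (24 * (delta * delta) * (1 + s) * ofZ N)%:C.
  rewrite cJE evM realCM; congr (_ * _); last by rewrite /ev evr_int.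
  congr _%:C; rewrite dd; transitivity (24 * (3 + 4 * s + s * s)); last by ring.
  rewrite sqrt3K /evr -[(_, _).1]/(Zpos 144) -[(_, _).2]/(Zpos 96).
  have -> : ofZ 144 = 144 :> R by []. have -> : ofZ 96 = 96 :> R by [].
  by ring.
have D0 : (t * (1 + s))%:C * ev (cJ r) != 0.
  by rewrite cJE' -realCM fmorph_eq0 !mulf_neq0 // pnatr_eq0.
pose K := mu / ((t * (1 + s))%:C * ev (cJ r)).
have coef x a b : - x * (t * (t * delta))%:C * (a * mu) * (b * mu) =
    K * (- (x * delta%:C) * (a * b) * (ofZ N)%:C).
  apply: (mulIf D0); rewrite [RHS]mulrAC divfK // cJE'.
  transitivity (- (x * delta%:C) * (a * b) * mu * (ofZ N)%:C *
      (mu * (24 * (t * t * t) * (delta * delta) * ((1 + s) * (1 + s)))%:C)).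
    by rewrite !realCM; ring.
  by rewrite unit_valueK; ring.
apply: (jellyfish_row (b := true) (tA := treeA) (tB := treeB) (r := r)
  (cJr := mu) (cS := sA^-1 * mu) (cT := sB^-1 * mu) (K := K) pf _
  (box_values_checked _ box_valuesA) (box_values_checked _ box_valuesB)) wq.
- by case: (jB r); [exact: box_valuesB | exact: box_valuesA].
- by rewrite /K -[RHS]mulrA [X in _ = _ * X]mulrC divfK.
- by rewrite coef w0.
- by rewrite coef w1.
- by rewrite coef w2.
- by rewrite coef w3.
move=> v v9 vb; have [c] := checked_rows v9; rewrite /rows_at vb => /andP[c1 c2].
by case: rE => ->; [exists c.1 | exists c.2].
Qed.

End Rows.

Section Assembly.
Variables (R : realType) (dim : 'I_9 -> R) (delta kappa : R).
Hypothesis pf : perron_frobenius adj3311 dim delta.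
Local Notation C := R[i].
Local Notation s := (Num.sqrt 3 : R).
Local Notation ev := (@ev R).
Local Notation evr := (@evr R).
Variables (A B : gpa3311 R 4 false).
Hypothesis AB : generators3311 dim kappa A B.

Local Opaque ofZ.

(** Clearing the denominator k N0 of an entry; v collects the eigenvalues
    sigma. *)
Lemma coefE (w u v : C) Y N0 N k g z :
  w = (evr Y / ofZ N0)%:C * u -> u * v = ev g -> Z.ltb 0 N0 ->
  N = Z.mul k N0 -> z = oppz (mulz g (mulz (k, Z0) Y)) -> - w * v * (ofZ N)%:C = ev z.
Proof.
move=> -> uv N0_gt0 -> ->; have N0_nz : ofZ N0 != 0 :> R by rewrite gt_eqF // ofZ_gt0.
rewrite evN !evM -uv ofZM /ev evr_int.
transitivity (- ((evr Y / ofZ N0 * ofZ N0)%:C * (u * v * (ofZ k)%:C))).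
  by rewrite !realCM; ring.
by rewrite divfK //; ring.
Qed.

Lemma ev_N1 : ev (oppz z1) = - 1. Proof. by rewrite evN ev1. Qed.
Lemma ii : 'i * 'i = - 1 :> C.
Proof. by rewrite sqr_i -ev_N1 /ev evr_int. Qed.
Lemma iV : 'i^-1 = - 'i :> C.
Proof.
have i0 : 'i != 0 :> C by rewrite -normr_eq0 norm_i oner_eq0.
by apply: (mulfI i0); rewrite mulfV // mulrN ii opprK.
Qed.

Local Notation w0 := (fun l : nat => relR R ord0 (inord l)).
Local Notation w1 := (fun l : nat => relR R (inord 1) (inord l)).
Local Notation v0 := (fun l : nat => relRcheck R ord0 (inord l)).
Local Notation v1 := (fun l : nat => relRcheck R (inord 1) (inord l)).
Local Notation jw10 := (jones_wenzl adj3311 root3311 dim delta 10).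

Lemma even_row0 q : walk adj3311 11 q ->
  jw10 (state_sum dim (j_tangle (checked dim 'i A))) q =
  \sum_(l < 4) w0 l * jw10 (state_sum dim
    (circ_tangle (if (l < 2)%N then A else B) (if odd l then B else A))) q.
Proof.
have N0 : ofZ 11 != 0 :> R by rewrite gt_eqF // ofZ_gt0.
have i0 : 'i != 0 :> C by rewrite -normr_eq0 norm_i oner_eq0.
have z00 l : (l == 0%N) || (l == 3%N) -> relR R ord0 (inord l) = 0.
  by case/orP=> /eqP ->; rewrite /relR /mx24 mxE inordK.
refine (even_relation (r := even_rows.1) (w := w0) pf AB (kappa1 pf AB) i0 N0 erefl _ _ _ _ (or_introl erefl) (q := q)).
- by rewrite z00 // mulr0 oppr0 mul0r ev0.
- rewrite [X in - X]mulrC -mulNr.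
  by apply: (coefE (g := (oppz z1)) (k := Zpos 1) (relR01 R)); rewrite ?ev_N1 ?ii.
- rewrite [X in - X]mulrC -mulNr.
  by apply: (coefE (g := z1) (k := Zpos 1) (relR02 R)); rewrite ?ev1 ?mulNr ?ii ?opprK.
- by rewrite z00 // mulr0 oppr0 mul0r ev0.
Qed.

Lemma relR1 l : (l < 4)%N -> relR R (inord 1) (inord l) = (evr (nth z0
  [:: (Zneg 137208, Zneg 77672); (Zneg 33708, Zneg 32332); (Zneg 33708, Zneg 32332);
      (Zpos 52626, Zpos 80142)] l) / ofZ 172163)%:C * 1.
Proof.
move=> l4; rewrite /relR /mx24 mxE !inordK // mulr1.
by move: l l4 => [|[|[|[|//]]]] _ /=; rewrite /evr ?mulNr -?ofZN ?mulNr.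
Qed.

Lemma even_row1 q : walk adj3311 11 q ->
  jw10 (state_sum dim (j_tangle (checked dim 1 B))) q =
  \sum_(l < 4) w1 l * jw10 (state_sum dim
    (circ_tangle (if (l < 2)%N then A else B) (if odd l then B else A))) q.
Proof.
have N0 : ofZ 172163 != 0 :> R by rewrite gt_eqF // ofZ_gt0.
have o0 : 1 != 0 :> C by exact: oner_neq0.
have uv : 1 * 1 = ev z1 by rewrite mulr1 ev1.
refine (even_relation (r := even_rows.2) (w := w1) pf AB (kappa1 pf AB) o0 N0 erefl _ _ _ _ (or_intror erefl) (q := q)).
- by rewrite mul1r -[- _]mulr1; apply: (coefE (k := Zpos 1) (relR1 (l := 0) isT) uv).
- by rewrite mul1r -[- _]mulr1; apply: (coefE (k := Zpos 1) (relR1 (l := 1) isT) uv).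
- by rewrite mul1r -[- _]mulr1; apply: (coefE (k := Zpos 1) (relR1 (l := 2) isT) uv).
- by rewrite mul1r -[- _]mulr1; apply: (coefE (k := Zpos 1) (relR1 (l := 3) isT) uv).
Qed.

Lemma odd_row0 q : walk adj3311 11 q ->
  jw10 (state_sum dim (j_tangle A)) q =
  \sum_(l < 4) v0 l * jw10 (state_sum dim
    (circ_tangle (if (l < 2)%N then checked dim 'i A else checked dim 1 B)
                 (if odd l then checked dim 1 B else checked dim 'i A))) q.
Proof.
have [d2 d0 _] := dims3311 pf.
have N0 : ofZ (Z.mul 22 1248673) != 0 :> R by rewrite gt_eqF // ofZ_gt0.
refine (odd_relation (r := odd_rows.1) (w := v0) pf AB (kappa1 pf AB) N0 erefl _ _ _ _ (or_introl erefl) (q := q)).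
- by apply: (coefE (k := Zpos 22) (g := z1) (relRcheck00 d0 d2)); rewrite ?ev1 ?iV ?mulrNN ?ii ?mulrNN ?mulr1.
- by apply: (coefE (k := Zpos 1248673) (g := z1) (relRcheck01 d0 d2)); rewrite ?ev1 ?iV ?invr1 ?mulr1 ?mulrN ?ii ?opprK.
- by apply: (coefE (k := Zpos 1248673) (g := (oppz z1)) (relRcheck02 d0 d2)); rewrite ?ev_N1 ?iV ?invr1 ?mul1r ?mulrNN ?ii.
- by apply: (coefE (k := Zpos 22) (g := z1) (relRcheck03 d0 d2)); rewrite ?ev1 ?invr1 ?mulr1.
Qed.

Lemma odd_row1 q : walk adj3311 11 q ->
  jw10 (state_sum dim (j_tangle B)) q =
  \sum_(l < 4) v1 l * jw10 (state_sum dim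
    (circ_tangle (if (l < 2)%N then checked dim 'i A else checked dim 1 B)
                 (if odd l then checked dim 1 B else checked dim 'i A))) q.
Proof.
have [d2 d0 _] := dims3311 pf.
have N0 : ofZ (Z.mul 4 1248673) != 0 :> R by rewrite gt_eqF // ofZ_gt0.
refine (odd_relation (r := odd_rows.2) (w := v1) pf AB (kappa1 pf AB) N0 erefl _ _ _ _ (or_intror erefl) (q := q)).
- by apply: (coefE (k := Zpos 4) (g := z1) (relRcheck10 d0 d2)); rewrite ?ev1 ?iV ?mulrNN ?ii ?mulrNN ?mulr1.
- by apply: (coefE (k := Zpos 1248673) (g := (oppz z1)) (relRcheck11 d0 d2)); rewrite ?ev_N1 ?iV ?invr1 ?mulr1 ?mulrNN ?ii.
- by apply: (coefE (k := Zpos 1248673) (g := z1) (relRcheck12 d0 d2)); rewrite ?ev1 ?iV ?invr1 ?mul1r ?mulrN ?ii ?opprK.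
- by apply: (coefE (k := Zpos 4) (g := z1) (relRcheck13 d0 d2)); rewrite ?ev1 ?invr1 ?mulr1.
Qed.

End Assembly.

Theorem lemma4p10 (R : realType) (dim : 'I_9 -> R) (delta : R)
    (hdim : perron_frobenius adj3311 dim delta) (kappa : R)
    (A B : gpa3311 R 4 false) (hAB : generators3311 dim kappa A B) :
  let Acheck : gpa3311 R 4 true := checked dim 'i A in
  let Bcheck : gpa3311 R 4 true := checked dim 1 B in
  (forall k : 'I_2,
     tnth (j_column dim delta Acheck Bcheck) k =
     \sum_(l < 4) relR R k l *: tnth (circ_column dim delta A B) l) /\
  (forall k : 'I_2,
     tnth (j_column dim delta A B) k =
     \sum_(l < 4) relRcheck R k l *: tnth (circ_column dim delta Acheck Bcheck) l).
Proof.
have column (b : bool) (S T : gpa3311 R 4 b) (l : 'I_4) : tnth (circ_column dim delta S T) l =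
    bottom_elt adj3311 root3311 5 b (jones_wenzl adj3311 root3311 dim delta 10
      (state_sum dim (circ_tangle (if (l < 2)%N then S else T) (if odd l then T else S)))).
  by case: l => [[|[|[|[|//]]]] l4]; rewrite (tnth_nth 0).
have row (M : 'M[R[i]]_(2, 4)) (b : bool) (S T : gpa3311 R 4 b) k psi :
    (forall q, walk adj3311 11 q -> jones_wenzl adj3311 root3311 dim delta 10 psi q =
       \sum_(l < 4) M k (inord l) * jones_wenzl adj3311 root3311 dim delta 10
         (state_sum dim (circ_tangle (if (l < 2)%N then S else T) (if odd l then T else S))) q) ->
    bottom_elt adj3311 root3311 5 b (jones_wenzl adj3311 root3311 dim delta 10 psi) =
    \sum_(l < 4) M k l *: tnth (circ_column dim delta S T) l.
  move=> H; rewrite (bottom_relation root3311 adj3311C (n := 4) (w := fun l : 'I_4 => M k (inord l)) b H).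
  by apply: eq_bigr => l _; rewrite column inord_val.
have k2 (k : 'I_2) : k = ord0 \/ k = inord 1.
  by case: k => [[|[|//]] k2]; [left | right]; apply: val_inj; rewrite //= inordK.
move=> Acheck Bcheck; split=> k; case: (k2 k) => ->; rewrite (tnth_nth 0) ?inordK //=.
- exact: (row _ false _ _ _ _ (even_row0 hdim hAB)).
- exact: (row _ false _ _ _ _ (even_row1 hdim hAB)).
- exact: (row _ true _ _ _ _ (odd_row0 hdim hAB)).
- exact: (row _ true _ _ _ _ (odd_row1 hdim hAB)).
Qed.
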